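(* Let $k$ be a field, $n\ge1$, and let $b,d$ be integers with $b\ge -n$ and $d\ge b+n+1$. Let $\kappa_{p,q}$ denote the graded Betti numbers of the line bundle $\mathcal{O}_{\mathbb{P}^n}(b)$ with respect to the Veronese embedding of $\mathbb{P}^n$ of degree $d$ over $k$. Then the first non-zero entry on the $n$-th row (that is, the entry $\kappa_{p,n}\neq0$ with $p\ge0$ smallest) is the one with $p=\binom{d+n}{d}-\binom{d-b-1}{n}-n$, and it equals $$\kappa_{\binom{d+n}{d}-\binom{d-b-1}{n}-n,\;n}=\binom{\binom{b+2n+1}{n}+\binom{d-b-1}{n}-2}{\binom{d-b-1}{n}-1}.$$
   Context: Let $V=H^0(\mathbb{P}^n,\mathcal{O}(d))$ and let $M=\bigoplus_{i\ge0}M_i$ with $M_i=H^0(\mathbb{P}^n,\mathcal{O}(b+id))$, a graded module over the symmetric algebra $S^*V$. Then $\kappa_{p,q}$ is the number of degree $p+q$ generators of the $p$-th free module in the minimal graded free resolution of $M$ over $S^*V$, i.e. the $k$-dimension of the degree $p+q$ part of $\mathrm{Tor}_p^{S^*V}(M,k)$. Equivalently, it is the dimension of the homology at the middle term of $\bigwedge^{p+1}V\otimes M_{q-1}\to\bigwedge^pV\otimes M_q\to\bigwedge^{p-1}V\otimes M_{q+1}$ with Koszul differentials $v_1\wedge\dots\wedge v_p\otimes w\mapsto\sum_{i}(-1)^iv_1\wedge\dots\wedge\widehat{v_i}\wedge\dots\wedge v_p\otimes v_iw$. *)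

(* Defs.v *)
From HB Require Import structures.
From mathcomp Require Import all_boot all_order all_algebra.
From mathcomp.multinomials Require Import mpoly.

Set Implicit Arguments.
Unset Strict Implicit.
Unset Printing Implicit Defensive.

Import Order.TTheory GRing.Theory Num.Theory.
Local Open Scope ring_scope.

(* An element of /\V (x) W is given by its coefficients in W on the basis     *)
(* e_S = e_(s_1) /\ ... /\ e_(s_p), S = {s_1 < ... < s_p}, where e is the     *)
(* chosen basis vbasis {:V} of V.                                             *)
Notation extmod V W := {ffun {set 'I_(\dim (fullv : {vspace V}))} -> W}.

Section Koszul.
Variables (k : fieldType) (V : vectType k).

Local Notation N := (\dim (fullv : {vspace V})).
Local Notation e := (vbasis (fullv : {vspace V})).

Section Degree.
Variable W : vectType k.
Implicit Types (f : extmod V W) (w : W).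

Definition extmod_off (p : nat) f : extmod V W :=
  [ffun S : {set 'I_N} => if #|S| == p then 0 else f S].

Fact extmod_off_linear p : linear (extmod_off p).
Proof.
move=> c f g; apply/ffunP=> S; rewrite !ffunE.
by case: ifP => _; rewrite ?scaler0 ?addr0.
Qed.

HB.instance Definition _ p :=
  GRing.isLinear.Build k (extmod V W) (extmod V W) _ (extmod_off p)
    (@extmod_off_linear p).

(* /\^p V (x) W *)
Definition extpow (p : nat) : {vspace extmod V W} :=
  lker (linfun (extmod_off p)).

Lemma extpowP p f :
  reflect (forall S : {set 'I_N}, #|S| != p -> f S = 0) (f \in extpow p).
Proof.
rewrite memv_ker lfunE /=; apply: (iffP eqP) => [/ffunP f0 S /negbTE Sp|f0].
  by have := f0 S; rewrite !ffunE Sp.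
by apply/ffunP=> S; rewrite !ffunE; case: ifPn => // /f0.
Qed.

(* v_1 /\ ... /\ v_p (x) w: the coefficient on e_S is the minor of the        *)
(* coordinate matrix of the v_i on the columns S.                             *)
Definition wedge (p : nat) (v : 'I_p -> V) (w : W) : extmod V W :=
  [ffun S : {set 'I_N} => if #|S| == p then
     \det (\matrix_(i < p, j < p) nth 0 [seq coord e s (v i) | s <- enum S] j)
       *: w
   else 0].

Lemma wedge_extpow p v w : @wedge p v w \in extpow p.
Proof. by apply/extpowP=> S /negbTE Sp; rewrite ffunE Sp. Qed.

End Degree.

Section Differential.
Variables (W W' : vectType k) (mul : V -> 'Hom(W, W')).

(* The term of index s comes from removing e_s from e_(s |: T), in which it   *)
(* sits in position #|[set t in s |: T | t <= s]|, counting from 1.           *)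
Definition koszul_fun (f : extmod V W) : extmod V W' :=
  [ffun T : {set 'I_N} => \sum_(s : 'I_N | s \notin T)
     (-1) ^+ #|[set t in s |: T | (t <= s)%N]| *: mul e`_s (f (s |: T))].

Fact koszul_fun_linear : linear koszul_fun.
Proof.
move=> c f g; apply/ffunP=> T; rewrite !ffunE scaler_sumr -big_split /=.
apply: eq_bigr => s _; rewrite !ffunE linearP scalerDr !scalerA.
by rewrite (mulrC c).
Qed.

HB.instance Definition _ :=
  GRing.isLinear.Build k (extmod V W) (extmod V W') _ koszul_fun
    koszul_fun_linear.

Definition koszul : 'Hom(extmod V W, extmod V W') := linfun koszul_fun.

Lemma koszul_extpow p f : f \in extpow W p.+1 -> koszul f \in extpow W' p.
Proof.
move=> /extpowP f0; apply/extpowP=> T Tp; rewrite lfunE ffunE big1 // => s sT.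
by rewrite f0 ?linear0 ?scaler0 // cardsU1 sT.
Qed.

End Differential.

Lemma enum_setD1 (S : {set 'I_N}) s : s \in S ->
  let j := #|[set t in S | (t < s)%N]| in
  [/\ (j < #|S|)%N, enum S = take j (enum (S :\ s)) ++ s :: drop j (enum (S :\ s))
    & (j <= size (enum (S :\ s)))%N].
Proof.
move=> sS j.
have sub_enum (P : pred 'I_N) : enum [set t in S | P t] = filter P (enum S).
  rewrite /enum_mem -filter_predI; apply: eq_filter => t.
  by rewrite !inE andbC.
have srt : sorted (fun x y : 'I_N => (x < y)%N) (enum S).
  apply: (@subseq_sorted _ _ _ _ (enum 'I_N)).
  - by move=> x y z; apply: ltn_trans.
  - by rewrite {1}/enum_mem -enumT filter_subseq.
  by have := iota_ltn_sorted 0 N; rewrite -val_enum_ord sorted_map.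
have -> : enum (S :\ s) = filter (predC1 s) (enum S).
  by rewrite -sub_enum; apply: eq_enum => t; rewrite !inE andbC.
have -> : j = size (filter (fun t : 'I_N => (t < s)%N) (enum S)).
  by rewrite -sub_enum -cardE.
have : s \in enum S by rewrite mem_enum.
rewrite (cardE S); move: srt; move: (enum S) => E srt sE.
case/splitPr: sE srt => p1 p2.
rewrite sorted_pairwise; last by move=> x y z; apply: ltn_trans.
rewrite pairwise_cat /= allrel_consr => /and3P[/andP[lt1 _] _ /andP[lt2 _]].
have f1 : filter (fun t : 'I_N => (t < s)%N) (p1 ++ s :: p2) = p1.
  rewrite filter_cat /= ltnn (all_filterP lt1) -[RHS]cats0; congr cat.
  rewrite -(filter_pred0 p2); apply: eq_in_filter => t /(allP lt2) /=.
  by move=> /ltnW; rewrite leqNgt => /negbTE.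
have f2 : filter (predC1 s) (p1 ++ s :: p2) = p1 ++ p2.
  rewrite filter_cat /= eqxx /=; congr cat; apply/all_filterP/allP=> t.
    by move=> /(allP lt1) /=; apply: contraL => /eqP->; rewrite ltnn.
  by move=> /(allP lt2) /=; apply: contraL => /eqP->; rewrite ltnn.
rewrite f1 f2 take_size_cat // drop_size_cat // !size_cat /= addnS ltnS.
by rewrite leq_addr.
Qed.

(* The basis-free formula for koszul. With 1-based indices:                   *)
(*   v_1 /\ ... /\ v_p (x) w |->                                              *)
(*     sum_i (-1)^i v_1 /\ ... (no v_i) ... /\ v_p (x) v_i w.                 *)
Lemma koszul_wedge (W W' : vectType k) (mul : {linear V -> 'Hom(W, W')})
    (p : nat) (v : 'I_p.+1 -> V) (w : W) :
  koszul mul (wedge v w) =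
    \sum_(i < p.+1) (-1) ^+ i.+1 *: wedge (fun j => v (lift i j)) (mul (v i) w).
Proof.
apply/ffunP=> T; rewrite lfunE ffunE sum_ffunE.
have [Tp|Tp] := eqVneq #|T| p; last first.
  rewrite !big1 // => [i _|s sT]; first by rewrite !ffunE (negbTE Tp) scaler0.
  by rewrite ffunE cardsU1 sT eqSS (negbTE Tp) linear0 scaler0.
pose c s i : k := coord e s (v i).
pose D (i : 'I_p.+1) : k := \det (\matrix_(i' < p, j < p)
  nth 0 [seq c s (lift i i') | s <- enum T] j).
have main (s : 'I_N) : \sum_(i < p.+1) (-1) ^+ i.+1 * (c s i * D i) =
    if s \notin T then (-1) ^+ #|[set t in s |: T | (t <= s)%N]| *
      \det (\matrix_(i < p.+1, j < p.+1)
        nth 0 [seq c t i | t <- enum (s |: T)] j) else 0.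
  case: ifPn => [sT|]; last first.
    rewrite negbK => sT; have := sT; rewrite -mem_enum => /(nthP s)[j0].
    rewrite -cardE Tp => j0p Es.
    pose A : 'M[k]_p.+1 := \matrix_(i, j)
      (if unlift ord0 j is Some j' then nth 0 [seq c s i | s <- enum T] j'
       else c s i).
    transitivity (- \det A); last first.
      rewrite -det_tr (@determinant_alternate _ _ _ ord0 (lift ord0 (Ordinal j0p))).
      - by rewrite oppr0.
      - by rewrite -val_eqE.
      move=> i; rewrite !mxE unlift_none liftK (nth_map s) /= ?Es //.
      by rewrite -cardE Tp.
    rewrite (expand_det_col _ ord0) -sumrN; apply: eq_bigr => i _.
    rewrite mxE unlift_none /cofactor addn0 exprS mulN1r mulNr mulrCA.
    congr (- (_ * (_ * \det _))); apply/matrixP=> i' j.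
    by rewrite !mxE liftK.
  have sS : s \in s |: T by rewrite setU11.
  have [jlt Eq jle] := enum_setD1 sS; move: jlt Eq jle.
  rewrite setU1K //; set j := #|_| => jlt Eq jle.
  have -> : #|[set t in s |: T | (t <= s)%N]| = j.+1.
    rewrite (cardsD1 s) !inE eqxx leqnn /= add1n; congr _.+1.
    apply: eq_card => t; rewrite !inE.
    by rewrite ltn_neqAle val_eqE; case: (t == s); rewrite ?andbF ?andbT.
  have jp : (j < p.+1)%N by move: jlt; rewrite cardsU1 sT Tp.
  rewrite (expand_det_col _ (Ordinal jp)) mulr_sumr; apply: eq_bigr => i _.
  rewrite mxE Eq map_cat nth_cat size_map size_takel // ltnn subnn /=.
  rewrite /cofactor /= [RHS]mulrCA [LHS]mulrCA; congr (_ * _).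
  have -> : (-1) ^+ i.+1 = (-1) ^+ j.+1 * (-1) ^+ (i + j) :> k.
    rewrite -exprD addSn addnCA addnn !exprS exprD.
    by rewrite -(signr_odd _ j.*2) odd_double mulr1.
  rewrite -mulrA; congr (_ * _).
  congr (_ * \det _); apply/matrixP=> i' j'; rewrite !mxE.
  rewrite !map_cat [RHS]nth_cat size_map size_takel //= /bump.
  rewrite -[in LHS](cat_take_drop j (enum T)) map_cat nth_cat size_map.
  rewrite size_takel //; case: (leqP j j') => jj'.
    by rewrite add1n ltnNge ltnW //= subSn.
  by rewrite add0n jj'.
transitivity (\sum_s (\sum_(i < p.+1) (-1) ^+ i.+1 * (c s i * D i)) *:
    mul e`_s w).
  rewrite big_mkcond; apply: eq_bigr => s _; rewrite main.
  case: ifPn => sT; last by rewrite scale0r.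
  by rewrite ffunE cardsU1 sT Tp eqxx linearZ scalerA.
under eq_bigr do rewrite scaler_suml; rewrite exchange_big /=.
apply: eq_bigr => i _; rewrite !ffunE Tp eqxx.
transitivity ((-1) ^+ i.+1 *: (D i *: mul (\sum_s c s i *: e`_s) w)).
  rewrite linear_sum sum_lfunE !scaler_sumr; apply: eq_bigr => s _.
  by rewrite [mul (_ *: _)]linearZ scale_lfunE /= !scalerA mulrAC -!mulrA.
by rewrite -(coord_vbasis (memvf (v i))).
Qed.

Lemma koszulK (W W' W'' : vectType k)
    (mul1 : V -> 'Hom(W, W')) (mul2 : V -> 'Hom(W', W''))
    (f : extmod V W) :
    (forall u v w, mul2 u (mul1 v w) = mul2 v (mul1 u w)) ->
  koszul mul2 (koszul mul1 f) = 0.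
Proof.
move=> mulC; apply/ffunP=> T; rewrite lfunE !ffunE.
have signE (A : {set 'I_N}) s : s \notin A ->
    #|[set t in s |: A | (t <= s)%N]| = #|[set t in A | (t < s)%N]|.+1.
  move=> sA; rewrite (cardsD1 s) !inE eqxx leqnn /= add1n; congr _.+1.
  apply: eq_card => t; rewrite !inE.
  have [->|ts] := eqVneq t s; first by rewrite ltnn andbF.
  by rewrite ltn_neqAle val_eqE ts.
pose F (s t : 'I_N) := (-1) ^+ (#|[set u in T | (u < s)%N]| +
                       #|[set u in s |: T | (u < t)%N]|) *:
                mul2 e`_s (mul1 e`_t (f (t |: (s |: T)))).
transitivity (\sum_s \sum_(t | [&& s != t, s \notin T & t \notin T]) F s t).
  rewrite big_mkcond; apply: eq_bigr => s _; case: ifPn => sT; last first.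
    by rewrite big1 // => t /and3P[_ /negP]; rewrite negbK in sT.
  rewrite lfunE ffunE linear_sum scaler_sumr; apply: eq_big => [t|t].
    by rewrite !inE negb_or eq_sym.
  rewrite !inE => tsT; rewrite linearZ scalerA /= -exprD !signE ?inE //.
  by rewrite addSn addnS -addn2 exprD sqrrN expr1n mulr1.
pose P (s t : 'I_N) := [&& (s < t)%N, s \notin T & t \notin T].
transitivity (\sum_s (\sum_(t | P s t) F s t + \sum_(t | P t s) F s t)).
  apply: eq_bigr => s _; rewrite (bigID (fun t : 'I_N => (s < t)%N)) /=.
  congr (_ + _); apply: eq_bigl => t; rewrite /P -(inj_eq val_inj) /=; 
  by case: (s \in T); case: (t \in T); case: ltngtP.
rewrite big_split /= [X in _ + X](exchange_big_dep predT) //= -big_split /=.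
rewrite big1 // => s _; rewrite -big_split big1 //= => t /and3P[st sT tT].
apply/eqP; rewrite addr_eq0; apply/eqP.
rewrite /F mulC setUCA -scaleNr; congr (_ *: _).
have -> : #|[set u in s |: T | (u < t)%N]| = #|[set u in T | (u < t)%N]|.+1.
  rewrite (cardsD1 s) !inE eqxx st /= add1n; congr _.+1; apply: eq_card => u.
  by rewrite !inE; case: (eqVneq u s) => [->|//]; rewrite (negbTE sT).
have -> : #|[set u in t |: T | (u < s)%N]| = #|[set u in T | (u < s)%N]|.
  apply: eq_card => u; rewrite !inE; case: (eqVneq u t) => [->|//].
  by rewrite ltnNge (ltnW st) !andbF.
by rewrite addnS exprS mulN1r addnC.
Qed.

End Koszul.

(* H^0(P^n, O(m)): forms of degree m in n+1 variables, and 0 if m < 0. *)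
Definition H0 (k : fieldType) (n : nat) (m : int) : vectType k :=
  match m with
  | Posz m' => dhomog n.+1 k m'
  | Negz _ => 'rV[k]_0
  end.

Section Sections.
Variables (k : fieldType) (n : nat).

Definition H0_val (m : int) : H0 k n m -> {mpoly k[n.+1]} :=
  match m with
  | Posz _ => fun u => mpoly_of_dhomog u
  | Negz _ => fun=> 0
  end.

(* The component of degree m of a polynomial. *)
Definition H0_proj (m : int) : {mpoly k[n.+1]} -> H0 k n m :=
  match m with
  | Posz m' => fun p => DHomog (pihomogP mdeg m' p)
  | Negz _ => fun=> 0
  end.

Fact H0_val_linear m : linear (@H0_val m).
Proof. by case: m => m c u v /=; rewrite ?linearP // scaler0 addr0. Qed.

HB.instance Definition _ m := GRing.isLinear.Build k (H0 k n m)
  {mpoly k[n.+1]} _ (@H0_val m) (@H0_val_linear m).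

Fact H0_proj_linear m : linear (@H0_proj m).
Proof.
case: m => m c u v /=; last by rewrite scaler0 addr0.
by apply/val_inj; rewrite /= linearP.
Qed.

HB.instance Definition _ m := GRing.isLinear.Build k {mpoly k[n.+1]}
  (H0 k n m) _ (@H0_proj m) (@H0_proj_linear m).

Lemma H0_val_inj m : injective (@H0_val m).
Proof.
case: m => m u v /=; first exact: val_inj.
by move=> _; apply/rowP; case.
Qed.

Definition H0_mul_fun (a m c : int) (v : H0 k n a) (w : H0 k n m) : H0 k n c :=
  H0_proj c (H0_val v * H0_val w).

Fact H0_mul_fun_linear a m c v : linear (@H0_mul_fun a m c v).
Proof.
by move=> x u w; rewrite /H0_mul_fun linearP mulrDr -scalerAr linearP.
Qed.

HB.instance Definition _ a m c v := GRing.isLinear.Build k (H0 k n m)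
  (H0 k n c) _ (@H0_mul_fun a m c v) (@H0_mul_fun_linear a m c v).

(* Multiplication of sections. The target degree c is a separate argument to  *)
(* avoid casts; the definition is only meant for c = a + m.                   *)
Definition H0_mul (a m c : int) (v : H0 k n a) : 'Hom(H0 k n m, H0 k n c) :=
  linfun (H0_mul_fun c v).

Lemma H0_val_mul a m c (v : H0 k n a) (w : H0 k n m) : c = a + m ->
  H0_val (H0_mul m c v w) = H0_val v * H0_val w.
Proof.
move=> ->; rewrite lfunE /= /H0_mul_fun.
case: a v => a v; last first.
  by rewrite /= mul0r !linear0.
case: m w => m w; last first.
  by rewrite /= mulr0 !linear0.
by apply: pihomog_dE; apply: dhomogM; apply: dhomog_is_dhomog.
Qed.

Fact H0_mul_linear a m c : linear (@H0_mul a m c).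
Proof.
move=> x u v; apply/lfunP=> w; rewrite add_lfunE scale_lfunE !lfunE /=.
by rewrite /H0_mul_fun linearP mulrDl -scalerAl linearP.
Qed.

HB.instance Definition _ a m c := GRing.isLinear.Build k (H0 k n a)
  'Hom(H0 k n m, H0 k n c) _ (@H0_mul a m c) (@H0_mul_linear a m c).

End Sections.

Section Betti.
Variables (k : fieldType) (n : nat) (b d : int).

(* V *)
Definition Vero : vectType k := H0 k n d.

(* M_i *)
Definition VeroMod (i : nat) : vectType k := H0 k n (b + i%:Z * d).

(* /\V (x) M_i -> /\V (x) M_(i+1) *)
Definition VeroKoszul (i : nat) :
    'Hom(extmod Vero (VeroMod i), extmod Vero (VeroMod i.+1)) :=
  koszul (H0_mul (b + i%:Z * d) (b + i.+1%:Z * d) : Vero -> _).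

Definition koszul_cycles (p q : nat) : {vspace extmod Vero (VeroMod q)} :=
  (extpow Vero (VeroMod q) p :&: lker (VeroKoszul q))%VS.

(* For q = 0 the incoming differential starts from M_(-1) = 0. *)
Definition koszul_boundaries (p q : nat) : {vspace extmod Vero (VeroMod q)} :=
  match q with
  | 0 => 0%VS
  | q'.+1 => (VeroKoszul q' @: extpow Vero (VeroMod q') p.+1)%VS
  end.

Lemma koszul_boundaries_sub p q :
  (koszul_boundaries p q <= koszul_cycles p q)%VS.
Proof.
case: q => [|q]; first exact: sub0v.
apply/subvP=> _ /memv_imgP[f fp ->]; rewrite memv_cap koszul_extpow //=.
rewrite memv_ker; apply/eqP; apply: koszulK => u v w.
have degE i : b + i.+1%:Z * d = d + (b + i%:Z * d).
  by rewrite intS mulrDl mul1r addrCA.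
by apply: H0_val_inj; rewrite !H0_val_mul // mulrCA.
Qed.

(* The dimension of the Koszul homology at /\^p V (x) M_q, a natural-number   *)
(* subtraction by koszul_boundaries_sub.                                      *)
Definition kappa (p q : nat) : nat :=
  (\dim (koszul_cycles p q) - \dim (koszul_boundaries p q))%N.

End Betti.

(* Main.v *)
(** Let [S = k[x_0, ..., x_n]], [V = S_d], [N = dim V], [c = d - b - n - 1],
    [m = dim S_c] and [s = dim S_(d-c)].

    Duality. The module [M] consists of the Laurent monomials with nonnegative
    exponents. Division by [x_j^d] is a contracting homotopy of the Koszul complex
    on the Laurent monomials with unrestricted exponent of [x_j], so the homology
    does not change, up to a shift, when the exponents are made negative one
    variable at a time. On the negative monomials the homology is a cokernel, whose
    dual is, after passing to complements of exterior degree, the kernel [Z_p'] of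
    [/\^p' V (x) S_c -> /\^(p'-1) V (x) S_(c+d)] with [p' = N - n - 1 - p]. It
    remains to see that [Z_p' = 0] for [p' >= m] and that
    [dim Z_(m-1) = 'C(s + m - 2, m - 1)].

    Upper bounds. Contraction with the evaluation at a point [q] sends [Z_p] to the
    elements of [Z_(p-1)] whose factor in [S_c] vanishes at [q]. For generic points
    this gives a recursion of Pascal type. Its base case says that a syzygy
    [sum_i v_i f_i = 0] with [v_i] in [V], and the [f_i] in [S_c] vanishing at [m - 2]
    points, is zero as soon as the [v_i] vanish at these and at [s] further points;
    by semicontinuity it is enough to find one good configuration, and for [n >= 2] the
    points on a complete intersection of two products of hyperplanes provide it.

    Lower bound. For a basis [w_1, ..., w_m] of [S_c] and a generic form [g] of degree
    [d - c], the Koszul differential of [g w_1 /\ ... /\ g w_m] is [g] times an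
    element of [Z_(m-1)]. Its ['C(s + m - 2, m - 1)] coefficients with respect to the
    coefficients of [g] are linearly independent elements of [Z_(m-1)]. *)

(* The points must be good in every order in which the recursion meets them, and [k] may be finite.
   Their coordinates are therefore unknowns, and the kernel is extended to the fraction field of the
   polynomial ring in these unknowns; this does not lower dimensions. That a linear system has only
   the zero solution passes from one specialization of the unknowns to the generic points. So each
   condition may be checked at a special configuration of its own, over [k(t)], where scalars
   abound.

   The numbers: [d >= b + n + 1] is [c >= 0], and [b >= -n] is [c < d]. Making one variable negative
   raises the exterior degree by 1 and lowers the degree by [d]. After all [n + 1] variables the
   degree [b + n d] of [M_n] has become [b - d = -(c + n + 1)], the degree of [1 / (x_0 ... x_n m)]
   with [m] in [S_c]. As [c < d], no such monomial has degree [b], so everything is a cycle.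

   In the lower bound, independence is tested by evaluation at generic points: it turns the syzygy
   into the product of the values of [g] at [m - 1] points, times a nonzero determinant. *)
From HB Require Import structures.
Require Import Defs.
From mathcomp Require Import all_boot all_order all_algebra zify ring.
From mathcomp.multinomials Require Import mpoly.
From mathcomp Require Import boolp functions.
From Stdlib Require Import Classical.

Set Implicit Arguments.
Unset Strict Implicit.
Unset Printing Implicit Defensive.

Import Order.TTheory GRing.Theory Num.Theory.
Local Open Scope ring_scope.

(** * Contraction and creation operators *)

Section Exterior.
Variable N : nat.
Implicit Types (S T : {set 'I_N}) (s t : 'I_N).

Definition pos T s : nat := #|[set t in T | (t < s)%N]|.

Lemma pos_setU1 T s t : s \notin T -> pos (s |: T) t = ((s < t) + pos T t)%N.
Proof.
move=> sT; rewrite /pos; case: (ltnP s t) => st.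
  rewrite (cardsD1 s) !inE eqxx st /=; congr (_ + _)%N; apply: eq_card => u.
  by rewrite !inE; case: (eqVneq u s) => [->|//]; rewrite (negbTE sT).
apply: eq_card => u; rewrite !inE; case: (eqVneq u s) => [->|//].
by rewrite (negbTE sT) ltnNge st.
Qed.

Lemma pos_setD1 T s t : s \in T -> pos T t = ((s < t) + pos (T :\ s) t)%N.
Proof. by move=> sT; rewrite -{1}(setD1K sT) pos_setU1 // !inE eqxx. Qed.

(** The terms of [(s, t)] and [(t, s)] cancel, since adding the smaller index first moves the
    position of the larger one by one. The symmetric [F] is abstract because coefficients multiply
    in [contract] but act as operators in [ldiff]. *)
Lemma contract2_sum (R : pzRingType) (F : 'I_N -> 'I_N -> {set 'I_N} -> R) T :
  (forall s t S, F s t S = F t s S) ->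
  \sum_(s | s \notin T) (-1) ^+ pos T s *
    (\sum_(t | t \notin s |: T) (-1) ^+ pos (s |: T) t * F s t (t |: (s |: T))) = 0.
Proof.
move=> FC.
pose G s t := (-1) ^+ pos T s * ((-1) ^+ pos (s |: T) t * F s t (t |: (s |: T))).
pose P s t := [&& (s < t)%N, s \notin T & t \notin T].
transitivity (\sum_s (\sum_(t | P s t) G s t + \sum_(t | P t s) G s t)).
  rewrite big_mkcond; apply: eq_bigr => s _; case: ifPn => sT; last first.
    by rewrite /P (negbTE sT) !big1 ?addr0 // => t /and3P[_ //]; rewrite (negbTE sT).
  rewrite mulr_sumr (bigID (fun t : 'I_N => (s < t)%N)) /=.
  congr (_ + _); apply: eq_bigl => t; rewrite /P !inE -(inj_eq val_inj) /= negb_or sT;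
  by case: (t \in T); case: ltngtP.
rewrite big_split /= [X in _ + X](exchange_big_dep predT) //= -big_split /=.
rewrite big1 // => s _; rewrite -big_split big1 //= => t /and3P[st sT tT].
have ts : (t < s)%N = false by rewrite ltnNge ltnW.
rewrite /G setUCA (FC t s) !mulrA -mulrDl !pos_setU1 // st ts -!exprD.
by rewrite addnCA add1n exprS mulN1r addnC [(pos T t + _)%N]addnC addNr mul0r.
Qed.

(** For [s != t], adding [s] and removing [t] in the two orders gives opposite signs, so only the
    diagonal survives. The abstract [G] serves both [contract_create] and the contracting homotopy
    on Laurent series. *)
Lemma contract_create_sum (R : pzRingType) (G : 'I_N -> 'I_N -> {set 'I_N} -> R) T :
  \sum_(s | s \notin T) (-1) ^+ pos T s *
    (\sum_(t in s |: T) (-1) ^+ pos (s |: T) t * G s t ((s |: T) :\ t)) +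
  \sum_(t in T) (-1) ^+ pos T t *
    (\sum_(s | s \notin T :\ t) (-1) ^+ pos (T :\ t) s * G s t (s |: (T :\ t))) =
  \sum_s G s s T.
Proof.
have sgK n (x : R) : (-1) ^+ n * ((-1) ^+ n * x) = x.
  by rewrite mulrA -exprD addnn -signr_odd odd_double mul1r.
have pos1 (S : {set 'I_N}) s : pos (s |: S) s = pos S s.
  apply: eq_card => u; rewrite !inE; case: (eqVneq u s) => [->|//].
  by rewrite ltnn !andbF.
have posD (S : {set 'I_N}) s : pos (S :\ s) s = pos S s.
  apply: eq_card => u; rewrite !inE; case: (eqVneq u s) => [->|//].
  by rewrite ltnn !andbF.
rewrite [RHS](bigID (mem T)) [LHS]addrC /=.
transitivity (\sum_(s in T) (G s s T + \sum_(t | t \notin T)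
     (-1) ^+ pos T s * ((-1) ^+ pos (T :\ s) t * G t s (t |: (T :\ s)))) +
   \sum_(s | s \notin T) (G s s T + \sum_(t in T)
     (-1) ^+ pos T s * ((-1) ^+ pos (s |: T) t * G s t ((s |: T) :\ t)))).
  congr (_ + _); apply: eq_bigr => s sT.
    rewrite (bigD1 s) /= ?inE ?eqxx // posD setD1K // mulrDr sgK mulr_sumr.
    congr (_ + _); apply: eq_bigl => t; rewrite !inE negb_and negbK.
    by case: (eqVneq t s) => [->|]; rewrite ?sT ?andbF ?andbT.
  rewrite (bigD1 s) /= ?inE ?eqxx // pos1 setU1K // mulrDr sgK mulr_sumr.
  congr (_ + _); apply: eq_bigl => t; rewrite !inE.
  by case: (eqVneq t s) => [->|]; rewrite /= ?(negbTE sT) ?andbF ?andbT.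
rewrite !big_split /= addrACA [X in _ + (X + _)]exchange_big /= -big_split /=.
rewrite [X in _ + X]big1 ?addr0 // => s sT; rewrite -big_split big1 //= => t tT.
have st : s != t by apply: contraNneq sT => ->.
have -> : s |: T :\ t = (s |: T) :\ t.
  by apply/setP=> u; rewrite !inE; case: (eqVneq u s) => [->|]; rewrite ?st.
rewrite !mulrA -mulrDl pos_setU1 // (pos_setD1 s tT) -!exprD.
move: st; rewrite -(inj_eq val_inj) /=.
by case: ltngtP => //= _ _; rewrite ?add0n ?add1n ?addSn ?addnS exprS mulN1r
  addnC ?subrr ?addNr mul0r.
Qed.

Section Operators.
Variable R : comPzRingType.
Implicit Types (f g : {set 'I_N} -> R) (m v : 'I_N -> R).

(** With [m] the forms [e] this is the Koszul differential up to sign, positions being counted from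
    0; with [m] their values at a point it is the contraction with that point. *)
Definition contract m f T : R :=
  \sum_(s | s \notin T) (-1) ^+ pos T s * (m s * f (s |: T)).

Definition create v f T : R :=
  \sum_(s in T) (-1) ^+ pos T s * (v s * f (T :\ s)).

Lemma eq_contract m m' f f' : m =1 m' -> f =1 f' ->
  contract m f =1 contract m' f'.
Proof. by move=> em ef T; apply: eq_bigr => s _; rewrite em ef. Qed.

Lemma contract_sumr (I : Type) (r : seq I) (P : pred I) m (F : I -> {set 'I_N} -> R) T :
  contract m (fun S => \sum_(i <- r | P i) F i S) T =
  \sum_(i <- r | P i) contract m (F i) T.
Proof.
by rewrite exchange_big; apply: eq_bigr => s _; rewrite !mulr_sumr.
Qed.

Lemma contractZr m f c T :
  contract m (fun S => c * f S) T = c * contract m f T.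
Proof.
by rewrite mulr_sumr; apply: eq_bigr => s _; rewrite !(mulrCA c).
Qed.

Lemma contractK m f T : contract m (contract m f) T = 0.
Proof.
have FC s t S : m s * (m t * f S) = m t * (m s * f S) by rewrite mulrCA.
rewrite -(contract2_sum T FC) /contract; apply: eq_bigr => s _.
rewrite [m s * _]mulr_sumr; congr (_ * _); apply: eq_bigr => t _.
by rewrite mulrCA.
Qed.

Lemma contractC m m' f T :
  contract m (contract m' f) T = - contract m' (contract m f) T.
Proof.
apply/eqP; rewrite -addr_eq0; apply/eqP.
have FC s t S : (m s * m' t + m' s * m t) * f S = (m t * m' s + m' t * m s) * f S.
  by congr (_ * _); rewrite addrC; congr (_ + _); apply: mulrC.
rewrite -(contract2_sum T FC) -big_split; apply: eq_bigr => s _ /=.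
rewrite -mulrDr /contract [m s * _]mulr_sumr [m' s * _]mulr_sumr -big_split /=.
congr (_ * _); apply: eq_bigr => t _.
rewrite mulrDl mulrDr mulrCA [X in _ + X]mulrCA -!mulrA; done.
Qed.

Lemma contract_create m v f T :
  contract m (create v f) T + create v (contract m f) T =
  (\sum_s m s * v s) * f T.
Proof.
rewrite mulr_suml -(@contract_create_sum R (fun s t S => m s * v t * f S)).
rewrite /contract /create; congr (_ + _); apply: eq_bigr => s _; congr (_ * _).
  by rewrite mulr_sumr; apply: eq_bigr => t _; rewrite mulrCA -!mulrA.
rewrite mulr_sumr; apply: eq_bigr => t _.
by rewrite mulrCA -!mulrA [X in _ * X = _]mulrCA.
Qed.

End Operators.
End Exterior.

(** * Recursion over points *)

Section Subspaces.
Variables (K : fieldType) (V : vectType K).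

(** Vectors of [P] outside the current subspace are adjoined until none is left; the dimension
    bounds the number of steps. Classical logic replaces a decision procedure for [P]. *)
Lemma subspace_exists (P : V -> Prop) :
  P 0 -> (forall c u v, P u -> P v -> P (c *: u + v)) ->
  exists U : {vspace V}, forall v, v \in U <-> P v.
Proof.
move=> P0 PD.
have PU r (U : {vspace V}) : (\dim (fullv : {vspace V}) - \dim U <= r)%N ->
    (forall v, v \in U -> P v) -> exists U : {vspace V}, forall v, v \in U <-> P v.
  elim: r U => [|r IH] U dU UP.
    have UV : (fullv <= U)%VS.
      by rewrite -(dimv_leqif_sup (subvf U)) eqn_leq dimvS ?subvf // -subn_eq0 -leqn0.
    by exists U => v; split=> [/UP//|_]; apply: (subvP UV); rewrite memvf.
  have [[v [Pv vU]]|nv] := classic (exists v, P v /\ v \notin U).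
    apply: (IH (<[v]> + U)%VS) => [|_ /memv_addP[_ /vlineP[c ->] [u uU ->]]].
      have : (\dim U < \dim (<[v]> + U))%N.
        rewrite ltn_neqAle dimvS ?addvSr // andbT; apply: contra vU => /eqP eqd.
        have /eqP-> : U == (<[v]> + U)%VS by rewrite eqEdim addvSr eqd /=.
        by rewrite (subvP (addvSl _ _)) ?memv_line.
      by move: dU; rewrite !leq_subLR addnS -addSn => dU lt; apply: leq_trans dU _; rewrite leq_add2r.
    by apply: PD Pv (UP _ uU).
  exists U => v; split=> [/UP//|Pv]; apply: contra_notT nv => vU.
  by exists v.
by apply: (PU _ 0%VS (leqnn _)) => v; rewrite memv0 => /eqP->.
Qed.

(** While [U] is not inside [U0], some [rho q] is nonzero on it, and cutting by its kernel lowers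
    the dimension. Points are found in this way, [rho q] being an evaluation at [q]; [q0] pads the
    sequence when fewer than [r] points suffice. *)
Lemma greedy_kernel (Q : Type) (q0 : Q) (W : vectType K) (rho : Q -> 'Hom(V, W))
    r (U0 U : {vspace V}) :
  (U0 <= U)%VS -> (forall q, (U0 <= lker (rho q))%VS) ->
  (forall u, u \in U -> (forall q, rho q u = 0) -> u \in U0) ->
  (\dim U <= \dim U0 + r)%N ->
  exists q : nat -> Q, forall u, u \in U ->
    (forall i, (i < r)%N -> rho (q i) u = 0) -> u \in U0.
Proof.
move=> sU k0; elim: r U sU => [|r IH] U sU kU dU.
  exists (fun=> q0) => u uU _; suff -> : U0 = U by [].
  by apply/eqP; rewrite eqEdim sU -[X in (_ <= X)%N]addn0.
have [UU|/subvPn[u uU u0]] := boolP (U <= U0)%VS.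
  by exists (fun=> q0) => u uU _; apply: (subvP UU).
have [q qu] : exists q, rho q u <> 0.
  by apply: not_all_ex_not => ku; rewrite (kU u) in u0.
pose U' := (U :&: lker (rho q))%VS.
have [|||qs qsP] := IH U'.
- by rewrite subv_cap sU k0.
- by move=> v /memv_capP[vU _]; apply: kU.
- rewrite -ltnS -addnS; apply: leq_trans dU.
  rewrite ltn_neqAle dimvS ?capvSl // andbT; apply/eqP => eqd.
  have /eqP eqU : U' == U by rewrite eqEdim capvSl eqd /=.
  by move: uU; rewrite -eqU memv_cap memv_ker => /andP[_ /eqP].
exists (fun i => if i is i'.+1 then qs i' else q) => v vU vq; apply: qsP.
  by rewrite memv_cap vU memv_ker; apply/eqP/(vq 0%N).
by move=> i ir; apply: (vq i.+1).
Qed.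

End Subspaces.

Section Recursion.
Variables (K : fieldType) (n N m : nat).
Variables (e : 'I_N -> {mpoly K[n]}) (w : 'I_m -> {mpoly K[n]}).
Local Notation ext := {ffun {set 'I_N} -> 'rV[K]_m}.
Implicit Types (f : ext).

Definition lin_form f (S : {set 'I_N}) : {mpoly K[n]} := \sum_j f S 0 j *: w j.

(* [Z_p] in coordinates, when [e] is a basis of [V] and [w] is one of [S_c]. *)
Definition koszul_kernel p f : Prop :=
  (forall S : {set 'I_N}, #|S| != p -> f S = 0) /\
  (forall T, contract e (lin_form f) T = 0).

Lemma ext0 (T : {set 'I_N}) j : (0 : ext) T 0 j = 0.
Proof. by rewrite ffunE mxE. Qed.

Definition rcontract (al : 'I_N -> K) f : ext :=
  [ffun T : {set 'I_N} => \sum_(s | s \notin T) ((-1) ^+ pos T s * al s) *: f (s |: T)].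

Fact rcontract_linear al : linear (rcontract al).
Proof.
move=> c f g; apply/ffunP=> T; rewrite !ffunE scaler_sumr -big_split /=.
apply: eq_bigr => s _; rewrite !ffunE scalerDr !scalerA; congr (_ *: _ + _).
by rewrite mulrC.
Qed.

HB.instance Definition _ al :=
  GRing.isLinear.Build K ext ext _ (rcontract al) (@rcontract_linear al).

Lemma rcontractE al f T j :
  rcontract al f T 0 j = contract al (fun S => f S 0 j) T.
Proof.
by rewrite ffunE summxE; apply: eq_bigr => s _; rewrite mxE mulrA.
Qed.

Lemma rcontract_comb al f (y : 'I_m -> K) T :
  \sum_j y j * rcontract al f T 0 j =
  contract al (fun S => \sum_j y j * f S 0 j) T.
Proof.
by rewrite contract_sumr; apply: eq_bigr => j _; rewrite contractZr rcontractE.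
Qed.

Lemma lin_form_rcontract al f T :
  lin_form (rcontract al f) T =
  contract (fun s => (al s)%:MP) (lin_form f) T.
Proof.
rewrite contract_sumr; apply: eq_bigr => j _; rewrite rcontractE scaler_suml.
apply: eq_bigr => s _.
by rewrite -(rmorph_sign (@mpolyC n K)) !mul_mpolyC !scalerA mulrA.
Qed.

Lemma rcontract_koszul al p f : koszul_kernel p.+1 f ->
  koszul_kernel p (rcontract al f).
Proof.
move=> [fp fk]; split=> [S Sp|T].
  rewrite ffunE big1 // => s sS; rewrite fp ?scaler0 //.
  by rewrite cardsU1 sS add1n eqSS.
rewrite (eq_contract (m' := e) (f' := contract (fun s => (al s)%:MP) (lin_form f))) //.
  by rewrite contractC [contract _ _ _]big1 ?oppr0 // => s _; rewrite fk !mulr0.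
exact: lin_form_rcontract.
Qed.

Lemma meval_contract (v : 'I_n -> K) mu (h : {set 'I_N} -> {mpoly K[n]}) T :
  (contract mu h T).@[v] = contract (fun s => (mu s).@[v]) (fun S => (h S).@[v]) T.
Proof.
rewrite raddf_sum; apply: eq_bigr => s _.
by rewrite /= !mevalM rmorph_sign.
Qed.

Variables (tn s0 : nat) (q : 'I_tn -> 'I_n -> K).
Local Notation al i := (fun s => (e s).@[q i]).
Local Notation be i := (fun j => (w j).@[q i]).

(** When [e] and [w] are bases of [V] and [S_c], the evaluations at all points span the dual of [V],
    and those at any [m] of them form a basis of the dual of [S_c]. In [no_syzygy], [I2] holds the
    [m - 2] points and [I1] the further ones. *)
Hypothesis span_points : forall x : 'I_N -> K,
  (forall i, \sum_s al i s * x s = 0) -> forall s, x s = 0.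
Hypothesis indep_points : forall I : {set 'I_tn}, #|I| = m ->
  forall y : 'I_m -> K,
  (forall i, i \in I -> \sum_j be i j * y j = 0) -> forall j, y j = 0.
Hypothesis no_syzygy : forall I1 I2 : {set 'I_tn}, [disjoint I1 & I2] ->
  (s0 <= #|I1|)%N -> (#|I2| + 2)%N = m -> forall x : 'I_N -> 'I_m -> K,
  \sum_s \sum_j x s j *: (e s * w j) = 0 ->
  (forall i, i \in I1 :|: I2 -> forall j, \sum_s al i s * x s j = 0) ->
  (forall i, i \in I2 -> forall s, \sum_j be i j * x s j = 0) ->
  forall s j, x s j = 0.
Hypothesis m_le_tn : (m <= tn)%N.

(* The points [q i], [i < t], are already used: [f] is killed by the contractions
   with all of them, and its factor in [S_c] vanishes at those in [I]. *)
Definition state t (I : {set 'I_tn}) p f : Prop :=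
  [/\ koszul_kernel p f,
      forall i : 'I_tn, (i < t)%N -> rcontract (al i) f = 0
    & forall i, i \in I -> forall S, \sum_j be i j * f S 0 j = 0].

(** Evaluating the kernel equation of [f] at [q t] turns the [e s] into the contraction with [q t]
    and the [w j] into values: this is the vanishing of the new factor at [q t]. The rest persists
    because contractions anticommute and square to zero. *)
Lemma state_step (t : 'I_tn) (I : {set 'I_tn}) p f : state t I p.+1 f ->
  state t.+1 (t |: I) p (rcontract (al t) f).
Proof.
move=> [fk f0 fI]; split; first exact: rcontract_koszul.
  move=> i; rewrite ltnS => it; apply/ffunP=> T; apply/rowP=> j.
  rewrite rcontractE ext0.
  have E (S : {set 'I_N}) : rcontract (al t) f S 0 j = contract (al t) (fun S => f S 0 j) S.
    exact: rcontractE.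
  rewrite (eq_contract (fun=> erefl) E).
  move: it; rewrite leq_eqVlt => /orP[/eqP/val_inj->|it].
    exact: contractK.
  rewrite contractC [contract _ _ _]big1 ?oppr0 // => s _.
  by rewrite -rcontractE f0 // ext0 !mulr0.
move=> i; rewrite in_setU1 => /orP[/eqP->|iI] S; rewrite rcontract_comb.
  have := congr1 (meval (q t)) (fk.2 S); rewrite meval_contract meval0.
  move=> k0; rewrite -[RHS]k0; apply: eq_contract => // S'.
  rewrite /lin_form [RHS]raddf_sum; apply: eq_bigr => j _ /=.
  by rewrite mevalZ mulrC.
by rewrite [LHS]big1 // => s _; rewrite fI // !mulr0.
Qed.

Lemma state_ker t I p f : state t I p f -> forall i : 'I_tn, val i = t ->
  rcontract (al i) f = 0 -> state t.+1 I p f.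
Proof.
move=> [fk f0 fI] i it fi; split=> // i'; rewrite ltnS leq_eqVlt.
by case/orP=> [/eqP|/f0//]; rewrite -it => /val_inj->.
Qed.

(** For [s] in [S], the coefficients of [f] on the sets [t |: (S :\ s)] are, up to sign, the
    coordinates of a vector of [V] killed by all evaluations. *)
Lemma contract_all_eq0 p f : koszul_kernel p.+1 f ->
  (forall i : 'I_tn, rcontract (al i) f = 0) -> f = 0.
Proof.
move=> [fp _] f0; apply/ffunP=> S; apply/rowP=> j; rewrite ext0.
have [Sp|/fp->] := eqVneq #|S| p.+1; last by rewrite mxE.
have /set0Pn[s sS] : S != set0 by rewrite -card_gt0 Sp.
pose T := S :\ s.
pose x t := if t \notin T then (-1) ^+ pos T t * f (t |: T) 0 j else 0.
have x0 i : \sum_t al i t * x t = 0.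
  have := congr1 (fun g : ext => g T 0 j) (f0 i); rewrite rcontractE ext0 => f0T; rewrite -[RHS]f0T.
  rewrite /contract [RHS]big_mkcond; apply: eq_bigr => t _.
  by rewrite /x; case: ifP => _; rewrite ?mulr0 // mulrCA.
have := span_points x0 s; rewrite /x !inE eqxx /= setD1K //.
by move/eqP; rewrite mulf_eq0 signr_eq0 => /eqP.
Qed.

(** A contraction trades one exterior degree for one point of [I], which keeps [#|I| + p]. By
    induction the contraction with the next point vanishes, so that point can be passed over. With
    [m] points in [I] the factor in [S_c] is zero; with all points used, [contract_all_eq0]
    applies. *)
Lemma state_big t (I : {set 'I_tn}) p f : (t <= tn)%N -> (#|I| <= m)%N ->
  (forall i : 'I_tn, i \in I -> (i < t)%N) -> (m <= #|I| + p)%N ->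
  state t I p f -> f = 0.
Proof.
move=> + + + + fs; move: {2}(tn - t)%N (leqnn (tn - t)) => r.
elim: r t I p f fs => [|r IH] t I p f fs dt tt Im It mp.
  all: have [Im1|Im1] := eqVneq #|I| m.
  1,3: apply/ffunP=> S; apply/rowP=> j; rewrite ext0;
    case: fs => _ _ fI; apply: (indep_points Im1) => i iI; exact: fI.
  all: have {Im Im1} Im : (#|I| < m)%N by rewrite ltn_neqAle Im1.
  all: case: p fs mp => [|p] fs mp; first by rewrite addn0 leqNgt Im in mp.
  case: fs => fk f0 _; apply: contract_all_eq0 fk _ => i; apply: f0.
  by apply: leq_trans (ltn_ord i) _; rewrite -subn_eq0 -leqn0.
case: (ltnP t tn) => [ttn|tnt]; last first.
  case: fs => fk f0 _; apply: contract_all_eq0 fk _ => i; apply: f0.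
  exact: leq_trans (ltn_ord i) tnt.
pose i0 := Ordinal ttn.
have dr : (tn - t.+1 <= r)%N by rewrite subnS -ltnS (leq_trans _ dt) // prednK ?subn_gt0.
have i0I : i0 \notin I by apply/negP=> /It; rewrite ltnn.
apply: (IH t.+1 I p.+1) => //; [|exact: ltnW|by move=> i /It /ltnW].
apply: (@state_ker t I p.+1 f fs i0) => //.
apply: (IH t.+1 (i0 |: I) p) => //.
- exact: (@state_step i0).
- by rewrite cardsU1 i0I.
- by move=> i /setU1P[->|/It /ltnW].
- by rewrite cardsU1 i0I addSnnS.
Qed.

Lemma card_below t (I : {set 'I_tn}) : (t <= tn)%N ->
  (forall i : 'I_tn, i \in I -> (i < t)%N) ->
  (#|I| <= t)%N /\ #|[set i : 'I_tn | (i < t)%N] :\: I| = (t - #|I|)%N.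
Proof.
move=> ttn It; have sub : I \subset [set i : 'I_tn | (i < t)%N].
  by apply/subsetP=> i /It; rewrite inE.
have ct : #|[set i : 'I_tn | (i < t)%N]| = t.
  transitivity #|[set widen_ord ttn i | i in 'I_t]|; last first.
    by rewrite card_imset ?card_ord // => i j /(congr1 val) /= /val_inj.
  apply: eq_card => i; rewrite inE; apply/idP/imsetP => [it|[j _ ->]]; last exact: (ltn_ord j).
  by exists (Ordinal it) => //; apply: val_inj.
by rewrite cardsD (setIidPr sub) ct; split=> //; rewrite -[leqRHS]ct subset_leq_card.
Qed.

Lemma state_leaf t (I : {set 'I_tn}) f : (t <= tn)%N ->
  (forall i : 'I_tn, i \in I -> (i < t)%N) -> (#|I| + 2 = m)%N ->
  (s0 + #|I| <= t)%N -> state t I 1 f -> f = 0.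
Proof.
move=> ttn It Im s0t [[fp fk] f0 fI].
have [It' cI] := card_below ttn It.
have pos0 s : pos set0 s = 0%N.
  by apply: eq_card0 => i; rewrite !inE.
have c0 (R : comPzRingType) (mu : 'I_N -> R) h :
    contract mu h set0 = \sum_s mu s * h [set s].
  rewrite /contract; apply: eq_big => s; rewrite ?inE // => _.
  by rewrite pos0 mul1r setU0.
have x0 s j : f [set s] 0 j = 0.
  apply: (@no_syzygy ([set i : 'I_tn | (i < t)%N] :\: I) I _ _ Im
            (fun s j => f [set s] 0 j)) => //.
  - by rewrite disjoint_sym disjoints_subset setCD subsetUr.
  - by rewrite cI leq_subRL // addnC.
  - rewrite -[RHS](fk set0) c0; apply: eq_bigr => s' _.
    by rewrite mulr_sumr; apply: eq_bigr => j' _; rewrite scalerAr.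
  - move=> i iI j'; have it : (i < t)%N.
      by case/setUP: iI => [/setDP[]|/It//]; rewrite inE.
    have := congr1 (fun g : ext => g set0 0 j') (f0 i it).
    by rewrite rcontractE ext0 c0.
  - by move=> i iI s'; rewrite fI.
apply/ffunP=> S; apply/rowP=> j; rewrite ext0.
have [/eqP/cards1P[s ->]//|/fp->] := eqVneq #|S| 1%N.
by rewrite mxE.
Qed.

(** This is one exterior degree below [state_big]. At least [s0] points were passed over without
    entering [I]; contractions keep this number and passing over a point increases it, so the
    contractions lead down to [state_leaf]. *)
Lemma state_exhausted t (I : {set 'I_tn}) p f : (t <= tn)%N ->
  (forall i : 'I_tn, i \in I -> (i < t)%N) -> (#|I| + p.+2 = m)%N ->
  (s0 + #|I| <= t)%N -> state t I p.+1 f -> f = 0.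
Proof.
move: {2}(tn - t)%N (leqnn (tn - t)) => r.
elim: r t I p f => [|r IH] t I p f dt ttn It Im s0t fs;
  case: p Im fs => [|p] Im fs; do ?[exact: (state_leaf ttn It Im s0t fs)].
  case: fs => fk f0 _; apply: contract_all_eq0 fk _ => i; apply: f0.
  by apply: leq_trans (ltn_ord i) _; rewrite -subn_eq0 -leqn0.
case: (ltnP t tn) => [ttn'|tnt]; last first.
  case: fs => fk f0 _; apply: contract_all_eq0 fk _ => i; apply: f0.
  exact: leq_trans (ltn_ord i) tnt.
pose i0 := Ordinal ttn'.
have dr : (tn - t.+1 <= r)%N by rewrite subnS -ltnS (leq_trans _ dt) // prednK ?subn_gt0.
have i0I : i0 \notin I by apply/negP=> /It; rewrite ltnn.
apply: (IH t.+1 I p.+1) => //; [by move=> i /It /ltnW|exact: leqW|].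
apply: (@state_ker t I p.+2 f fs i0) => //.
apply: (IH t.+1 (i0 |: I) p) => //.
- by move=> i /setU1P[->|/It /ltnW].
- by rewrite cardsU1 i0I -Im !addnS !addSn.
- by rewrite cardsU1 i0I addnS ltnS.
- exact: (@state_step i0).
Qed.

(** In exterior degree 0 there remains a form of [S_c] vanishing at [m - 1] points; its value at one
    more point determines it. *)
Lemma state0_dim t (I : {set 'I_tn}) (U : {vspace ext}) : (#|I| + 1 = m)%N ->
  (forall f, f \in U -> state t I 0 f) -> (\dim U <= 1)%N.
Proof.
move=> Im US.
have [i1 i1I] : exists i1, i1 \notin I.
  apply/existsP; rewrite -negb_forall; apply/forallP => allI.
  have : (#|I| < tn)%N by rewrite -addn1 Im.
  rewrite ltnNge -[leqLHS]card_ord => /negP[].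
  by apply: subset_leq_card; apply/subsetP=> i _; apply: allI.
pose phi (f : ext) : K^o := \sum_j be i1 j * f set0 0 j.
have phi_lin : linear phi.
  move=> c f g; rewrite /phi scaler_sumr -big_split; apply: eq_bigr => j _ /=.
  by rewrite !ffunE !mxE mulrDr; congr (_ + _); apply: mulrCA.
pose phiL := GRing.isLinear.Build K ext K^o _ phi phi_lin.
pose Phi : {linear ext -> K^o} := HB.pack phi phiL.
rewrite -(limg_ker_dim (linfun Phi) U) (_ : (U :&: _)%VS = 0%VS).
  by rewrite dimv0 add0n (leq_trans (dimvS (subvf _))) // dimvf.
apply/eqP; rewrite -subv0; apply/subvP=> f /memv_capP[/US [[fp _] _ fI]].
rewrite memv_ker lfunE memv0 => /eqP /= phi0; apply/eqP/ffunP=> S.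
apply/rowP=> j; rewrite ext0; have [|/fp->] := eqVneq #|S| 0%N; last by rewrite mxE.
move/eqP; rewrite cards_eq0 => /eqP->.
apply: (@indep_points (i1 |: I) _ (fun j => f set0 0 j)).
  by rewrite cardsU1 i1I addnC.
by move=> i /setU1P[->|/fI].
Qed.

(* Rank-nullity for the contraction with [q t]: its kernel uses up a point, its image
   lives in exterior degree one lower, with [t] added to [I]. *)
Lemma state_dim t (I : {set 'I_tn}) p (U : {vspace ext}) : (t <= tn)%N ->
  (forall i : 'I_tn, i \in I -> (i < t)%N) -> (#|I| + p.+1 = m)%N ->
  (forall f, f \in U -> state t I p f) ->
  (\dim U <= 'C((s0 - (t - #|I|)) + p - 1, p))%N.
Proof.
move: {2}(tn - t)%N (leqnn (tn - t)) => r.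
have U0 (W : {vspace ext}) b : (forall f, f \in W -> f = 0) -> (\dim W <= b)%N.
  move=> W0; suff -> : W = 0%VS by rewrite dimv0.
  by apply/eqP; rewrite -subv0; apply/subvP=> f /W0->; rewrite mem0v.
elim: r t I p U => [|r IH] t I p U dt ttn It Im US;
  case: p Im US => [|p] Im US; rewrite ?bin0; do ?[exact: state0_dim Im US].
  apply: U0 => f /US[fk f0 _]; apply: contract_all_eq0 fk _ => i; apply: f0.
  by apply: leq_trans (ltn_ord i) _; rewrite -subn_eq0 -leqn0.
case: (ltnP t tn) => [ttn'|tnt]; last first.
  apply: U0 => f /US[fk f0 _]; apply: contract_all_eq0 fk _ => i; apply: f0.
  exact: leq_trans (ltn_ord i) tnt.
have [cIt _] := card_below ttn It.
(* This difference counts the points that may still be passed over. The kernel of the contraction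
   lowers it by one and the image keeps it: these are the two terms of Pascal's rule. *)
case Es : (s0 - (t - #|I|))%N => [|s].
  apply: U0 => f /US; apply: state_exhausted => //.
  by move/eqP: Es; rewrite subn_eq0 leq_subRL // addnC.
pose i0 := Ordinal ttn'.
have dr : (tn - t.+1 <= r)%N by rewrite subnS -ltnS (leq_trans _ dt) // prednK ?subn_gt0.
have i0I : i0 \notin I by apply/negP=> /It; rewrite ltnn.
rewrite -(limg_ker_dim (linfun (rcontract (al i0))) U).
rewrite addSn addnS subn1 /= binS; apply: leq_add; last first.
  have := IH t.+1 (i0 |: I) p (linfun (rcontract (al i0)) @: U)%VS dr ttn'.
  rewrite cardsU1 i0I /= add1n subSS Es addSn subn1 /=; apply.
  - by move=> i /setU1P[->|/It /ltnW].
  - by rewrite -Im !addnS.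
  - by move=> _ /memv_imgP[f /US fs ->]; rewrite lfunE; apply: (@state_step i0).
have := IH t.+1 I p.+1 (U :&: lker (linfun (rcontract (al i0))))%VS dr ttn'.
have -> : (s0 - (t.+1 - #|I|))%N = s by rewrite subSn // subnS Es.
have -> : (s + p.+1 - 1 = s + p)%N by rewrite addnS subn1.
apply=> //.
  by move=> i /It /ltnW.
move=> f /memv_capP[/US fs]; rewrite memv_ker lfunE => /eqP /= fi.
exact: (@state_ker t I p.+1 f fs i0).
Qed.

End Recursion.

(** * Specialization of linear systems and evaluation on grids *)

Section Specialization.

Definition only_zero (K : fieldType) (X Q : finType) (c : Q -> X -> K) : Prop :=
  forall x : X -> K, (forall q, \sum_j c q j * x j = 0) -> forall j, x j = 0.

(* A maximal minor that is nonzero after specialization was nonzero before. *)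
Lemma only_zero_specialize (P : comNzRingType) (K L : fieldType)
    (sigma : {rmorphism P -> L}) (tau : {rmorphism P -> K}) (X Q : finType)
    (c : Q -> X -> P) : injective tau ->
  only_zero (fun q j => sigma (c q j)) -> only_zero (fun q j => tau (c q j)).
Proof.
move=> tau_inj s0 x x0.
pose A : 'M[P]_(#|Q|, #|X|) := \matrix_(q, j) c (enum_val q) (enum_val j).
have fullA : row_full (map_mx sigma A).
  rewrite -cokermx_eq0; apply/eqP/matrixP=> j l; rewrite [RHS]mxE.
  have := s0 (fun j => cokermx (map_mx sigma A) (enum_rank j) l) _ (enum_val j).
  rewrite enum_valK; apply=> q.
  have := congr1 (fun M : 'M__ => M (enum_rank q) l) (mulmx_coker (map_mx sigma A)).
  rewrite mxE [in RHS]mxE => E; rewrite -[RHS]E [RHS](reindex_onto enum_rank enum_val) /=.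
    by apply: eq_big => i; rewrite ?enum_rankK ?eqxx // => _; rewrite !mxE !enum_rankK.
  by move=> i _; rewrite enum_valK.
pose f := fullrankfun fullA.
have := fullrowsub_unit fullA; rewrite -/f -map_mxsub unitmxE det_map_mx unitfE => dA.
have dA' : map_mx tau (rowsub f A) \in unitmx.
  rewrite unitmxE det_map_mx unitfE; apply: contraNneq dA => d0.
  by rewrite [\det _](tau_inj _ 0) ?rmorph0.
pose y : 'cV[K]_#|X| := \col_j x (enum_val j).
have y0 : map_mx tau (rowsub f A) *m y = 0.
  apply/colP=> i; rewrite [RHS]mxE mxE -[RHS](x0 (enum_val (f i))).
  rewrite [RHS](reindex_onto enum_val enum_rank) /=; last by move=> j _; rewrite enum_rankK.
  by apply: eq_big => j; rewrite ?enum_valK ?eqxx // => _; rewrite !mxE.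
move=> j; have := congr1 (mulmx (invmx (map_mx tau (rowsub f A)))) y0.
rewrite mulKmx // mulmx0 => /colP/(_ (enum_rank j)).
by rewrite !mxE enum_rankK.
Qed.

End Specialization.

Section Grid.
Variables (L : fieldType) (a : nat -> L).
Hypothesis a_inj : injective a.

Lemma vandermonde_dual b e0 : (e0 < b)%N ->
  exists l : nat -> L, forall e, (e < b)%N ->
    \sum_(r < b) l r * a r ^+ e = (e == e0)%:R.
Proof.
move=> e0b; pose M := Vandermonde b (\row_(r < b) a r).
have uM : M \in unitmx.
  rewrite unitmxE unitfE det_Vandermonde; apply/prodf_neq0 => i _.
  apply/prodf_neq0 => j ij; rewrite !mxE subr_eq0 (inj_eq a_inj).
  by rewrite gtn_eqF.
pose l := invmx M *m delta_mx (Ordinal e0b) (0 : 'I_1).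
exists (fun r => if insub r is Some i then l i 0 else 0) => e eb.
have := mulKVmx uM (delta_mx (Ordinal e0b) (0 : 'I_1)).
move/colP/(_ (Ordinal eb)); rewrite !mxE eqxx andbT -(inj_eq val_inj) /= => <-.
by apply: eq_bigr => r _; rewrite valK !mxE mulrC.
Qed.

(** Products of the functionals of [vandermonde_dual], one for each variable of [J], extract a
    single coefficient from the values on the grid. The other variables are set to 1; by the second
    hypothesis this merges no two monomials of [p], as for a homogeneous polynomial in an affine
    chart. *)
Lemma grid_eq0 n (p : {mpoly L[n]}) (J : pred 'I_n) (b : 'I_n -> nat) :
  {in msupp p, forall (mon : 'X_{1..n}) i, J i -> (mon i < b i)%N} ->
  {in msupp p &, forall mon mon' : 'X_{1..n}, (forall i, J i -> mon i = mon' i) -> mon = mon'} ->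
  (forall phi : 'I_n -> nat, (forall i, J i -> (phi i < b i)%N) ->
     p.@[fun i => if J i then a (phi i) else 1] = 0) ->
  p = 0.
Proof.
move=> pb pJ p0; apply: contraTeq isT => pn0.
have [mon0 mon0p] : exists mon0, mon0 \in msupp p.
  by exists (mlead p); apply: mlead_supp.
have [l lP] : exists l : 'I_n -> nat -> L, forall i, J i -> forall e, (e < b i)%N ->
    \sum_(r < b i) l i r * a r ^+ e = (e == mon0 i)%:R.
  apply: (@fin_all_exists _ (fun=> nat -> L)
    (fun i l => J i -> forall e, (e < b i)%N ->
       \sum_(r < b i) l r * a r ^+ e = (e == mon0 i)%:R)) => i.
  case Ji : (J i); last by exists (fun=> 0).
  by have [l lP] := vandermonde_dual (pb _ mon0p _ Ji); exists l.
(* A common bound lets the grid consist of functions into one finite type; [D] cuts out the actual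
   ranges and pins the coordinates outside [J]. *)
pose B := (\max_i b i).+1.
have bB i : (b i <= B)%N by apply/leqW/leq_bigmax.
pose D (i : 'I_n) (r : 'I_B) := if J i then (r < b i)%N else r == ord0.
pose c i r := if J i then l i r else 1.
pose y (r : {ffun 'I_n -> 'I_B}) i := if J i then a (r i) else 1.
have : \sum_(r in family D) (\prod_i c i (r i)) * p.@[y r] = 0.
  rewrite big1 // => r /familyP rD; rewrite p0 ?mulr0 // => i Ji.
  by have := rD i; rewrite unfold_in /= /D Ji.
under eq_bigr do rewrite mevalE mulr_sumr.
rewrite exchange_big /= (bigD1_seq mon0) ?msupp_uniq //=.
have E mon : mon \in msupp p ->
    \sum_(r in family D) \prod_i c i (r i) * (p@_mon * \prod_i y r i ^+ mon i) =
    p@_mon * (mon == mon0)%:R.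
  move=> monp; under eq_bigr do rewrite mulrCA -big_split /=.
  rewrite -mulr_sumr; congr (_ * _).
  rewrite -(bigA_distr_big_dep (fun i r => D i r)
    (fun i (r : 'I_B) => c i r * (if J i then a r else 1) ^+ mon i)) /=.
  have F i : \sum_(r < B | D i r) c i r * (if J i then a r else 1) ^+ mon i =
      if J i then (mon i == mon0 i)%:R else 1.
    rewrite /D /c; case Ji : (J i); last by rewrite big_pred1_eq mul1r expr1n.
    rewrite -(lP i Ji (mon i)) ?pb // (big_ord_widen B (fun r => l i r * a r ^+ mon i)) //.
  rewrite (eq_bigr _ (fun i _ => F i)).
  have [->|ne] := eqVneq mon mon0; first by rewrite big1 // => i _; rewrite eqxx if_same.
  have [i Ji mi] : exists2 i, J i & mon i != mon0 i.
    apply/exists_inP; rewrite -negb_forall_in; apply: contra ne => /forall_inP h.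
    by apply/eqP/pJ => // i /h /eqP.
  by rewrite (bigD1 i) //= Ji (negbTE mi) mul0r.
rewrite E // eqxx mulr1 big1_seq ?addr0; last first.
  by move=> mon /andP[ne monp]; rewrite E // (negbTE ne) mulr0.
by move/eqP; rewrite mcoeff_eq0 mon0p.
Qed.

Lemma meval_neq0 n (p : {mpoly L[n]}) : p != 0 -> exists y, p.@[y] != 0.
Proof.
move=> pn0; apply: NNPP => ny; move/eqP: pn0; apply.
apply: (@grid_eq0 _ _ predT (fun=> msize p)) => [mon monp i _|mon mon' _ _ E|phi _].
- apply: leq_trans (msize_mdeg_lt monp).
  by rewrite ltnS mdegE (bigD1 i) //= leq_addr.
- by apply: (proj2 (mnmP mon mon')) => i; apply: E.
- by apply/eqP; apply: contra_notT ny => py; exists (fun i => a (phi i)).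
Qed.

End Grid.

Section Monomials.
Variables n d : nat.

Definition monom (i : 'I_('C(d + n, d))) : 'X_{1..n.+1} :=
  nth 0%MM [seq s2m t | t : d.-tuple 'I_n.+1 <- enum (basis n.+1 d)] i.

Lemma monom_inj : injective monom.
Proof.
move=> i j /eqP; rewrite nth_uniq ?uniq_basis ?size_basis //.
by move=> /eqP/val_inj.
Qed.

Lemma mdeg_monom i : mdeg (monom i) = d.
Proof. by apply/eqP; rewrite basis_cover mem_nth ?size_basis. Qed.

Lemma monom_onto mon : mdeg mon = d -> exists i, monom i = mon.
Proof.
move/eqP; rewrite basis_cover => /(nthP 0%MM)[i]; rewrite size_basis => id <-.
by exists (Ordinal id).
Qed.

Variable R : nzRingType.

Lemma mcoeff_sum_monom (u : 'I_('C(d + n, d)) -> R) j :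
  (\sum_i u i *: 'X_[monom i])@_(monom j) = u j.
Proof.
rewrite raddf_sum (bigD1 j) //= mcoeffZ mcoeffX eqxx mulr1 big1 ?addr0 // => i ij.
by rewrite mcoeffZ mcoeffX (inj_eq monom_inj) (negbTE ij) mulr0.
Qed.

Lemma homog_sum_monom (p : {mpoly R[n.+1]}) : p \is d.-homog ->
  p = \sum_i p@_(monom i) *: 'X_[monom i].
Proof.
move=> pd; apply/mpolyP => mon.
have [/monom_onto[j <-]|ne] := eqVneq (mdeg mon) d.
  by rewrite mcoeff_sum_monom.
rewrite (dhomog_nemf_coeff pd ne) raddf_sum big1 //= => i _.
rewrite mcoeffZ mcoeffX; case: eqP => [E|]; last by rewrite mulr0.
by rewrite -E mdeg_monom eqxx in ne.
Qed.

Lemma sum_monom_homog (u : 'I_('C(d + n, d)) -> R) :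
  \sum_i u i *: 'X_[monom i] \is d.-homog.
Proof.
by apply: rpred_sum => i _; apply: rpredZ; rewrite dhomogX /= mdeg_monom.
Qed.

End Monomials.

Lemma dim_inj (K : fieldType) (V W : vectType K) (f : 'Hom(V, W)) (U : {vspace V}) :
  (forall u, u \in U -> f u = 0 -> u = 0) -> (\dim U <= \dim (fullv : {vspace W}))%N.
Proof.
move=> fU; rewrite -(limg_ker_dim f U) (_ : (U :&: _)%VS = 0%VS).
  by rewrite dimv0 add0n dimvS ?subvf.
apply/eqP; rewrite -subv0; apply/subvP=> u /memv_capP[uU].
by rewrite memv_ker memv0 => /eqP/(fU _ uU)->.
Qed.

Lemma dim_rV (K : fieldType) m : \dim (fullv : {vspace 'rV[K]_m}) = m.
Proof. by rewrite dimvf /dim /= mul1n. Qed.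

(** * Syzygies vanishing at special points *)

Section Leaf.
Variables (L : fieldType) (a : nat -> L).
Hypothesis a_inj : injective a.

Lemma meval_unit n c (p : {mpoly L[n]}) (i : 'I_n) : p \is c.-homog ->
  p.@[fun j => (j == i)%:R] = p@_(U_(i) *+ c)%MM.
Proof.
move=> pc; rewrite mevalE.
have F mon : mdeg mon = c -> \prod_(j < n) ((j == i)%:R : L) ^+ mon j =
    (mon == U_(i) *+ c)%MM%:R.
  move=> mc; have [->|ne] := eqVneq mon _.
    rewrite big1 // => j _; rewrite mulmnE mnm1E (eq_sym i).
    by case: eqP => _; rewrite ?expr1n // mul0n expr0.
  have [j /andP[ji mj]] : exists j, (j != i) && (mon j != 0)%N.
    apply/existsP; rewrite -[[exists _, _]]negbK negb_exists; apply: contra ne => /forallP h.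
    have m0 j : j != i -> mon j = 0%N.
      by move=> ji; have := h j; rewrite ji /= negbK => /eqP.
    apply/eqP/mnmP => j; rewrite mulmnE mnm1E -mc mdegE (bigD1 i) //= big1 ?addn0.
      by rewrite (eq_sym i); have [->|/m0->] := eqVneq j i; rewrite ?mul1n ?mul0n.
    by move=> k /m0.
  by rewrite (bigD1 j) //= (negbTE ji) expr0n (negbTE mj) mul0r.
rewrite big_seq (eq_bigr (fun mon => p@_mon * (mon == U_(i) *+ c)%MM%:R)).
  rewrite -big_seq; have [ip|ip] := boolP ((U_(i) *+ c)%MM \in msupp p).
    rewrite (bigD1_seq _ ip) ?msupp_uniq //= eqxx mulr1 big1 ?addr0 //.
    by move=> mon /negbTE->; rewrite mulr0.
  rewrite (memN_msupp_eq0 ip) big1_seq // => mon /andP[_ monp].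
  by case: eqP monp => [->|_ _]; rewrite ?(negbTE ip) ?mulr0.
by move=> mon monp; rewrite F // (dhomog_mf pc).
Qed.

Section Forms.
Variables (n N d c : nat).
Local Notation m := 'C(c + n, c).
Local Notation s0 := 'C(d - c + n, d - c).
Variable e : 'I_N -> {mpoly L[n.+1]}.
Hypothesis e_homog : forall s, e s \is d.-homog.
Hypothesis e_free : forall x : 'I_N -> L, \sum_s x s *: e s = 0 -> forall s, x s = 0.

Local Notation w j := ('X_[monom j] : {mpoly L[n.+1]}).
Definition form_of (x : 'I_m -> L) : {mpoly L[n.+1]} := \sum_j x j *: w j.

Lemma form_of_homog x : form_of x \is c.-homog. Proof. exact: sum_monom_homog. Qed.

Lemma meval_form_of x y : (form_of x).@[y] = \sum_j (w j).@[y] * x j.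
Proof.
by rewrite /form_of raddf_sum; apply: eq_bigr => j _ /=; rewrite mevalZ mulrC.
Qed.

Lemma form_of_eq0 x : form_of x = 0 -> forall j, x j = 0.
Proof. by move=> x0 j; rewrite -(mcoeff_sum_monom x) -/(form_of _) x0 mcoeff0. Qed.

Lemma syzygyE (x : 'I_N -> 'I_m -> L) :
  \sum_s \sum_j x s j *: (e s * w j) = \sum_s e s * form_of (x s).
Proof.
by apply: eq_bigr => s _; rewrite mulr_sumr; apply: eq_bigr => j _; rewrite scalerAr.
Qed.

(** The rows of [x] are coordinates of forms of degree [c], its columns coordinates of forms in [V];
    both kinds vanish at the [m - 2] points. *)
Definition leaf_cond (y : nat -> 'I_n.+1 -> L) (x : 'M[L]_(N, m)) : Prop :=
  \sum_s \sum_j x s j *: (e s * w j) = 0 /\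
  (forall i, (i < m - 2)%N ->
    (forall j, \sum_s (e s).@[y i] * x s j = 0) /\
    (forall s, \sum_j (w j).@[y i] * x s j = 0)).

(** Since [L] is infinite, evaluating the columns at points separates solutions, and greedily chosen
    points cut the solution space down to zero, one dimension each. So the [m - 2] points are good
    as soon as they leave at most [s0] dimensions. *)
Lemma leaf_points (y2 : nat -> 'I_n.+1 -> L) :
  (forall U : {vspace 'M[L]_(N, m)},
     (forall x, x \in U -> leaf_cond y2 x) -> (\dim U <= s0)%N) ->
  exists y1 : nat -> 'I_n.+1 -> L, forall x : 'M[L]_(N, m), leaf_cond y2 x ->
    (forall i, (i < s0)%N -> forall j, \sum_s (e s).@[y1 i] * x s j = 0) -> x = 0.
Proof.
move=> dimU.
have [|c0 u v [u0 ui] [v0 vi]|U UP] := @subspace_exists _ _ (leaf_cond y2).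
- split=> [|i _]; last by split=> ?; rewrite big1 // => ? _; rewrite mxE mulr0.
  by rewrite big1 // => s _; rewrite big1 // => j _; rewrite mxE scale0r.
- split=> [|i ir].
    transitivity (c0 *: (\sum_s \sum_j u s j *: (e s * w j)) +
      \sum_s \sum_j v s j *: (e s * w j)); last by rewrite u0 v0 scaler0 addr0.
    rewrite scaler_sumr -big_split; apply: eq_bigr => s _ /=.
    rewrite scaler_sumr -big_split; apply: eq_bigr => j _ /=.
    by rewrite !mxE scalerDl scalerA.
  have [u1 u2] := ui i ir; have [v1 v2] := vi i ir; split=> k.
    transitivity (c0 * (\sum_s (e s).@[y2 i] * u s k) + \sum_s (e s).@[y2 i] * v s k).
      rewrite mulr_sumr -big_split; apply: eq_bigr => s _ /=.
      by rewrite !mxE mulrDr mulrCA.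
    by rewrite u1 v1 mulr0 addr0.
  transitivity (c0 * (\sum_j (w j).@[y2 i] * u k j) + \sum_j (w j).@[y2 i] * v k j).
    rewrite mulr_sumr -big_split; apply: eq_bigr => s _ /=.
    by rewrite !mxE mulrDr mulrCA.
  by rewrite u2 v2 mulr0 addr0.
pose rho y : 'Hom('M[L]_(N, m), 'rV[L]_m) := linfun (mulmx (\row_s (e s).@[y])).
have rhoE y x j : rho y x 0 j = \sum_s (e s).@[y] * x s j.
  by rewrite lfunE mxE; apply: eq_bigr => s _; rewrite mxE.
have [||||y1 y1P] := @greedy_kernel _ _ ('I_n.+1 -> L) (fun=> 0) _ rho s0 0%VS U.
- exact: sub0v.
- by move=> y; apply: sub0v.
- move=> x xU x0; rewrite memv0; apply/eqP/matrixP=> s j; rewrite mxE.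
  apply: (e_free (x := fun s => x s j)).
  apply/eqP; apply: contraT => /(meval_neq0 a_inj)[y]; rewrite raddf_sum /= => /eqP[].
  have := congr1 (fun v : 'rV_m => v 0 j) (x0 y); rewrite rhoE mxE => x0y.
  by rewrite -[RHS]x0y; apply: eq_bigr => s' _; rewrite mevalZ mulrC.
- by rewrite dimv0 add0n dimU // => x /UP.
exists y1 => x /UP xU x0; apply/eqP; rewrite -memv0; apply: y1P => // i ir.
by apply/rowP=> j; rewrite rhoE mxE x0.
Qed.

End Forms.
End Leaf.

Section Line.
Variables (L : fieldType) (a : nat -> L).
Hypothesis a_inj : injective a.
Variables (N d c : nat).
Hypothesis c_gt0 : (0 < c)%N.
Hypothesis c_le_d : (c <= d)%N.
Local Notation m := 'C(c + 1, c).
Local Notation s0 := 'C(d - c + 1, d - c).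
Variable e : 'I_N -> {mpoly L[2]}.
Hypothesis e_homog : forall s, e s \is d.-homog.
Hypothesis e_free : forall x : 'I_N -> L, \sum_s x s *: e s = 0 -> forall s, x s = 0.

Definition line_point i (l : 'I_2) : L := if l == ord_max then a i else 1.

Lemma line_form_eq0 D (p : {mpoly L[2]}) : p \is D.-homog ->
  (forall i, (i <= D)%N -> p.@[line_point i] = 0) -> p = 0.
Proof.
move=> pD p0; apply: (@grid_eq0 L a a_inj _ _ (pred1 ord_max) (fun=> D.+1)).
- move=> mon /(dhomog_mf pD) <- i _ /=; by rewrite ltnS mdegE (bigD1 i) //= leq_addr.
- move=> mon mon' /(dhomog_mf pD) /= mD /(dhomog_mf pD) /= mD' E.
  have P0 : (fun i : 'I_2 => i != ord_max) =1 pred1 ord0 by case=> [[|[|]]].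
  apply/mnmP => i; move: mD; rewrite -mD' !mdegE.
  rewrite !(bigD1 (P := xpredT) ord_max) //= E ?eqxx // => /addnI.
  rewrite !(big_pred1 _ P0) => E0.
  have [->|] := eqVneq i ord_max; first by rewrite E ?eqxx.
  by rewrite P0 => /eqP->.
- move=> phi phiD; rewrite -[RHS](p0 (phi ord_max)); last by rewrite -ltnS phiD /=.
  by apply: meval_eq => i; rewrite /line_point /=; case: eqP => // ->.
Qed.

(** On the line [m - 2 = c - 1]. Let [P] be the next point and [v] the combination of the [e s] with
    the values of the rows at [P]. It vanishes at the first [c - 1] points by the column conditions
    and at [P] by the syzygy, so [s0 = d - c + 1] further values determine it. If [v = 0], the rows
    vanish at [c] points, hence are proportional, and the syzygy is a product of two forms. *)
Lemma leaf_dim_line :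
  exists y : nat -> 'I_2 -> L, forall U : {vspace 'M[L]_(N, m)},
    (forall x, x \in U -> leaf_cond e y x) -> (\dim U <= s0)%N.
Proof.
have s0E : s0 = (d - c).+1 by rewrite -[LHS]bin_sub ?leq_addr // addKn bin1 addn1.
have mE : m = c.+1 by rewrite -[LHS]bin_sub ?leq_addr // addKn bin1 addn1.
exists line_point => U UP.
pose C (x : 'M[L]_(N, m)) s := (form_of (x s)).@[line_point (c - 1)].
pose v x := \sum_s C x s *: e s.
have v_homog x : v x \is d.-homog by apply: rpred_sum => s _; apply: rpredZ.
have C_lin k x y s : C (k *: x + y) s = k * C x s + C y s.
  rewrite /C !meval_form_of mulr_sumr -big_split; apply: eq_bigr => j _ /=.
  by rewrite !mxE mulrDr mulrCA.
pose phi (x : 'M[L]_(N, m)) : 'rV[L]_s0 := \row_i (v x).@[line_point (c + i)].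
have phi_lin : linear phi.
  move=> k x y; apply/rowP=> i; rewrite !mxE /v !raddf_sum mulr_sumr -big_split.
  by apply: eq_bigr => s _ /=; rewrite !mevalZ C_lin mulrDl mulrA.
pose Phi : {linear 'M[L]_(N, m) -> 'rV[L]_s0} :=
  HB.pack phi (GRing.isLinear.Build L _ _ _ phi phi_lin).
rewrite -[leqRHS](@dim_rV L); apply: (dim_inj (f := linfun Phi)) => x /UP[syz xi].
rewrite lfunE => /rowP phi0.
have row0 s i : (i < c - 1)%N -> (form_of (x s)).@[line_point i] = 0.
  move=> ic; rewrite meval_form_of; apply: (xi i _).2.
  by rewrite mE subSS.
have v0 : v x = 0.
  apply: (@line_form_eq0 d) => // i id.
  have [ic|ci] := ltnP i (c - 1).
    rewrite raddf_sum /=.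
    transitivity (\sum_j ('X_[monom j] : {mpoly L[2]}).@[line_point (c - 1)] *
        (\sum_s (e s).@[line_point i] * x s j)); last first.
      by rewrite big1 // => j _; rewrite (xi i _).1 ?mulr0 // mE subSS.
    under [RHS]eq_bigr do rewrite mulr_sumr.
    rewrite exchange_big /=; apply: eq_bigr => s _.
    rewrite mevalZ /C meval_form_of mulr_suml; apply: eq_bigr => j _.
    by rewrite mulrAC mulrA.
  have [->|ne] := eqVneq i (c - 1)%N.
    have := congr1 (meval (line_point (c - 1))) syz; rewrite syzygyE meval0 => E.
    rewrite -[RHS]E !raddf_sum; apply: eq_bigr => s _ /=.
    by rewrite mevalZ mevalM mulrC.
  have ci' : (c <= i)%N by rewrite -(prednK c_gt0) -subn1 ltn_neqAle eq_sym ne.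
  have i0 : (i - c < s0)%N by rewrite s0E ltnS leq_sub2r.
  by have := phi0 (Ordinal i0); rewrite !mxE /= subnKC.
have row0' s i : (i < c)%N -> (form_of (x s)).@[line_point i] = 0.
  move=> ic; have : (i <= c - 1)%N by rewrite -ltnS subn1 prednK.
  rewrite leq_eqVlt => /orP[/eqP->|/row0//].
  exact: (e_free (x := C x)).
pose B s := (form_of (x s)).@[line_point c].
have B_form s : B s = 0 -> form_of (x s) = 0.
  move=> Bs; apply: (@line_form_eq0 c) (form_of_homog _) _ => i.
  by rewrite leq_eqVlt => /orP[/eqP->|/row0'->].
have [s' Bs'|B0] := pickP (fun s => B s != 0); last first.
  apply/matrixP=> s j; rewrite mxE; apply: form_of_eq0; apply: B_form.
  by have /negbT := B0 s; rewrite negbK => /eqP.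
have prop s : form_of (x s) = (B s / B s') *: form_of (x s').
  apply/eqP; rewrite -subr_eq0; apply/eqP; apply: (@line_form_eq0 c).
    by rewrite rpredB ?rpredZ ?form_of_homog.
  move=> i; rewrite mevalB mevalZ leq_eqVlt => /orP[/eqP->|/row0' i0].
    by rewrite divfK // subrr.
  by rewrite !i0 mulr0 subrr.
have : (\sum_s (B s / B s') *: e s) * form_of (x s') = 0.
  rewrite -[RHS]syz syzygyE mulr_suml; apply: eq_bigr => s _.
  by rewrite (prop s) -scalerAl -scalerAr.
move/eqP; rewrite mulf_eq0 => /orP[/eqP E|/eqP E].
  by have /eqP := e_free E s'; rewrite divff // oner_eq0.
by move: Bs'; rewrite /B E meval0 eqxx.
Qed.

End Line.

Section Space.
Variables (L : fieldType) (a : nat -> L).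
Hypothesis a_inj : injective a.
Variables (n N d c : nat).
Hypothesis n_gt1 : (1 < n)%N.
Hypothesis c_gt0 : (0 < c)%N.
Hypothesis c_le_d : (c <= d)%N.
Local Notation m := 'C(c + n, c).
Local Notation s0 := 'C(d - c + n, d - c).
Variable e : 'I_N -> {mpoly L[n.+1]}.
Hypothesis e_homog : forall s, e s \is d.-homog.
Hypothesis e_free : forall x : 'I_N -> L, \sum_s x s *: e s = 0 -> forall s, x s = 0.

Let i0 : 'I_n.+1 := inord 0.
Let i1 : 'I_n.+1 := inord 1.
Let i2 : 'I_n.+1 := inord 2.

Definition line_prod (i : 'I_n.+1) : {mpoly L[n.+1]} :=
  \prod_(r < c) ('X_i - a r *: 'X_i2).

Lemma mnm1_lt (i : 'I_n.+1) : (i < i2)%N -> (U_(i2)%MM < U_(i)%MM)%O.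
Proof.
move=> ii; apply/(ltmcP _); first by rewrite !mdeg1.
exists i => [j ji|]; rewrite !mnm1E.
  by rewrite -!(inj_eq val_inj) /= (gtn_eqF ji) (gtn_eqF (ltn_trans ji ii)).
by rewrite eqxx -(inj_eq val_inj) /= (gtn_eqF ii).
Qed.

Lemma mlead_line (i : 'I_n.+1) r : (i < i2)%N ->
  mlead ('X_i - a r *: 'X_i2 : {mpoly L[n.+1]}) = U_(i)%MM.
Proof.
move=> ii; rewrite mleadDl ?mleadXm // mleadN.
by apply: le_lt_trans (mleadZ_le _ _) _; rewrite mleadXm mnm1_lt.
Qed.

Lemma line_prod_homog i : line_prod i \is c.-homog.
Proof.
rewrite /line_prod; move: c => k; elim: k => [|k IH]; first by rewrite big_ord0 dhomog1.
rewrite big_ord_recr /= -(addn1 k); apply: dhomogM => //.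
by rewrite rpredB ?rpredZ // dhomogX /= mdeg1.
Qed.

Lemma meval_line_prod i y : (line_prod i).@[y] = \prod_(r < c) (y i - a r * y i2).
Proof.
rewrite rmorph_prod; apply: eq_bigr => r _ /=.
by rewrite mevalB mevalZ !mevalXU.
Qed.

Lemma line_neq0 (i : 'I_n.+1) r : (i < i2)%N ->
  'X_i - a r *: 'X_i2 != 0 :> {mpoly L[n.+1]}.
Proof.
move=> ii; apply: contraNneq (oner_neq0 L) => E.
have := congr1 (mcoeff U_(i)) E.
rewrite mcoeffB mcoeffZ !mcoeffXU eqxx -(inj_eq val_inj) /= (gtn_eqF ii).
by rewrite mulr0 subr0 mcoeff0 => /eqP.
Qed.

Lemma line_prod_neq0 (i : 'I_n.+1) : (i < i2)%N -> line_prod i != 0.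
Proof. by move=> ii; apply/prodf_neq0 => r _; apply: line_neq0. Qed.

Lemma mlead_line_prod (i : 'I_n.+1) : (i < i2)%N ->
  mlead (line_prod i) = (U_(i) *+ c)%MM.
Proof.
move=> ii; rewrite mlead_prod => [|r _ _]; last exact: line_neq0.
rewrite (eq_bigr (fun=> U_(i)%MM)) => [|r _]; last exact: mlead_line.
by apply/mnmP => j; rewrite mnm_sumE mulmnE sum_nat_const card_ord mulnC.
Qed.

Lemma lt02 : (i0 < i2)%N. Proof. by rewrite !inordK // ltnS ltnW. Qed.
Lemma lt12 : (i1 < i2)%N. Proof. by rewrite !inordK // ltnS ltnW. Qed.
Lemma i01 : i0 != i1.
Proof. by rewrite -(inj_eq val_inj) /= !inordK // ltnS ltnW. Qed.

Lemma line_prod_coef (i j : 'I_n.+1) : (i < i2)%N -> (j < i2)%N ->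
  (line_prod i)@_(U_(j) *+ c)%MM = (i == j)%:R.
Proof.
move=> ii ji; rewrite -meval_unit ?line_prod_homog // meval_line_prod.
have i2j : (i2 == j) = false by rewrite -(inj_eq val_inj) /= gtn_eqF.
under eq_bigr do rewrite i2j mulr0 subr0.
by rewrite prodr_const card_ord; case: eqP; rewrite ?expr1n // expr0n gtn_eqF.
Qed.

(* Common zeros of the two products of hyperplanes, in the chart x_2 = 1. *)
Definition grid_point (phi : 'I_n.+1 -> nat) (i : 'I_n.+1) : L :=
  if i == i2 then 1
  else if (i == i0) || (i == i1) then a (phi i %% c) else a (phi i).

Lemma line_prod_grid i phi : (i == i0) || (i == i1) ->
  (line_prod i).@[grid_point phi] = 0.
Proof.
move=> ii; rewrite meval_line_prod (bigD1 (Ordinal (ltn_pmod (phi i) c_gt0))) //=.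
rewrite /grid_point ii eqxx mulr1 ifF ?subrr ?mul0r //.
by case/orP: ii => /eqP->; rewrite -(inj_eq val_inj) /= ltn_eqF ?lt02 ?lt12.
Qed.

(** Without the monomials [x_0^c] and [x_1^c], the exponents of [x_0] and [x_1] stay below [c], so
    [c] values of each are enough for [grid_eq0]. *)
Lemma form_grid_eq0 (p : {mpoly L[n.+1]}) : p \is c.-homog ->
  p@_(U_(i0) *+ c)%MM = 0 -> p@_(U_(i1) *+ c)%MM = 0 ->
  (forall phi, p.@[grid_point phi] = 0) -> p = 0.
Proof.
move=> pc p0 p1 pg.
pose b i := if (i == i0) || (i == i1) then c else c.+1.
have full i mon : mon \in msupp p -> (mon i <= c)%N.
  by move=> /(dhomog_mf pc) /= <-; rewrite mdegE (bigD1 i) //= leq_addr.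
have fullE i mon : mon \in msupp p -> mon i = c -> mon = (U_(i) *+ c)%MM.
  move=> /(dhomog_mf pc) /= mc ic; apply/mnmP => j; rewrite mulmnE mnm1E.
  have [<-|ij] := eqVneq i j; first by rewrite mul1n.
  move: mc; rewrite mdegE (bigD1 i) //= ic -[X in _ = X]addn0 => /addnI/eqP.
  by rewrite sum_nat_eq0 => /forall_inP/(_ j); rewrite eq_sym => /(_ ij)/eqP.
apply: (@grid_eq0 L a a_inj _ _ (predC1 i2) b).
- move=> mon monp i _; rewrite /b; case: ifP => [ii|_]; last by rewrite ltnS full.
  rewrite ltn_neqAle full // andbT; apply/eqP => ic.
  have E := fullE _ _ monp ic; move: monp; rewrite mcoeff_msupp E.
  by case/orP: ii => /eqP->; rewrite ?p0 ?p1 eqxx.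
- move=> mon mon' /(dhomog_mf pc) /= mc /(dhomog_mf pc) /= mc' E.
  apply/mnmP => i; have [->|/E//] := eqVneq i i2.
  move: mc; rewrite -mc' !mdegE (bigD1 i2) //= [in RHS](bigD1 i2) //=.
  by rewrite (eq_bigr mon') => [/addIn//|j /E].
- move=> phi phib; rewrite -[RHS](pg phi); apply: meval_eq => i.
  rewrite /grid_point /=; case: eqP => //= /eqP ii; case: ifP => // ii'.
  by rewrite modn_small //; have := phib i ii; rewrite /b ii'.
Qed.

Lemma two_le_m : (2 <= m)%N.
Proof.
rewrite -bin_sub ?leq_addr // addKn; case: n n_gt1 => // n' _; case: c c_gt0 => // c' _.
by rewrite addSn binS addnS; apply: (@leq_add 1 1); rewrite bin_gt0 ?ltnS ?leq_addl // leqW // leq_addl.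
Qed.

(** Subtracting the multiples of the two products that match the coefficients of [x_0^c] and [x_1^c]
    reduces to [form_grid_eq0]: the forms vanishing on the whole grid have codimension [m - 2], and
    as many grid points cut them out. *)
Lemma grid_forms : exists y : nat -> 'I_n.+1 -> L, forall x : 'I_m -> L,
  (forall i, (i < m - 2)%N -> (form_of x).@[y i] = 0) ->
  exists A B, form_of x = A *: line_prod i0 + B *: line_prod i1.
Proof.
pose coefs (p : {mpoly L[n.+1]}) : 'rV[L]_m := \row_j p@_(monom j).
have coefsK p : p \is c.-homog -> form_of (coefs p 0) = p.
  by move=> pc; rewrite [RHS](homog_sum_monom pc); apply: eq_bigr => j _; rewrite mxE.
pose u0 := coefs (line_prod i0); pose u1 := coefs (line_prod i1).
pose rho phi : 'Hom('rV[L]_m, 'rV[L]_1) :=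
  linfun (mulmxr (\col_j ('X_[monom j] : {mpoly L[n.+1]}).@[grid_point phi])).
have rhoE phi x : rho phi x = ((form_of (x 0)).@[grid_point phi])%:M.
  rewrite lfunE /= [LHS]mx11_scalar meval_form_of; congr _%:M.
  by rewrite mxE; apply: eq_bigr => j _; rewrite mxE mulrC.
pose U0 : {vspace 'rV[L]_m} := <<[:: u0; u1]>>%VS.
have coefP (i : 'I_n.+1) : exists j : 'I_m, monom j = (U_(i) *+ c)%MM.
  by apply: monom_onto; rewrite mdegMn mdeg1 mul1n.
have [j0 j0P] := coefP i0; have [j1 j1P] := coefP i1.
have dimU0 : \dim U0 = 2.
  suff /eqP : free [:: u0; u1] by [].
  rewrite free_cons seq1_free span_seq1; apply/andP; split.
    apply/negP => /vlineP[k kE]; have := congr1 (fun v : 'rV_m => v 0 j0) kE.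
    rewrite !mxE j0P !line_prod_coef ?lt02 ?lt12 // eqxx eq_sym (negbTE i01) mulr0.
    by move/eqP; rewrite oner_eq0.
  apply/eqP => kE; have := congr1 (fun v : 'rV_m => v 0 j1) kE.
  by rewrite !mxE j1P !line_prod_coef ?lt12 // eqxx => /eqP; rewrite oner_eq0.
have U0P x : x \in U0 -> exists A B, form_of (x 0) = A *: line_prod i0 + B *: line_prod i1.
  rewrite /U0 span_cons span_seq1 => /memv_addP[_ /vlineP[A ->] [_ /vlineP[B ->] ->]].
  exists A, B; rewrite -[line_prod i0]coefsK ?line_prod_homog //.
  rewrite -[line_prod i1]coefsK ?line_prod_homog // /form_of !scaler_sumr -big_split.
  by apply: eq_bigr => j _ /=; rewrite !mxE scalerDl !scalerA.
have [||||y yP] := @greedy_kernel _ _ _ (fun=> 0%N) _ rho (m - 2)%N U0 fullv.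
- exact: subvf.
- move=> phi; apply/subvP => x /U0P[A [B xE]]; rewrite memv_ker rhoE xE.
  rewrite mevalD !mevalZ !line_prod_grid ?eqxx ?orbT // !mulr0 addr0.
  by apply/eqP/matrixP=> i j; rewrite !mxE mul0rn.
- move=> x _ x0; pose A := (form_of (x 0))@_(U_(i0) *+ c)%MM.
  pose B := (form_of (x 0))@_(U_(i1) *+ c)%MM.
  have xE : form_of (x 0) = A *: line_prod i0 + B *: line_prod i1.
    apply/eqP; rewrite -subr_eq0; apply/eqP; apply: form_grid_eq0.
    + by rewrite rpredB ?rpredD ?rpredZ ?line_prod_homog ?form_of_homog.
    + rewrite mcoeffB mcoeffD !mcoeffZ !line_prod_coef ?lt02 ?lt12 // eqxx.
      by rewrite eq_sym (negbTE i01) mulr1 mulr0 addr0 subrr.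
    + rewrite mcoeffB mcoeffD !mcoeffZ !line_prod_coef ?lt02 ?lt12 // eqxx.
      by rewrite (negbTE i01) mulr1 mulr0 add0r subrr.
    + move=> phi; rewrite mevalB mevalD !mevalZ !line_prod_grid ?eqxx ?orbT //.
      have /matrixP/(_ 0 0) := x0 phi; rewrite rhoE !mxE eqxx mulr1n => ->.
      by rewrite !mulr0 addr0 subrr.
  suff -> : x = A *: u0 + B *: u1.
    by rewrite memvD // memvZ // memv_span // !inE eqxx ?orbT.
  apply/rowP=> j; rewrite !mxE -(mcoeff_sum_monom (x 0)) -/(form_of _) xE.
  by rewrite mcoeffD !mcoeffZ.
- by rewrite dimU0 dim_rV subnKC ?two_le_m.
exists (fun i => grid_point (y i)) => x x0.
have /U0P[A [B]] : (\row_j x j) \in U0.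
  apply: yP => [|i im]; first exact: memvf.
  rewrite rhoE (_ : _.@[_] = 0); first by apply/matrixP=> k l; rewrite !mxE mul0rn.
  rewrite -[RHS](x0 i im); congr (meval _ _); apply: eq_bigr => j _.
  by rewrite mxE.
move=> E; exists A, B; rewrite -E; apply: eq_bigr => j _.
by rewrite mxE.
Qed.

(* By [grid_forms] every row of [x] is a combination of the two coprime forms, so that
   [v0 * line_prod i0 + v1 * line_prod i1 = 0]. Comparing leading monomials, that of [v0]
   is divisible by [x_1^c]: the coefficients of such monomials determine [x]. *)
Lemma leaf_dim_space :
  exists y : nat -> 'I_n.+1 -> L, forall U : {vspace 'M[L]_(N, m)},
    (forall x, x \in U -> leaf_cond e y x) -> (\dim U <= s0)%N.
Proof.
have [y yP] := grid_forms; exists y => U UP.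
have coefP (i : 'I_n.+1) : exists j : 'I_m, monom j = (U_(i) *+ c)%MM.
  by apply: monom_onto; rewrite mdegMn mdeg1 mul1n.
have [j0 j0P] := coefP i0; have [j1 j1P] := coefP i1.
pose v j (x : 'M[L]_(N, m)) := \sum_s x s j *: e s.
have v_homog j x : v j x \is d.-homog by apply: rpred_sum => s _; apply: rpredZ.
pose mon (i : 'I_s0) := (monom i + U_(i1) *+ c)%MM.
pose phi (x : 'M[L]_(N, m)) : 'rV[L]_s0 := \row_i (v j0 x)@_(mon i).
have phi_lin : linear phi.
  move=> k x z; apply/rowP=> i; rewrite !mxE /v !raddf_sum mulr_sumr -big_split.
  by apply: eq_bigr => s _ /=; rewrite !mcoeffZ !mxE mulrDl mulrA.
pose Phi : {linear 'M[L]_(N, m) -> 'rV[L]_s0} :=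
  HB.pack phi (GRing.isLinear.Build L _ _ _ phi phi_lin).
rewrite -[leqRHS](@dim_rV L); apply: (dim_inj (f := linfun Phi)) => x /UP[syz xi].
rewrite lfunE => /rowP phi0.
have rowE s : form_of (x s) = x s j0 *: line_prod i0 + x s j1 *: line_prod i1.
  have [i im|A [B E]] := yP (x s).
    by rewrite meval_form_of; apply: (xi i im).2.
  have xE j : x s j = (form_of (x s))@_(monom j) by rewrite mcoeff_sum_monom.
  rewrite {1}E; congr (_ *: _ + _ *: _).
    rewrite xE E j0P mcoeffD !mcoeffZ !line_prod_coef ?lt02 ?lt12 // eqxx.
    by rewrite eq_sym (negbTE i01) mulr1 mulr0 addr0.
  rewrite xE E j1P mcoeffD !mcoeffZ !line_prod_coef ?lt02 ?lt12 // eqxx.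
  by rewrite (negbTE i01) mulr1 mulr0 add0r.
have syz' : v j0 x * line_prod i0 + v j1 x * line_prod i1 = 0.
  rewrite -[RHS]syz syzygyE /v !mulr_suml -big_split; apply: eq_bigr => s _ /=.
  by rewrite rowE mulrDr -!scalerAl -!scalerAr.
have v00 : v j0 x = 0.
  apply/eqP; apply: contraT => v0.
  have v1 : v j1 x != 0.
    apply: contraNneq v0 => v1; move/eqP: syz'; rewrite v1 mul0r addr0 mulf_eq0.
    by rewrite (negbTE (line_prod_neq0 lt02)) orbF.
  have E : mlead (v j0 x * line_prod i0) = mlead (v j1 x * line_prod i1).
    by move/eqP: syz'; rewrite addr_eq0 => /eqP->; rewrite mleadN.
  move: E; rewrite !mleadM ?line_prod_neq0 ?lt02 ?lt12 // !mlead_line_prod ?lt02 ?lt12 //.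
  move/mnmP/(_ i1); rewrite !mnmDE !mulmnE !mnm1E eqxx (negbTE i01) mul0n mul1n addn0 => E.
  have ld : (U_(i1) *+ c <= mlead (v j0 x))%MM.
    apply/mnm_lepP => j; rewrite mulmnE mnm1E.
    by case: eqP => [<-|_]; rewrite ?mul0n // mul1n E leq_addl.
  have [j jE] : exists j : 'I_s0, monom j = (mlead (v j0 x) - U_(i1) *+ c)%MM.
    apply: monom_onto; have := congr1 (@mdeg _) (submK ld).
    rewrite mdegD mdegMn mdeg1 mul1n (_ : mdeg (mlead _) = d) => [<-|].
      by rewrite addnK.
    by apply: (dhomog_mf (v_homog j0 x)); apply: mlead_supp.
  have := phi0 j; rewrite !mxE /mon jE submK // => /eqP.
  by rewrite mleadc_eq0 (negbTE v0).
have v10 : v j1 x = 0.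
  move/eqP: syz'; rewrite v00 mul0r add0r mulf_eq0.
  by rewrite (negbTE (line_prod_neq0 lt12)) orbF => /eqP.
apply/matrixP=> s j; rewrite mxE; apply: form_of_eq0.
by rewrite rowE (e_free v00) (e_free v10) !scale0r addr0.
Qed.

End Space.

(** * The upper bounds *)

Lemma mmap_morph n (R S S' : comNzRingType) (f : R -> S) (h : 'I_n -> S)
    (phi : {rmorphism S -> S'}) p :
  phi (mmap f h p) = mmap (phi \o f) (phi \o h) p.
Proof.
rewrite /mmap rmorph_sum; apply: eq_bigr => mon _; rewrite rmorphM; congr (_ * _).
by rewrite /mmap1 rmorph_prod; apply: eq_bigr => i _; rewrite rmorphXn.
Qed.

Lemma eq_mmap n (R S : nzRingType) (f f' : R -> S) (h h' : 'I_n -> S) (p : {mpoly R[n]}) :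
  f =1 f' -> h =1 h' -> mmap f h p = mmap f' h' p.
Proof.
move=> ef eh; apply: eq_bigr => mon _; rewrite ef; congr (_ * _).
by apply: eq_bigr => i _; rewrite eh.
Qed.

Lemma meval_map_mpoly n (R S : comNzRingType) (f : R -> S) (v : 'I_n -> S) p :
  (map_mpoly f p).@[v] = mmap f v p.
Proof.
rewrite /map_mpoly mmap_morph; apply: eq_mmap => [c|i] /=; first exact: mevalC.
exact: mevalXU.
Qed.

Lemma mcoeff_map (n : nat) (R S : nzRingType) (f : {rmorphism R -> S}) (p : {mpoly R[n]}) mon :
  (map_mpoly f p)@_mon = f p@_mon.
Proof. exact: mcoeff_map_mpoly. Qed.

Lemma homog_map n (R S : nzRingType) (f : {rmorphism R -> S}) d (p : {mpoly R[n]}) :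
  p \is d.-homog -> map_mpoly f p \is d.-homog.
Proof.
move=> pd; apply/dhomogP => mon; rewrite mcoeff_msupp mcoeff_map => fp.
apply: (dhomog_mf pd); rewrite mcoeff_msupp; apply: contraNneq fp => ->.
by rewrite rmorph0.
Qed.

Section ExtKernel.
Variables (K : fieldType) (n N m : nat).
Variables (e : 'I_N -> {mpoly K[n]}) (w : 'I_m -> {mpoly K[n]}).
Local Notation ext := {ffun {set 'I_N} -> 'rV[K]_m}.

Lemma koszul_kernel_lin p : koszul_kernel e w p 0 /\
  forall c (f g : ext), koszul_kernel e w p f -> koszul_kernel e w p g ->
    koszul_kernel e w p (c *: f + g).
Proof.
split=> [|c f g [fp fk] [gp gk]]; split=> [S Sp|T].
- by rewrite ffunE.
- by rewrite /contract big1 // => s _; rewrite /lin_form big1 ?mulr0 // => j _;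
    rewrite ffunE mxE scale0r.
- by rewrite !ffunE fp // gp // scaler0 addr0.
- transitivity (c *: contract e (lin_form w f) T + contract e (lin_form w g) T).
    rewrite /contract scaler_sumr -big_split; apply: eq_bigr => s _ /=.
    rewrite scalerAr scalerAr -mulrDr -mulrDr; congr (_ * (_ * _)).
    rewrite /lin_form scaler_sumr -big_split; apply: eq_bigr => j _ /=.
    by rewrite !ffunE !mxE scalerDl scalerA.
  by rewrite fk gk scaler0 addr0.
Qed.

End ExtKernel.

Section KernelMap.
Variables (k K : fieldType) (iota : {rmorphism k -> K}) (n N m p : nat).
Variables (e : 'I_N -> {mpoly k[n]}) (w : 'I_m -> {mpoly k[n]}).
Local Notation ext F := {ffun {set 'I_N} -> 'rV[F]_m}.

Definition map_ext (f : ext k) : ext K := [ffun S => map_mx iota (f S)].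

Lemma koszul_kernel_map f : koszul_kernel e w p f ->
  koszul_kernel (fun s => map_mpoly iota (e s)) (fun j => map_mpoly iota (w j)) p
    (map_ext f).
Proof.
move=> [fp fk]; split=> [S Sp|T]; first by rewrite ffunE fp // map_mx0.
have <- : map_mpoly iota (contract e (lin_form w f) T) = 0 by rewrite fk rmorph0.
rewrite /contract rmorph_sum; apply: eq_bigr => s _.
rewrite rmorphM rmorph_sign rmorphM; congr (_ * (_ * _)).
rewrite /lin_form rmorph_sum; apply: eq_bigr => j _.
by rewrite /= map_mpolyZ ffunE mxE.
Qed.

(** A basis of [U] stays free over [K], as a nonzero maximal minor stays nonzero. Bounds proved over
    [K] thus hold over [k]. *)
Lemma dim_map_kernel (U : {vspace ext k}) :
  (forall f, f \in U -> koszul_kernel e w p f) ->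
  exists U' : {vspace ext K}, \dim U' = \dim U /\ forall f, f \in U' ->
    koszul_kernel (fun s => map_mpoly iota (e s)) (fun j => map_mpoly iota (w j)) p f.
Proof.
move=> UP; pose b := vbasis U; pose b' := [tuple map_ext b`_i | i < \dim U].
exists <<b'>>%VS; split.
  suff fr : free b' by move/eqP: fr; rewrite size_tuple.
  apply/freeP => x x0 i.
  have fb : forall y : 'I_(\dim U) -> k, \sum_i y i *: b`_i = 0 -> forall i, y i = 0.
    by apply/freeP; apply: basis_free (vbasisP U).
  have := @only_zero_specialize k K k idfun iota 'I_(\dim U)
    ({set 'I_N} * 'I_m)%type (fun q i => b`_i q.1 0 q.2) (fmorph_inj iota).
  move=> H; apply: H => [y y0|[S j]].
    apply: fb; apply/ffunP=> S; apply/rowP=> j; rewrite ext0.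
    rewrite sum_ffunE summxE -[RHS](y0 (S, j)); apply: eq_bigr => i' _ /=.
    by rewrite ffunE mxE mulrC.
  have := congr1 (fun f : ext K => f S 0 j) x0; rewrite ext0 => x0'.
  rewrite -[RHS]x0' sum_ffunE summxE; apply: eq_bigr => i' _ /=.
  by rewrite ffunE mxE (nth_map i') ?size_enum_ord // nth_ord_enum !ffunE mxE mulrC.
move=> f /(coord_span)->; have [k0 kD] := koszul_kernel_lin
   (fun s => map_mpoly iota (e s)) (fun j => map_mpoly iota (w j)) p.
apply: (big_ind (koszul_kernel _ _ p)) => // [f1 f2 f1k f2k|i _].
  by rewrite -[f1]scale1r; apply: kD.
rewrite -[_ *: _]addr0; apply: kD => //; rewrite (nth_map i) ?size_enum_ord //.
rewrite nth_ord_enum; apply: koszul_kernel_map; apply: UP.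
by apply: vbasis_mem; rewrite mem_nth ?size_tuple.
Qed.

End KernelMap.

(** * Generic points and their specializations *)

Section GenericPoints.
Variables (k : fieldType) (n tn : nat).

Definition coord_ring : idomainType := {mpoly k[#|{: 'I_tn * 'I_n.+1}|]}.

Definition gen_field : fieldType := {fraction coord_ring}.
Definition to_gen : {rmorphism coord_ring -> gen_field} := @tofrac coord_ring.

Lemma to_gen_inj : injective to_gen.
Proof. by move=> x y /eqP; rewrite tofrac_eq => /eqP. Qed.

Definition gen_const : {rmorphism k -> coord_ring} := @mpolyC _ k.
Definition gen_coord (i : 'I_tn) (l : 'I_n.+1) : coord_ring := 'X_(enum_rank (i, l)).

Definition gen_emb : {rmorphism k -> gen_field} := to_gen \o gen_const.
Definition gen_point i l : gen_field := to_gen (gen_coord i l).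

Lemma gen_meval (p : {mpoly k[n.+1]}) i :
  (map_mpoly gen_emb p).@[gen_point i] = to_gen (mmap gen_const (gen_coord i) p).
Proof. by rewrite meval_map_mpoly mmap_morph. Qed.

Section Specialize.
Variables (L : fieldType) (kappa : {rmorphism k -> L}) (y : 'I_tn -> 'I_n.+1 -> L).

(** It is defined on the polynomial ring only, so conditions on generic points are written with
    coefficients in [coord_ring] before [only_zero_specialize] applies. *)
Definition gen_spec : {rmorphism coord_ring -> L} :=
  mmap kappa (fun v => let: (i, l) := enum_val v in y i l).

Lemma gen_spec_const x : gen_spec (gen_const x) = kappa x.
Proof. exact: mmapC. Qed.

Lemma gen_spec_meval p i :
  gen_spec (mmap gen_const (gen_coord i) p) = (map_mpoly kappa p).@[y i].
Proof.
rewrite meval_map_mpoly mmap_morph; apply: eq_mmap => [x|l] /=.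
  exact: gen_spec_const.
by rewrite /gen_coord /gen_spec /= mmapX mmap1U enum_rankK.
Qed.

End Specialize.
End GenericPoints.

Section InfiniteExtension.
Variable k : fieldType.

(** Grids and special points need infinitely many distinct scalars: the powers of the variable of
    [k(t)]. *)
Definition inf_field : fieldType := {fraction {poly k}}.
Definition inf_emb : {rmorphism k -> inf_field} := @tofrac _ \o polyC.
Definition inf_seq (i : nat) : inf_field := @tofrac _ ('X^i : {poly k}).

Lemma inf_seq_inj : injective inf_seq.
Proof.
move=> i j /eqP; rewrite tofrac_eq => /eqP/(congr1 (fun p : {poly k} => size p)).
by rewrite !size_polyXn => -[].
Qed.

End InfiniteExtension.

Section PairSums.
Variables (R : pzRingType) (I J : finType).

Lemma sum_pair (F : I * J -> R) : \sum_p F p = \sum_i \sum_j F (i, j).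
Proof. by rewrite pair_bigA; apply: eq_bigr => -[]. Qed.

Lemma sum_select_snd (b : bool) j (A : I -> R) (z : I * J -> R) :
  \sum_p (if b && (j == p.2) then A p.1 else 0) * z p =
  if b then \sum_i A i * z (i, j) else 0.
Proof.
rewrite sum_pair; case: b; last by rewrite big1 // => i _; rewrite big1 // => ? _; rewrite mul0r.
apply: eq_bigr => i _; rewrite (bigD1 j) //= eqxx big1 ?addr0 // => j' jj.
by rewrite eq_sym (negbTE jj) mul0r.
Qed.

Lemma sum_select_fst (b : bool) i (A : J -> R) (z : I * J -> R) :
  \sum_p (if b && (i == p.1) then A p.2 else 0) * z p =
  if b then \sum_j A j * z (i, j) else 0.
Proof.
rewrite sum_pair; case: b; last by rewrite big1 // => ? _; rewrite big1 // => ? _; rewrite mul0r.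
rewrite (bigD1 i) //= eqxx [X in _ + X]big1 ?addr0 // => i' ii.
by rewrite big1 // => j _; rewrite eq_sym (negbTE ii) mul0r.
Qed.

End PairSums.

Section UpperBound.
Variables (k : fieldType) (n N d c : nat).
Hypothesis n_gt0 : (0 < n)%N.
Hypothesis c_le_d : (c <= d)%N.
Local Notation m := 'C(c + n, c).
Local Notation s0 := 'C(d - c + n, d - c).
Variable e : 'I_N -> {mpoly k[n.+1]}.
Hypothesis e_homog : forall s, e s \is d.-homog.
Hypothesis e_free : forall x : 'I_N -> k, \sum_s x s *: e s = 0 -> forall s, x s = 0.
Local Notation w F := (fun j => 'X_[monom j] : {mpoly F[n.+1]}).
Local Notation L := (inf_field k).
Local Notation a := (inf_seq k).
Let eL s : {mpoly L[n.+1]} := map_mpoly (inf_emb k) (e s).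

Lemma eL_homog s : eL s \is d.-homog. Proof. exact: homog_map. Qed.

Lemma eL_free (x : 'I_N -> L) : \sum_s x s *: eL s = 0 -> forall s, x s = 0.
Proof.
move=> x0; apply: (@only_zero_specialize k L k idfun (inf_emb k) _ 'X_{1..n.+1 < d.+1}
  (fun mon s => (e s)@_mon) (fmorph_inj _)) => [y y0|mon].
  apply: e_free; apply/mpolyP => mon; rewrite mcoeff0.
  have [md|md] := ltnP (mdeg mon) d.+1.
    rewrite raddf_sum /= -[RHS](y0 (BMultinom md)); apply: eq_bigr => s _.
    by rewrite mcoeffZ mulrC.
  rewrite raddf_sum big1 //= => s _.
  by rewrite mcoeffZ (dhomog_nemf_coeff (e_homog s)) ?mulr0 // neq_ltn md orbT.
have := congr1 (mcoeff mon) x0; rewrite mcoeff0 => x0m.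
rewrite -[RHS]x0m raddf_sum; apply: eq_bigr => s _.
by rewrite /= mcoeffZ mcoeff_map mulrC.
Qed.

Lemma independent_points N' (u : 'I_N' -> {mpoly L[n.+1]}) :
  (forall x : 'I_N' -> L, \sum_s x s *: u s = 0 -> forall s, x s = 0) ->
  exists y : nat -> 'I_n.+1 -> L, forall x : 'I_N' -> L,
    (forall i, (i < N')%N -> \sum_s (u s).@[y i] * x s = 0) -> forall s, x s = 0.
Proof.
move=> u_free.
pose rho y : 'Hom('rV[L]_N', 'rV[L]_1) := linfun (mulmxr (\col_s (u s).@[y])).
have rhoE y x : rho y x = (\sum_s (u s).@[y] * x 0 s)%:M.
  rewrite lfunE /= [LHS]mx11_scalar; congr _%:M.
  by rewrite mxE; apply: eq_bigr => s _; rewrite mxE mulrC.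
have [||||y yP] := @greedy_kernel _ _ ('I_n.+1 -> L) (fun=> 0) _ rho N' 0%VS fullv.
- exact: sub0v.
- by move=> y; apply: sub0v.
- move=> x _ x0; rewrite memv0; apply/eqP/rowP=> s; rewrite mxE.
  apply: (u_free (fun s => x 0 s)); apply/eqP; apply: contraT.
  move=> /(meval_neq0 (@inf_seq_inj k))[y]; rewrite raddf_sum => /eqP[].
  have /matrixP/(_ 0 0) := x0 y; rewrite rhoE !mxE eqxx mulr1n => x0y.
  by rewrite -[RHS]x0y; apply: eq_bigr => s' _; rewrite /= mevalZ mulrC.
- by rewrite dimv0 dim_rV.
exists y => x x0 s; have : (\row_s x s) \in (0%VS : {vspace 'rV[L]_N'}).
  apply: yP => [|i iN]; first exact: memvf.
  rewrite rhoE (_ : \sum_s _ = 0); first by apply/matrixP => ? ?; rewrite !mxE mul0rn.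
  by rewrite -[RHS](x0 i iN); apply: eq_bigr => s' _; rewrite mxE.
by rewrite memv0 => /eqP/rowP/(_ s); rewrite !mxE.
Qed.

Lemma leaf_solution : (2 <= m)%N ->
  exists y1 y2 : nat -> 'I_n.+1 -> L, forall x : 'M[L]_(N, m), leaf_cond eL y2 x ->
    (forall i, (i < s0)%N -> forall j, \sum_s (eL s).@[y1 i] * x s j = 0) -> x = 0.
Proof.
move=> m2; have c_gt0 : (0 < c)%N by move: m2; case: (c) => //; rewrite bin0.
have [y2 y2P] : exists y : nat -> 'I_n.+1 -> L, forall U : {vspace 'M[L]_(N, m)},
    (forall x, x \in U -> leaf_cond eL y x) -> (\dim U <= s0)%N.
  have := eL_homog; have := eL_free; move: eL => u.
  move: n_gt0 u; case: (n) => [//|[|n']] _ u uf uh.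
    exact: (leaf_dim_line (@inf_seq_inj k)).
  exact: (leaf_dim_space (@inf_seq_inj k)).
have [y1 y1P] := leaf_points (@inf_seq_inj k) eL_free y2P.
by exists y1, y2.
Qed.

(** [gen_span] uses [N] points, and the recursion asks for at least [m]. *)
Let tn := (N + m)%N.
Local Notation K := (gen_field k n tn).
Local Notation q := (@gen_point k n tn).
Let eK s : {mpoly K[n.+1]} := map_mpoly (gen_emb k n tn) (e s).

Lemma gen_span (x : 'I_N -> K) :
  (forall i, \sum_s (eK s).@[q i] * x s = 0) -> forall s, x s = 0.
Proof.
move=> x0; have [y yP] := independent_points eL_free.
apply: (@only_zero_specialize (coord_ring k n tn) K L (gen_spec (inf_emb k) (fun i => y i))
  (to_gen k n tn) 'I_N 'I_tn (fun i s => mmap (gen_const k n tn) (gen_coord k i) (e s))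
  (@to_gen_inj k n tn)) => [z z0|i].
  apply: yP => i iN; have it : (i < tn)%N by rewrite ltn_addr.
  have := z0 (Ordinal it); under eq_bigr do rewrite gen_spec_meval.
  by [].
by under eq_bigr do rewrite -gen_meval; rewrite x0.
Qed.

(** Each [I] has its own specialization, which sends its members, in the order of [enum I], to
    independent points; equations at points outside [I] are replaced by zero. *)
Lemma gen_indep (I : {set 'I_tn}) : #|I| = m -> forall x : 'I_m -> K,
  (forall i, i \in I -> \sum_j (w K j).@[q i] * x j = 0) -> forall j, x j = 0.
Proof.
move=> Im x x0; have [y yP] := @independent_points _ (w L) (@form_of_eq0 L n c).
pose idx (i : 'I_tn) := index i (enum I).
apply: (@only_zero_specialize (coord_ring k n tn) K L (gen_spec (inf_emb k) (fun i => y (idx i)))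
  (to_gen k n tn) 'I_m 'I_tn (fun i j => if i \in I then
    mmap (gen_const k n tn) (gen_coord k i) (w k j) else 0)
  (@to_gen_inj k n tn)) => [z z0|i].
  apply: yP => i im; have i_lt : (i < size (enum I))%N by rewrite -cardE Im.
  case: (enum I) i_lt (erefl (enum I)) => // i0 _ _ _.
  have iI : nth i0 (enum I) i \in I by rewrite -mem_enum mem_nth // -cardE Im.
  have := z0 (nth i0 (enum I) i).
  rewrite (eq_bigr (fun j => (w L j).@[y i] * z j)) // => j _.
  by rewrite iI gen_spec_meval map_mpolyX /idx index_uniq ?enum_uniq // -cardE Im.
case iI : (i \in I); last by rewrite big1 // => j _; rewrite rmorph0 mul0r.
rewrite -[RHS](x0 i iI); apply: eq_bigr => j _.
by rewrite -gen_meval map_mpolyX.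
Qed.

(** All conditions on [x] form one linear system over [coord_ring]. Sending [I2] to the [m - 2]
    points of [leaf_solution], and the first [s0] members of [I1] to its further points, leaves only
    the zero solution. *)
Lemma gen_no_syzygy (I1 I2 : {set 'I_tn}) : [disjoint I1 & I2] ->
  (s0 <= #|I1|)%N -> (#|I2| + 2)%N = m -> forall x : 'I_N -> 'I_m -> K,
  \sum_s \sum_j x s j *: (eK s * w K j) = 0 ->
  (forall i, i \in I1 :|: I2 -> forall j, \sum_s (eK s).@[q i] * x s j = 0) ->
  (forall i, i \in I2 -> forall s, \sum_j (w K j).@[q i] * x s j = 0) ->
  forall s j, x s j = 0.
Proof.
move=> dI sI1 mI2 x syz xe xw s j.
have [|y1 [y2 yP]] := leaf_solution; first by rewrite -mI2 leq_addl.
pose y (i : 'I_tn) := if i \in I2 then y2 (index i (enum I2)) else y1 (index i (enum I1)).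
(* The degree bound keeps the set of equations finite; coefficients beyond it vanish by
   homogeneity. *)
pose Q := ('X_{1..n.+1 < (d + c).+1} + 'I_tn * 'I_m + 'I_tn * 'I_N)%type.
pose ev i (p : {mpoly k[n.+1]}) := mmap (gen_const k n tn) (gen_coord k i) p.
pose C (r : Q) (sj : 'I_N * 'I_m) : coord_ring k n tn :=
  match r with
  | inl (inl mon) => gen_const k n tn ((e sj.1 * w k sj.2)@_mon)
  | inl (inr (i, j')) => if (i \in I1 :|: I2) && (j' == sj.2) then ev i (e sj.1) else 0
  | inr (i, s') => if (i \in I2) && (s' == sj.1) then ev i (w k sj.2) else 0
  end.
have CE (F : fieldType) (phi : {rmorphism coord_ring k n tn -> F})
    (psi : {rmorphism k -> F}) (v : 'I_tn -> 'I_n.+1 -> F) (z : 'I_N * 'I_m -> F) :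
    (forall x, phi (gen_const k n tn x) = psi x) ->
    (forall i p, phi (ev i p) = (map_mpoly psi p).@[v i]) ->
  [/\ forall mon, \sum_r phi (C (inl (inl mon)) r) * z r =
        (\sum_s \sum_j z (s, j) *: (map_mpoly psi (e s) * w F j))@_mon,
      forall i j, \sum_r phi (C (inl (inr (i, j))) r) * z r =
        if i \in I1 :|: I2 then \sum_s (map_mpoly psi (e s)).@[v i] * z (s, j) else 0
    & forall i s, \sum_r phi (C (inr (i, s)) r) * z r =
        if i \in I2 then \sum_j (w F j).@[v i] * z (s, j) else 0].
  move=> phiC phiE; split=> [mon|i j'|i s'].
  - rewrite sum_pair raddf_sum; apply: eq_bigr => s'' _; rewrite raddf_sum.
    apply: eq_bigr => j'' _; rewrite /= phiC mcoeffZ mulrC -mcoeff_map rmorphM /=.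
    by rewrite map_mpolyX.
  - rewrite -sum_select_snd; apply: eq_bigr => -[s'' j''] _ /=.
    by rewrite (fun_if phi) rmorph0 phiE.
  - rewrite -sum_select_fst; apply: eq_bigr => -[s'' j''] _ /=.
    by rewrite (fun_if phi) rmorph0 phiE map_mpolyX.
apply: (@only_zero_specialize (coord_ring k n tn) K L (gen_spec (inf_emb k) y)
  (to_gen k n tn) ('I_N * 'I_m)%type Q C (@to_gen_inj k n tn) _ (fun sj => x sj.1 sj.2) _ (s, j)).
  move=> z z0; pose Z : 'M[L]_(N, m) := \matrix_(s, j) z (s, j).
  have [|//|C1 C2 C3] := CE L (gen_spec (inf_emb k) y) (inf_emb k) y z.
  - exact: gen_spec_const.
  - by move=> i p; apply: gen_spec_meval.
  suff Z0 : Z = 0.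
    by move=> [s' j']; have := congr1 (fun M : 'M_(N, m) => M s' j') Z0; rewrite !mxE.
  have index_lt (A : {set 'I_tn}) i : (i < #|A|)%N ->
      exists r, r \in A /\ index r (enum A) = i.
    move=> iA; have /set0Pn[r0 _] : A != set0 by rewrite -card_gt0 (leq_ltn_trans _ iA).
    exists (nth r0 (enum A) i); rewrite -mem_enum mem_nth -?cardE //.
    by rewrite index_uniq ?enum_uniq // -cardE.
  apply: yP; [split=> [|i im]|move=> i is0 j'].
  - apply/mpolyP => mon; rewrite mcoeff0.
    have E : \sum_s \sum_j Z s j *: (eL s * w L j) =
        \sum_s \sum_j z (s, j) *: (eL s * w L j).
      by apply: eq_bigr => s' _; apply: eq_bigr => j' _; rewrite mxE.
    rewrite E; have [md|md] := ltnP (mdeg mon) (d + c).+1.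
      by rewrite -(C1 (BMultinom md)) z0.
    apply: (@dhomog_nemf_coeff _ _ mdeg (d + c)%N); last by rewrite neq_ltn md orbT.
    apply: rpred_sum => s' _; apply: rpred_sum => j' _; apply: rpredZ.
    by apply: dhomogM; rewrite ?eL_homog // dhomogX /= mdeg_monom.
  - have [|r [rI ri]] := index_lt I2 i; first by rewrite -mI2 addnK in im.
    split=> [j'|s'].
      have := C2 r j'; rewrite z0 inE rI orbT /y rI ri => E.
      by rewrite [RHS]E; apply: eq_bigr => s' _; rewrite mxE.
    have := C3 r s'; rewrite z0 rI /y rI ri => E.
    by rewrite [RHS]E; apply: eq_bigr => j' _; rewrite mxE.
  - have [|r [rI ri]] := index_lt I1 i; first exact: leq_trans is0 sI1.
    have rI2 : r \in I2 = false by apply: (disjointFr dI).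
    have := C2 r j'; rewrite z0 inE rI /y rI2 ri => E.
    by rewrite [RHS]E; apply: eq_bigr => s' _; rewrite mxE.
have [//|i p|C1 C2 C3] := CE K (to_gen k n tn) (gen_emb k n tn) q (fun sj => x sj.1 sj.2).
  by rewrite gen_meval.
case=> [[mon|[i j']]|[i s']].
- by rewrite C1 syz mcoeff0.
- by rewrite C2; case: ifP => // iI; apply: xe.
- by rewrite C3; case: ifP => // iI; apply: xw.
Qed.

Local Notation ext := {ffun {set 'I_N} -> 'rV[k]_m}.

Lemma eK_data (U : {vspace ext}) p :
  (forall f, f \in U -> koszul_kernel e (w k) p f) ->
  exists U' : {vspace {ffun {set 'I_N} -> 'rV[K]_m}}, \dim U' = \dim U /\
    forall f, f \in U' -> state eK (w K) q 0 set0 p f.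
Proof.
move=> UP; have [U' [dU U'P]] := dim_map_kernel (gen_emb k n tn) UP.
exists U'; split; first exact: dU.
move=> f /U'P [fp fk]; split; [|by move=> i|by move=> i; rewrite inE].
split; [exact: fp|move=> T; rewrite -[RHS](fk T)].
apply: eq_contract; [by []|move=> S].
by apply: eq_bigr => j _; rewrite map_mpolyX.
Qed.

Lemma koszul_kernel_eq0 p (f : ext) : (m <= p)%N ->
  koszul_kernel e (w k) p f -> f = 0.
Proof.
move=> mp fk; have [|U' [dU U'P]] := @eK_data <[f]>%VS p.
  move=> _ /vlineP[x ->]; rewrite -[_ *: _]addr0.
  by have [k0 kD] := koszul_kernel_lin e (w k : 'I_m -> _) p; apply: (kD x f 0).
apply/eqP; move: dU; have -> : U' = 0%VS.
  apply/eqP; rewrite -subv0; apply/subvP=> g /U'P gs; rewrite memv0; apply/eqP.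
  apply: (@state_big K n.+1 N m eK (w K) tn q gen_span gen_indep 0 set0 p g) => //.
  - by rewrite cards0.
  - by move=> i; rewrite inE.
  - by rewrite cards0.
by rewrite dimv0 dim_vline; case: eqP.
Qed.

Lemma koszul_kernel_dim (U : {vspace ext}) : (0 < m)%N ->
  (forall f, f \in U -> koszul_kernel e (w k) m.-1 f) ->
  (\dim U <= 'C(s0 + m.-1 - 1, m.-1))%N.
Proof.
move=> m0 /eK_data[U' [<- U'P]].
have := @state_dim K _ _ _ eK (w K) tn s0 q gen_span gen_indep gen_no_syzygy (leq_addl _ _)
  0 set0 m.-1 U' (leq0n _).
rewrite cards0 !subn0; apply=> //; first by move=> i; rewrite inE.
by rewrite add0n prednK.
Qed.

End UpperBound.

(** * The lower bound *)

Section Decomposable.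
Variables (N : nat) (R : comNzRingType).
Implicit Types (T S : {set 'I_N}).

Fixpoint decomposable p : ('I_p -> 'I_N -> R) -> {set 'I_N} -> R :=
  match p with
  | 0 => fun _ S => (S == set0)%:R
  | p'.+1 => fun v => create (v ord0) (decomposable (fun i => v (lift ord0 i)))
  end.

Fixpoint contract_all p : ('I_p -> 'I_N -> R) -> ({set 'I_N} -> R) -> {set 'I_N} -> R :=
  match p with
  | 0 => fun _ f => f
  | p'.+1 => fun m f => contract_all (fun i => m (lift ord0 i)) (contract (m ord0) f)
  end.

Lemma eq_create (v v' : 'I_N -> R) f f' : v =1 v' -> f =1 f' -> create v f =1 create v' f'.
Proof. by move=> ev ef T; apply: eq_bigr => s _; rewrite ev ef. Qed.

Lemma eq_decomposable p (v v' : 'I_p -> 'I_N -> R) :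
  v =2 v' -> decomposable v =1 decomposable v'.
Proof.
elim: p v v' => [//|p IH] v v' ev; apply: eq_create; first exact: ev.
by apply: IH => i; apply: ev.
Qed.

Lemma decomposable_size p (v : 'I_p -> 'I_N -> R) S :
  #|S| != p -> decomposable v S = 0.
Proof.
elim: p v S => [|p IH] v S Sp /=; first by rewrite -cards_eq0 (negbTE Sp).
rewrite /create big1 // => s sS; rewrite IH ?mulr0 //.
by rewrite (cardsD1 s) sS add1n eqSS in Sp.
Qed.

Lemma create_sumr (I : finType) v (a : I -> R) (F : I -> {set 'I_N} -> R) T :
  create v (fun S => \sum_i a i * F i S) T = \sum_i a i * create v (F i) T.
Proof.
transitivity (\sum_(s in T) \sum_i a i * ((-1) ^+ pos T s * (v s * F i (T :\ s)))).
  apply: eq_bigr => s _; rewrite !mulr_sumr; apply: eq_bigr => i _.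
  by rewrite (mulrCA (v s)) (mulrCA _ (a i)).
by rewrite exchange_big; apply: eq_bigr => i _; rewrite mulr_sumr.
Qed.

Lemma lift_lift0 p (i : 'I_p.+1) (j : 'I_p) :
  lift (lift ord0 i) (lift ord0 j) = lift ord0 (lift i j).
Proof. by apply: val_inj; rewrite /= /bump /= !add1n ltnS addnS. Qed.

Lemma lift_lift00 p (i : 'I_p.+1) : lift (lift ord0 i) ord0 = ord0 :> 'I_p.+2.
Proof. exact: val_inj. Qed.

(** A contraction is an antiderivation; [contract_create] peels off one factor at a time. *)
Lemma contract_decomposable p mu (v : 'I_p.+1 -> 'I_N -> R) T :
  contract mu (decomposable v) T =
  \sum_(i < p.+1) (-1) ^+ i * (\sum_s mu s * v i s) * decomposable (fun j => v (lift i j)) T.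
Proof.
elim: p v T => [|p IH] v T.
  have := contract_create mu (v ord0) (decomposable (fun i : 'I_0 => v (lift ord0 i))) T.
  rewrite [create _ (contract _ _) _]big1 ?addr0 => [E|s sT].
    by rewrite big_ord1 expr0 mul1r -E.
  rewrite [contract _ _ _]big1 ?mulr0 // => s' _ /=.
  by rewrite (negbTE (_ : s' |: _ != set0)) ?mulr0 //; apply/set0Pn; exists s'; rewrite setU11.
have := contract_create mu (v ord0) (decomposable (fun i => v (lift ord0 i))) T.
move/(canRL (addrK _)) => E; rewrite big_ord_recl expr0 mul1r [LHS]E; congr (_ + _).
rewrite (eq_create (fun=> erefl) (IH _)) create_sumr -sumrN.
apply: eq_bigr => i _; rewrite lift0 exprS mulN1r !mulNr; congr (- (_ * _)).
apply: eq_create => [s|]; first by rewrite lift_lift00.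
by apply: eq_decomposable => j s; rewrite lift_lift0.
Qed.

Lemma eq_contract_all p (m : 'I_p -> 'I_N -> R) f f' : f =1 f' ->
  contract_all m f =1 contract_all m f'.
Proof.
elim: p m f f' => [//|p IH] m f f' ef; apply: IH.
by apply: eq_contract.
Qed.

Lemma contract_all_sumr (I : finType) p (m : 'I_p -> 'I_N -> R) (a : I -> R)
    (F : I -> {set 'I_N} -> R) T :
  contract_all m (fun S => \sum_i a i * F i S) T = \sum_i a i * contract_all m (F i) T.
Proof.
elim: p m F T => [//|p IH] m F T /=; rewrite -IH; apply: eq_contract_all => S.
by rewrite contract_sumr; apply: eq_bigr => i _; rewrite contractZr.
Qed.

Lemma contract_allZr p (m : 'I_p -> 'I_N -> R) a f T :
  contract_all m (fun S => a * f S) T = a * contract_all m f T.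
Proof.
have := contract_all_sumr m (fun _ : 'I_1 => a) (fun _ => f) T.
rewrite big_ord1 => <-; apply: eq_contract_all => S.
by rewrite big_ord1.
Qed.

(** Each contraction expands the Gram determinant along its first row. *)
Lemma contract_all_decomposable p (m v : 'I_p -> 'I_N -> R) :
  contract_all m (decomposable v) set0 = \det (\matrix_(i, j) \sum_s m i s * v j s).
Proof.
elim: p m v => [|p IH] m v; first by rewrite /= eqxx det_mx00.
rewrite [LHS]/= -/(decomposable v) (eq_contract_all _ (contract_decomposable (m ord0) v)).
rewrite contract_all_sumr (expand_det_row _ ord0); apply: eq_bigr => j _.
rewrite IH mxE /cofactor /= add0n mulrCA mulrA; congr (_ * \det _).
by apply/matrixP => i i'; rewrite !mxE.
Qed.

End Decomposable.

Lemma map_decomposable N (R R' : comNzRingType) (phi : {rmorphism R -> R'}) p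
    (v : 'I_p -> 'I_N -> R) S :
  phi (decomposable v S) = decomposable (fun i s => phi (v i s)) S.
Proof.
elim: p v S => [|p IH] v S /=; first by rewrite rmorph_nat.
rewrite rmorph_sum; apply: eq_bigr => s _.
by rewrite !rmorphM rmorph_sign IH.
Qed.

Section LowerBound.
Variables (k : fieldType) (n N M r : nat).
Variables (e : 'I_N -> {mpoly k[n.+1]}) (w : 'I_M.+1 -> {mpoly k[n.+1]}).
Variable mg : 'I_r.+1 -> 'X_{1..n.+1}.
Hypothesis mg_inj : injective mg.
Variable h : 'I_r.+1 -> 'I_M.+1 -> 'I_N -> k.
Hypothesis hE : forall l j, 'X_[mg l] * w j = \sum_s h l j s *: e s.
Local Notation ext := {ffun {set 'I_N} -> 'rV[k]_M.+1}.

Let C : idomainType := {mpoly k[r.+1]}.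
Let A : idomainType := {mpoly C[n.+1]}.
Let emb : {rmorphism {mpoly k[n.+1]} -> A} := map_mpoly (@mpolyC r.+1 k).
Let cst : {rmorphism C -> A} := @mpolyC n.+1 C.

(* [gen_form] is [g], its coefficients being the unknowns of [C], and [gen_coef j] are the
   coordinates of [g * w j] in [V]. The element [syz al] of [Z_M] is the coefficient of
   ['X_[al]] in the quotient by [g] of the differential of their exterior product. *)
Definition gen_coef j s : C := \sum_l h l j s *: 'X_l.
Definition gen_form : A := \sum_l cst 'X_l * 'X_[mg l].
Definition syz_coef (S : {set 'I_N}) (j : 'I_M.+1) : C :=
  (-1) ^+ j * decomposable (fun i => gen_coef (lift j i)) S.
Definition syz (al : 'X_{1..r.+1}) : ext := [ffun S : {set 'I_N} => \row_j (syz_coef S j)@_al].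

Lemma gen_formM j : gen_form * emb (w j) = \sum_s emb (e s) * cst (gen_coef j s).
Proof.
transitivity (\sum_l cst 'X_l * emb ('X_[mg l] * w j)).
  rewrite /gen_form mulr_suml; apply: eq_bigr => l _.
  by rewrite -mulrA rmorphM /= map_mpolyX.
under eq_bigr do rewrite hE rmorph_sum mulr_sumr.
rewrite exchange_big; apply: eq_bigr => s _ /=.
rewrite /gen_coef [cst _]rmorph_sum mulr_sumr; apply: eq_bigr => l _.
rewrite [emb _]map_mpolyZ -[RHS]mulrC -mul_mpolyC.
by rewrite -(mul_mpolyC (h l j s)) [cst (_ * _)]rmorphM -!mulrA mulrCA.
Qed.

Lemma gen_form_neq0 : gen_form != 0.
Proof.
apply: contraTneq isT => g0; have := congr1 (mcoeff (mg ord0)) g0.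
rewrite mcoeff0 /gen_form raddf_sum (bigD1 ord0) //= mcoeffCM mcoeffX eqxx mulr1.
rewrite big1 ?addr0 => [X0|l l0]; last first.
  by rewrite mcoeffCM mcoeffX (inj_eq mg_inj) (negbTE l0) mulr0.
have := congr1 (mcoeff U_(ord0)) X0; rewrite mcoeffXU mcoeff0 eqxx.
by move/eqP; rewrite oner_eq0.
Qed.

(** The contraction of the exterior product of the [g * w j] is [g] times this sum, and contracting
    twice gives zero; [g] cancels because [A] is a domain. *)
Lemma syz_coef_kernel T :
  contract (fun s => emb (e s)) (fun S => \sum_j cst (syz_coef S j) * emb (w j)) T = 0.
Proof.
pose v j s : A := cst (gen_coef j s).
have E S : contract (fun s => emb (e s)) (decomposable v) S =
    gen_form * \sum_j cst (syz_coef S j) * emb (w j).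
  rewrite contract_decomposable mulr_sumr; apply: eq_bigr => j _.
  rewrite -gen_formM /syz_coef [cst (_ * _)]rmorphM rmorph_sign /=.
  rewrite -[_%:MP]/(cst _) map_decomposable.
  by rewrite -!mulrA mulrCA; congr (_ * (_ * _)); apply: mulrC.
apply/eqP; rewrite -(inj_eq (mulfI gen_form_neq0)) mulr0 -contractZr.
by rewrite -(eq_contract (fun=> erefl) E) contractK.
Qed.

Lemma syz_kernel al : koszul_kernel e w M (syz al).
Proof.
split=> [S Sp|T].
  apply/rowP=> j; rewrite ffunE !mxE /syz_coef decomposable_size //.
  by rewrite mulr0 mcoeff0.
apply/mpolyP => mon; rewrite mcoeff0.
have := congr1 (fun p : A => (p@_mon)@_al) (syz_coef_kernel T).
rewrite !mcoeff0 => k0; rewrite -[RHS]k0 /contract !raddf_sum; apply: eq_bigr => s _ /=.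
rewrite !raddfMsign; congr (_ * _).
rewrite /lin_form !mulr_sumr !raddf_sum; apply: eq_bigr => j _ /=.
rewrite mulrCA -rmorphM [X in X@_al](mcoeffCM (syz_coef (s |: T) j)) mcoeff_map.
rewrite [X in _ = X@_al]mulrC mcoeffCM -scalerAr mcoeffZ.
by rewrite ffunE mxE mulrC.
Qed.

Section Points.
Variables (K : fieldType) (iota : {rmorphism k -> K}) (q : 'I_M.+1 -> 'I_n.+1 -> K).
Local Notation evl p i := ((map_mpoly iota p).@[q i]).
Hypothesis det_points : \det (\matrix_(i, j) evl (w j) i) != 0.
Hypothesis indep_prod : forall x : {ffun 'I_M -> 'I_r.+1} -> k,
  \sum_phi iota (x phi) * \prod_(i < M) evl 'X_[mg (phi i)] (lift ord0 i) = 0 ->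
  forall phi, x phi = 0.
Let CK : idomainType := {mpoly K[r.+1]}.
Let emK : {rmorphism C -> CK} := map_mpoly iota.
Let cK : {rmorphism K -> CK} := @mpolyC r.+1 K.
Let ga i : CK := \sum_l evl 'X_[mg l] i *: 'X_l.

Lemma gen_coef_point i j : \sum_s cK (evl (e s) i) * emK (gen_coef j s) =
  ga i * cK (evl (w j) i).
Proof.
have E s : emK (gen_coef j s) = \sum_l iota (h l j s) *: 'X_l.
  rewrite [LHS]rmorph_sum; apply: eq_bigr => l _.
  by rewrite /= map_mpolyZ map_mpolyX.
transitivity (\sum_s \sum_l cK (evl (e s) i) * (iota (h l j s) *: 'X_l)).
  by apply: eq_bigr => s _; rewrite E mulr_sumr.
rewrite exchange_big /ga mulr_suml; apply: eq_bigr => l _ /=.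
transitivity ((\sum_s iota (h l j s) * evl (e s) i) *: ('X_l : CK)).
  rewrite scaler_suml; apply: eq_bigr => s _.
  by rewrite mul_mpolyC scalerA mulrC.
rewrite mulrC mul_mpolyC scalerA; congr (_ *: _).
transitivity (evl ('X_[mg l] * w j) i); last by rewrite rmorphM mevalM mulrC.
rewrite hE (raddf_sum (map_mpoly iota)) raddf_sum; apply: eq_bigr => s _ /=.
by rewrite map_mpolyZ mevalZ.
Qed.

Hypothesis monom_point : exists l, evl 'X_[mg l] ord0 != 0.

Lemma ga_neq0 : ga ord0 != 0.
Proof.
have [l ln0] := monom_point; apply: contraNneq ln0 => g0.
have := congr1 (mcoeff U_(l)) g0; rewrite mcoeff0 /ga raddf_sum (bigD1 l) //=.
rewrite mcoeffZ mcoeffXU eqxx mulr1 big1 ?addr0 => [->//|l' ll].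
by rewrite mcoeffZ mcoeffXU (negbTE ll) mulr0.
Qed.

(** The factor in [S_c] is evaluated at [q ord0], the exterior factor is contracted with the other
    points. After multiplication by [g(q_0)], the values [g(q_0) w_j(q_0)] become a contraction with
    [q_0], and the left side is the Gram determinant with entries [g(q_i) w_j(q_i)]; the values of
    [g] come out row by row. *)
Lemma contract_syz :
  contract_all (fun i s => cK (evl (e s) (lift ord0 i)))
    (fun S => \sum_j cK (evl (w j) ord0) * emK (syz_coef S j)) set0 =
  (\prod_(i < M) ga (lift ord0 i)) * cK (\det (\matrix_(i, j) evl (w j) i)).
Proof.
apply: (mulfI ga_neq0); rewrite -contract_allZr mulrA.
pose v j s := emK (gen_coef j s).
have D := contract_all_decomposable (fun i s => cK (evl (e s) i)) v.
transitivity (contract_all (fun i s => cK (evl (e s) i)) (decomposable v) set0).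
  apply: eq_contract_all => S; rewrite contract_decomposable mulr_sumr.
  apply: eq_bigr => j _; rewrite gen_coef_point /syz_coef rmorphM rmorph_sign.
  by rewrite map_decomposable -!mulrA [RHS]mulrCA [X in _ = _ * X]mulrCA.
rewrite D; have -> : (\matrix_(i, j) \sum_s cK (evl (e s) i) * v j s) =
    diag_mx (\row_i ga i) *m map_mx cK (\matrix_(i, j) evl (w j) i).
  apply/matrixP=> i j; rewrite mxE mul_diag_mx !mxE; exact: gen_coef_point.
rewrite det_mulmx det_diag det_map_mx big_ord_recl mxE; congr (_ * _ * _).
by apply: eq_bigr => i _; rewrite mxE.
Qed.

(** A relation with coefficients [x] defines the functional [Lk] on polynomials in the coefficients
    of [g], and it kills the left side of [contract_syz]. The right side then gives a relation among
    products of values of monomials, which [indep_prod] excludes. *)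
Lemma syz_free (x : 'X_{1..r.+1} -> k) (al : seq 'X_{1..r.+1}) : uniq al ->
  (forall a, a \in al -> mdeg a = M) ->
  \sum_(a <- al) x a *: syz a = 0 -> forall a, a \in al -> x a = 0.
Proof.
move=> al_uniq al_deg x0.
(* The product of the [ga] may involve monomials of degree [M] outside [al]; they get coefficient
   0. *)
pose x' a := if a \in al then x a else 0.
suff x'0 (phi : {ffun 'I_M -> 'I_r.+1}) : x' (\sum_(i < M) U_(phi i))%MM = 0.
  move=> a aal; have := al_deg a aal; move/eqP; rewrite basis_cover => /mapP[t _ aE].
  have := x'0 [ffun i => tnth t i]; rewrite /x'.
  have -> : (\sum_(i < M) U_([ffun i => tnth t i] i) = a)%MM.
    rewrite aE; apply/mnmP => l; rewrite mnm_sumE mnmE -sum1_count.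
    rewrite big_tuple [RHS]big_mkcond; apply: eq_bigr => i _.
    by rewrite ffunE mnm1E /=; case: (tnth t i == l).
  by rewrite aal.
move: phi; apply: (@indep_prod (fun phi : {ffun 'I_M -> 'I_r.+1} => x' (\sum_(i < M) U_(phi i))%MM)).
pose Lk (p : CK) : K := \sum_(a <- al) iota (x a) * p@_a.
have LkD : {morph Lk : p p' / p + p'}.
  by move=> p p'; rewrite /Lk -big_split; apply: eq_bigr => a _; rewrite /= mcoeffD mulrDr.
have Lk0 : Lk 0 = 0 by rewrite /Lk big1 // => a _; rewrite mcoeff0 mulr0.
have LkZ y p : Lk (cK y * p) = y * Lk p.
  by rewrite /Lk mulr_sumr; apply: eq_bigr => a _; rewrite /= mcoeffCM mulrCA.
have Lksum (I : Type) (s : seq I) (P : pred I) (F : I -> CK) :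
  Lk (\sum_(i <- s | P i) F i) = \sum_(i <- s | P i) Lk (F i) by exact: big_morph.
have Lksyz S j : Lk (emK (syz_coef S j)) = 0.
  have := congr1 (fun f : ext => iota (f S 0 j)) x0; rewrite ext0 rmorph0 => xs.
  rewrite -[RHS]xs sum_ffunE summxE rmorph_sum; apply: eq_bigr => a _.
  by rewrite !ffunE !mxE mcoeff_map rmorphM.
have Lkall p (ms : 'I_p -> 'I_N -> K) (f : {set 'I_N} -> CK) T :
    Lk (contract_all (fun i s => cK (ms i s)) f T) = contract_all ms (fun S => Lk (f S)) T.
  elim: p ms f T => [//|p IH] ms f T /=; rewrite IH; apply: eq_contract_all => S.
  rewrite Lksum; apply: eq_bigr => s _.
  by rewrite -(rmorph_sign cK) !LkZ.
have := congr1 Lk contract_syz; rewrite Lkall.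
rewrite (@eq_contract_all _ _ _ _ _ (fun S => 0 * 0)); last first.
  move=> S; rewrite mul0r Lksum big1 // => j _.
  by rewrite LkZ Lksyz mulr0.
rewrite contract_allZr mul0r mulrC LkZ => /esym/eqP.
rewrite mulf_eq0 (negbTE det_points) /= => /eqP prod0.
rewrite -[RHS]prod0 (bigA_distr_bigA (fun i l => evl 'X_[mg l] (lift ord0 i) *: ('X_l : CK))) Lksum.
apply: eq_bigr => phi _; rewrite scaler_prod -mul_mpolyC [_%:MP]/(cK _) LkZ mulrC; congr (_ * _).
rewrite mprodXE /Lk /x'; set a0 := (\sum_(i < M) _)%MM.
have [aal|aal] := boolP (a0 \in al); last first.
  rewrite rmorph0 big1_seq // => a /andP[_ aal']; rewrite mcoeffX.
  by rewrite (negbTE (_ : a0 != a)) ?mulr0 //; apply: contraNneq aal => ->.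
rewrite (bigD1_seq a0) //= mcoeffX eqxx mulr1 big1 ?addr0 // => a aa0.
by rewrite mcoeffX eq_sym (negbTE aa0) mulr0.
Qed.

End Points.
End LowerBound.

Lemma syz_space (k : fieldType) (n N m r0 : nat) (e : 'I_N -> {mpoly k[n.+1]})
    (w : 'I_m -> {mpoly k[n.+1]}) (mg : 'I_r0 -> 'X_{1..n.+1})
    (K : fieldType) (iota : {rmorphism k -> K}) (q : nat -> 'I_n.+1 -> K) :
  (0 < m)%N -> (0 < r0)%N -> injective mg ->
  (forall l j, exists x, 'X_[mg l] * w j = \sum_s x s *: e s) ->
  \det (\matrix_(i < m, j < m) (map_mpoly iota (w j)).@[q i]) != 0 ->
  (forall x : {ffun 'I_m.-1 -> 'I_r0} -> k,
    \sum_phi iota (x phi) *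
       \prod_(i < m.-1) (map_mpoly iota 'X_[mg (phi i)]).@[q i.+1] = 0 ->
    forall phi, x phi = 0) ->
  (exists l, (map_mpoly iota 'X_[mg l]).@[q 0%N] != 0) ->
  exists U : {vspace {ffun {set 'I_N} -> 'rV[k]_m}},
    (forall f, f \in U -> koszul_kernel e w m.-1 f) /\
    \dim U = 'C(r0 + m.-1 - 1, m.-1).
Proof.
case: m r0 w mg => [//|M] [//|r] w mg _ _ mg_inj hex dW indep mon0.
have [h hE] : exists h : 'I_r.+1 -> 'I_M.+1 -> 'I_N -> k,
    forall l j, 'X_[mg l] * w j = \sum_s h l j s *: e s.
  apply: (@fin_all_exists _ (fun=> 'I_M.+1 -> 'I_N -> k)
    (fun l h => forall j, 'X_[mg l] * w j = \sum_s h j s *: e s)) => l.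
  by apply: (@fin_all_exists _ (fun=> 'I_N -> k)
    (fun j h => 'X_[mg l] * w j = \sum_s h s *: e s)) => j; apply: hex.
(* One syzygy for each monomial of degree [M] in the [r + 1] coefficients of [g]. *)
pose b := [tuple syz h (monom i) | i < 'C(M + r, M)].
have [k0 kD] := koszul_kernel_lin e w M.
exists <<b>>%VS; split=> [f /(coord_span)->|].
  apply: (big_ind (koszul_kernel _ _ M)) => // [f1 f2 f1k f2k|i _].
    by rewrite -[f1]scale1r; apply: kD.
  rewrite -[_ *: _]addr0; apply: kD => //; rewrite (nth_map i) ?size_enum_ord //.
  exact: syz_kernel mg_inj _ hE _.
suff fr : free b by rewrite (eqP fr) size_tuple addSn subn1 addnC.
apply/freeP => x x0 i.
pose al := [seq monom i | i <- enum 'I_('C(M + r, M))] : seq 'X_{1..r.+1}.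
have al_uniq : uniq al by rewrite map_inj_uniq ?enum_uniq //; apply: monom_inj.
pose y (a : 'X_{1..r.+1}) := if [pick i : 'I_('C(M + r, M)) | monom i == a] is Some i then x i else 0.
have yE j : y (monom j) = x j.
  rewrite /y; case: pickP => [j' /eqP/monom_inj->//|/(_ j)]; by rewrite eqxx.
rewrite -yE; apply: (syz_free hE dW indep mon0 al_uniq) => [a /mapP[j _ ->]||].
- exact: mdeg_monom.
- rewrite big_map big_enum /= -[RHS]x0; apply: eq_bigr => j _.
  by rewrite yE (nth_map j) ?size_enum_ord // nth_ord_enum.
- by apply: map_f; rewrite mem_enum.
Qed.

Section LowerBoundForms.
Variables (k : fieldType) (n N d c : nat).
Hypothesis c_le_d : (c <= d)%N.
Local Notation m := 'C(c + n, c).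
Local Notation s0 := 'C(d - c + n, d - c).
Variable e : 'I_N -> {mpoly k[n.+1]}.
Hypothesis e_span : forall p : {mpoly k[n.+1]}, p \is d.-homog ->
  exists x : 'I_N -> k, p = \sum_s x s *: e s.
Local Notation w F := (fun j => 'X_[monom j] : {mpoly F[n.+1]}).
Local Notation ext := {ffun {set 'I_N} -> 'rV[k]_m}.

Lemma koszul_kernel_dim_ge : exists U : {vspace ext},
  (forall f, f \in U -> koszul_kernel e (w k) m.-1 f) /\
  \dim U = 'C(s0 + m.-1 - 1, m.-1).
Proof.
have m_gt0 : (0 < m)%N by rewrite bin_gt0 leq_addr.
have s0_gt0 : (0 < s0)%N by rewrite bin_gt0 leq_addr.
(* [gen_indep] speaks of [N + m] points and is used with [N = 0], whence [0 + m]. *)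
pose K := gen_field k n (0 + m); pose iota := gen_emb k n (0 + m).
pose co (i : nat) (l : 'I_n.+1) : coord_ring k n (0 + m) :=
  if insub i is Some i' then gen_coord k i' l else 0.
pose q (i : nat) (l : 'I_n.+1) : K := to_gen k n (0 + m) (co i l).
have coE (i : 'I_(0 + m)) : co i =1 gen_coord k i by move=> l; rewrite /co valK.
have qE (p : {mpoly k[n.+1]}) i : (map_mpoly iota p).@[q i] =
    to_gen k n (0 + m) (mmap (gen_const k n (0 + m)) (co i) p).
  by rewrite meval_map_mpoly mmap_morph.
have [|||||U [UP dU]] := @syz_space k n N m s0 e (w k) (fun l => monom l) K iota q m_gt0 s0_gt0.
- exact: monom_inj.
- move=> l j; apply: e_span.
  have : ('X_[monom l] : {mpoly k[n.+1]}) * 'X_[monom j] \is (d - c + c).-homog.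
    by apply: dhomogM; rewrite dhomogX /= mdeg_monom.
  by rewrite subnK.
- set W := \matrix_(i, j) _; suff fW : row_full W by rewrite -unitfE -unitmxE -row_full_unit.
  rewrite -cokermx_eq0; apply/eqP/matrixP=> j l; rewrite [RHS]mxE.
  apply: (@gen_indep k n 0 c setT _ (fun j => cokermx W j l)).
    by rewrite cardsT card_ord.
  move=> i _; have := congr1 (fun M : 'M__ => M i l) (mulmx_coker W).
  rewrite mxE [in RHS]mxE => E; rewrite -[RHS]E; apply: eq_bigr => j' _; congr (_ * _).
  transitivity (map_mpoly iota 'X_[monom j']).@[gen_point k i].
    by rewrite map_mpolyX.
  rewrite mxE qE gen_meval; congr (to_gen _ _ _ _).
  by apply: eq_mmap => // l'; rewrite coE.
- have idxP (i : 'I_m.-1) : (i.+1 < 0 + m)%N by rewrite add0n -ltn_predRL.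
  pose idx i := Ordinal (idxP i).
  have idx_inj : injective idx by move=> i i' /(congr1 val) /= [/val_inj].
  (* Distinct generic points have disjoint sets of unknowns, so a product of values of monomials at
     them is a single monomial, from which every factor can be read off. *)
  pose E (phi : {ffun 'I_m.-1 -> 'I_s0}) : 'X_{1..#|{: 'I_(0 + m) * 'I_n.+1}|} :=
    (\sum_(i < m.-1) \sum_l U_(enum_rank (idx i, l)) *+ monom (phi i) l)%MM.
  have E_inj : injective E.
    move=> phi phi' Ephi; apply/ffunP=> i; apply: monom_inj; apply/mnmP => l.
    have EE (psi : {ffun 'I_m.-1 -> 'I_s0}) : E psi (enum_rank (idx i, l)) = monom (psi i) l.
      rewrite mnm_sumE (bigD1 i) //= mnm_sumE (bigD1 l) //=.
      rewrite mulmnE mnm1E eqxx mul1n !big1 ?addn0 // => [i' ii|l' ll].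
        rewrite mnm_sumE big1 // => l' _; rewrite mulmnE mnm1E.
        by rewrite (inj_eq enum_rank_inj) xpair_eqE (inj_eq idx_inj) (negbTE ii).
      rewrite mulmnE mnm1E.
      by rewrite (inj_eq enum_rank_inj) xpair_eqE (negbTE ll) andbF.
    by rewrite -!EE Ephi.
  move=> x x0 phi.
  have prodE (psi : {ffun 'I_m.-1 -> 'I_s0}) : \prod_(i < m.-1) mmap (gen_const k n (0 + m)) (co i.+1) 'X_[monom (psi i)] =
      'X_[E psi] :> coord_ring k n (0 + m).
    rewrite -mprodXE; apply: eq_bigr => i _; rewrite mmapX -mprodXE.
    by apply: eq_bigr => l _; rewrite (coE (idx i)) -mpolyXn.
  have : \sum_psi x psi *: ('X_[E psi] : {mpoly k[#|{: 'I_(0 + m) * 'I_n.+1}|]}) = 0.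
    apply: (@to_gen_inj k n (0 + m)); rewrite [RHS]rmorph0 -[RHS]x0 [LHS]rmorph_sum.
    apply: eq_bigr => psi _; rewrite -mul_mpolyC -prodE [LHS]rmorphM rmorph_prod.
    by congr (_ * _); apply: eq_bigr => i _; rewrite qE.
  move/(congr1 (mcoeff (E phi))); rewrite mcoeff0 raddf_sum (bigD1 phi) //=.
  rewrite mcoeffZ mcoeffX eqxx mulr1 big1 ?addr0 // => psi ne.
  by rewrite mcoeffZ mcoeffX (inj_eq E_inj) (negbTE ne) mulr0.
- exists (Ordinal s0_gt0); rewrite qE -(rmorph0 (to_gen k n (0 + m))).
  rewrite (inj_eq (@to_gen_inj k n (0 + m))) mmapX; apply/prodf_neq0 => l _.
  rewrite expf_neq0 // (coE (Ordinal (m_gt0 : (0 < 0 + m)%N))).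
  apply/eqP => /(congr1 (mcoeff U_(enum_rank (Ordinal (m_gt0 : (0 < 0 + m)%N), l))))/eqP.
  by rewrite mcoeffXU eqxx mcoeff0 oner_eq0.
by exists U.
Qed.

End LowerBoundForms.

(** * Laurent series and regions *)

Section Lattice.
Variables (k : fieldType) (n N d : nat).
Variable E : 'I_N -> {mpoly k[n.+1]}.
Hypothesis E_span : forall p : {mpoly k[n.+1]}, p \is d.-homog ->
  exists x : 'I_N -> k, p = \sum_s x s *: E s.

Local Notation lattice := {ffun 'I_n.+1 -> int}.
Local Notation coeffs := ({set 'I_N} -> lattice -> k^o).
Implicit Types (f g : coeffs) (a : lattice) (R : pred lattice).

Definition lat (m : 'X_{1..n.+1}) : lattice := [ffun i => (m i)%:Z].
Definition ldeg a : int := \sum_i a i.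

Lemma ldeg_lat m : ldeg (lat m) = (mdeg m)%:Z.
Proof. by rewrite mdegE (big_morph Posz PoszD erefl); apply: eq_bigr => i _; rewrite ffunE. Qed.

Lemma ldegD a b : ldeg (a + b) = ldeg a + ldeg b.
Proof. by rewrite -big_split; apply: eq_bigr => i _; rewrite ffunE. Qed.

Lemma ldegB a b : ldeg (a - b) = ldeg a - ldeg b.
Proof. by rewrite -sumrN -big_split; apply: eq_bigr => i _; rewrite !ffunE. Qed.

(* A function on the lattice [Z^(n+1)] stands for a formal Laurent series in the
   [x_i], on which the forms of degree [d] act by multiplication. *)
Definition act (p : {mpoly k[n.+1]}) (phi : lattice -> k^o) : lattice -> k^o :=
  fun a => \sum_(i < 'C(d + n, d)) p@_(monom i) * phi (a - lat (monom i)).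

Lemma actC p p' phi a : act p (act p' phi) a = act p' (act p phi) a.
Proof.
rewrite /act; under eq_bigr do rewrite mulr_sumr.
under [RHS]eq_bigr do rewrite mulr_sumr.
rewrite exchange_big; apply: eq_bigr => i _; apply: eq_bigr => j _ /=.
by rewrite mulrCA addrAC.
Qed.

Lemma act_sum (I : Type) (r : seq I) (P : pred I) p (c : I -> k) (F : I -> lattice -> k^o) a :
  act p (fun b => \sum_(i <- r | P i) c i * F i b) a =
  \sum_(i <- r | P i) c i * act p (F i) a.
Proof.
rewrite /act; under eq_bigr do rewrite mulr_sumr.
rewrite exchange_big; apply: eq_bigr => i _; rewrite mulr_sumr.
by apply: eq_bigr => j _; rewrite mulrCA.
Qed.

Definition ldiff f : coeffs :=
  fun T a => \sum_(s | s \notin T) (-1) ^+ pos T s * act (E s) (f (s |: T)) a.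

Definition restr R f : coeffs := fun T a => if R a then f T a else 0.

Fact ldiff_linear : linear ldiff.
Proof.
move=> c f g; apply/funext=> T; apply/funext=> a.
have actD p (phi psi : lattice -> k^o) :
    act p (c *: phi + psi) a = c * act p phi a + act p psi a.
  rewrite /act [c * _]mulr_sumr -[RHS]big_split; apply: eq_bigr => i _.
  by rewrite [RHS]/= -mulrCA -mulrDr.
transitivity (\sum_(s | s \notin T) (c * ((-1) ^+ pos T s * act (E s) (f (s |: T)) a) +
    (-1) ^+ pos T s * act (E s) (g (s |: T)) a)).
  by apply: eq_bigr => s _; rewrite actD mulrDr mulrCA.
by rewrite big_split -mulr_sumr.
Qed.

HB.instance Definition _ := GRing.isLinear.Build k coeffs coeffs _ ldiff ldiff_linear.

Fact restr_linear R : linear (restr R).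
Proof.
move=> c f g; apply/funext=> T; apply/funext=> a.
rewrite -[RHS]/(c *: restr R f T a + restr R g T a) /restr.
by case: (R a); rewrite ?scaler0 ?addr0.
Qed.

HB.instance Definition _ R := GRing.isLinear.Build k coeffs coeffs _ (restr R) (restr_linear R).

Lemma ldiffK f : ldiff (ldiff f) = 0.
Proof.
apply/funext=> T; apply/funext=> a.
have FC s t (S : {set 'I_N}) : act (E s) (act (E t) (f S)) a = act (E t) (act (E s) (f S)) a.
  exact: actC.
rewrite -[RHS]/(0 : k) -(contract2_sum T FC) {1}/ldiff; apply: eq_bigr => s _.
by rewrite act_sum.
Qed.

Definition supported R f : Prop := forall T a, ~~ R a -> f T a = 0.
Definition homogeneous p (e : int) f : Prop :=
  forall (T : {set 'I_N}) a, (#|T| != p) || (ldeg a != e) -> f T a = 0.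

Lemma restr_id R f : supported R f -> restr R f = f.
Proof. by move=> fR; apply/funext=> T; apply/funext=> a; rewrite /restr; case: ifPn => // /fR. Qed.

Lemma supported_restr R f : supported R (restr R f).
Proof. by move=> T a; rewrite /restr => /negbTE->. Qed.

Lemma homogeneous_restr p e R f : homogeneous p e f -> homogeneous p e (restr R f).
Proof. by move=> fp T a pa; rewrite /restr fp // if_same. Qed.

Lemma homogeneousB p e f g : homogeneous p e f -> homogeneous p e g -> homogeneous p e (f - g).
Proof.
by move=> fp gp T a pa; rewrite -[LHS]/(f T a - g T a) fp // gp // subrr.
Qed.

Lemma supportedB R f g : supported R f -> supported R g -> supported R (f - g).
Proof. by move=> fR gR T a Ra; rewrite -[LHS]/(f T a - g T a) fR // gR // subrr. Qed.

Lemma homogeneous_ldiff p e f : homogeneous p.+1 (e - d%:Z) f -> homogeneous p e (ldiff f).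
Proof.
move=> fp T a pa; rewrite /ldiff big1 // => s sT; rewrite /act big1 ?mulr0 // => i _.
rewrite fp ?mulr0 // cardsU1 sT add1n eqSS ldegB ldeg_lat mdeg_monom.
by rewrite (inj_eq (addIr _)).
Qed.

(** The complex of a region has the differential cut back to that region. Cycles and boundaries are
    predicates because the series form an infinite-dimensional space. *)
Definition is_cycle R p e f : Prop :=
  [/\ homogeneous p e f, supported R f & restr R (ldiff f) = 0].
Definition is_boundary R p e f : Prop :=
  exists g, [/\ homogeneous p.+1 (e - d%:Z) g, supported R g & f = restr R (ldiff g)].

Definition neg_region j a := [forall i : 'I_n.+1, if (i < j)%N then a i < 0 else 0 <= a i].
Definition free_region (j : 'I_n.+1) a :=
  [forall i : 'I_n.+1, (i != j) ==> if (i < j)%N then a i < 0 else 0 <= a i].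

(* [free_region j] is the disjoint union of [neg_region j] and [neg_region j.+1]; it is
   acyclic, so the connecting map between the homologies of the two is an isomorphism. *)
Section Step.
Variable j : 'I_n.+1.
Let L := free_region j.
Let R := neg_region j.
Let R' := neg_region j.+1.

Lemma latB_le a (m : 'X_{1..n.+1}) i : (a - lat m) i <= a i.
Proof. by rewrite !ffunE lerBlDr lerDl. Qed.

Lemma R_L a : R a -> L a.
Proof. by move=> /forallP Ra; apply/forallP => i; apply/implyP. Qed.

Lemma R'_L a : R' a -> L a.
Proof.
move=> /forallP Ra; apply/forallP => i; apply/implyP => ij.
by have := Ra i; rewrite ltnS leq_eqVlt (negbTE (ij : i != j :> nat)).
Qed.

Lemma L_split a : L a -> R' a = ~~ R a.
Proof.
move=> /forallP La; apply/idP/idP => [/forallP Ra|nR].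
  apply/negP => /forallP Ra'; have := Ra j; have := Ra' j.
  by rewrite ltnn ltnSn leNgt => /negbTE->.
apply/forallP => i; have := La i; rewrite ltnS [(i <= j)%N]leq_eqVlt.
have [->|ij] := eqVneq i j; last by rewrite ?(negbTE (ij : i != j :> nat)).
move=> _; rewrite ?eqxx /= ltNge; apply: contra nR => aj; apply/forallP => i'.
by have := La i'; have [->|//] := eqVneq i' j; rewrite ltnn.
Qed.

(** Multiplication raises exponents, so inside [L] it does not leave [R]: the series on [R] form a
    subcomplex, those on [R'] the quotient. *)
Lemma R_up a m : R (a - lat m) -> L a -> R a.
Proof.
move=> /forallP Ra /forallP La; apply/forallP => i.
have := Ra i; have := La i; have [->|//] := eqVneq i j.
by rewrite ltnn => _ aj; apply: le_trans aj (latB_le _ _ _).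
Qed.

(** Each coordinate condition of [L] is an upper or a lower bound, so exponents between two members
    of [L] lie in [L]. Hence the differential cut back to [L] still squares to zero. *)
Lemma L_convex a m m' : L a -> L (a - lat m - lat m') -> L (a - lat m).
Proof.
move=> /forallP La /forallP La'; apply/forallP => i; apply/implyP => ij.
have := La i; have := La' i; rewrite ij /=.
by case: ifP => _ h h'; [apply: le_lt_trans (latB_le _ _ _) h'|apply: le_trans h (latB_le _ _ _)].
Qed.

Lemma split_L f : supported L f -> f = restr R f + restr R' f.
Proof.
move=> fL; apply/funext=> T; apply/funext=> a.
rewrite -[RHS]/(restr R f T a + restr R' f T a) /restr.
have [La|La] := boolP (L a); last by rewrite !fL // !if_same addr0.
by rewrite L_split //; case: (R a); rewrite /= ?addr0 ?add0r.
Qed.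

Lemma restr_R_L f : restr R (restr L f) = restr R f.
Proof.
apply/funext=> T; apply/funext=> a; rewrite /restr; case: ifP => // /R_L->//.
Qed.

Lemma restr_R'_L f : restr R' (restr L f) = restr R' f.
Proof.
apply/funext=> T; apply/funext=> a; rewrite /restr; case: ifP => // /R'_L->//.
Qed.

Lemma restr_R'_R f : restr R' (restr R f) = 0.
Proof.
apply/funext=> T; apply/funext=> a; rewrite /restr; case: ifP => // R'a.
by have := L_split (R'_L R'a); rewrite R'a => /esym/negbTE->.
Qed.

Lemma supported_R_L f : supported R f -> supported L f.
Proof. by move=> fR T a La; apply: fR; apply: contra La; apply: R_L. Qed.

Lemma supported_R'_L f : supported R' f -> supported L f.
Proof. by move=> fR T a La; apply: fR; apply: contra La; apply: R'_L. Qed.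

Lemma ldiff_R f : supported R f -> restr L (ldiff f) = restr R (ldiff f).
Proof.
move=> fR; apply/funext=> T; apply/funext=> a; rewrite /restr.
have [Ra|Ra] := boolP (R a); first by rewrite R_L.
case: ifP => // La; rewrite /ldiff big1 // => s _; rewrite /act big1 ?mulr0 // => i _.
by rewrite fR ?mulr0 //; apply: contra Ra => /R_up; apply.
Qed.

Lemma ldiff_R' f : supported L f -> restr R' (ldiff f) = restr R' (ldiff (restr R' f)).
Proof.
move=> fL; rewrite {1}(split_L fL) raddfD raddfD /= -[X in X + _ = _]restr_R'_L.
by rewrite ldiff_R ?restr_R'_R ?add0r //; apply: supported_restr.
Qed.

Lemma ldiff_LK f : supported L f -> restr L (ldiff (restr L (ldiff f))) = 0.
Proof.
move=> fL; transitivity (restr L (ldiff (ldiff f))); last by rewrite ldiffK raddf0.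
apply/funext=> T; apply/funext=> a; rewrite {1 3}/restr; case: ifP => // La.
apply: eq_bigr => s _; congr (_ * _); apply: eq_bigr => i _; congr (_ * _).
rewrite /restr; case: ifPn => // La'; rewrite /ldiff big1 // => t _.
rewrite /act big1 ?mulr0 // => i' _; rewrite fL ?mulr0 //.
by apply: contra La'; apply: L_convex.
Qed.

Definition shift a : lattice := a + lat (U_(j) *+ d).

(* Exterior multiplication by [x_j^d] combined with division by [x_j^d]. *)
Lemma homotopy : exists h : coeffs -> coeffs, h 0 = 0 /\ forall f, supported L f ->
  [/\ supported L (h f), forall p e, homogeneous p e f -> homogeneous p.+1 (e - d%:Z) (h f)
    & restr L (ldiff (h f)) + h (restr L (ldiff f)) = f].
Proof.
have [c cE] : exists c : 'I_N -> k, 'X_[U_(j) *+ d] = \sum_s c s *: E s.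
  by apply: E_span; rewrite dhomogX /= mdegMn mdeg1 mul1n.
pose h f : coeffs := fun T a => \sum_(t in T) (-1) ^+ pos T t * (c t * f (T :\ t) (shift a)).
have L_shift a : L (shift a) = L a.
  apply: eq_forallb => i; have [->//|ij] := eqVneq i j.
  by rewrite /shift !ffunE mulmnE mnm1E (negbTE (_ : j != i)) ?mul0n ?addr0 // eq_sym.
exists h; split=> [|f fL].
  apply/funext=> T; apply/funext=> a; rewrite /h big1 // => t _.
  by rewrite [X in c t * X]/(0 : k) !mulr0.
split=> [T a La|p e fp T a pa|].
- by rewrite /h big1 // => t _; rewrite fL ?mulr0 // L_shift.
- rewrite /h big1 // => t tT; rewrite fp ?mulr0 //.
  rewrite (cardsD1 t) tT add1n eqSS in pa; rewrite /shift ldegD ldeg_lat mdegMn mdeg1 mul1n.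
  by rewrite -(inj_eq (addIr d%:Z)) subrK in pa.
apply/funext=> T; apply/funext=> a.
rewrite -[LHS]/(restr L (ldiff (h f)) T a + h (restr L (ldiff f)) T a).
have [La|La] := boolP (L a); last first.
  rewrite fL // /restr (negbTE La) add0r /h big1 // => t _.
  by rewrite L_shift (negbTE La) mulr0 mulr0.
(* The anticommutator is division by [x_j^d] followed by multiplication by [sum_s c_s E_s = x_j^d],
   that is, the identity. *)
have := contract_create_sum (fun s t S => c t * act (E s) (f S) (shift a)) T.
have -> : \sum_s c s * act (E s) (f T) (shift a) = f T a.
  transitivity (act 'X_[U_(j) *+ d] (f T) (shift a)).
    rewrite cE /act; under eq_bigr do rewrite mulr_sumr.
    rewrite exchange_big; apply: eq_bigr => i _ /=.
    by rewrite raddf_sum mulr_suml; apply: eq_bigr => s _; rewrite /= mcoeffZ mulrA.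
  have [|i iE] := @monom_onto n d (U_(j) *+ d)%MM; first by rewrite mdegMn mdeg1 mul1n.
  rewrite /act (bigD1 i) //= mcoeffX iE eqxx mul1r /shift addrK big1 ?addr0 // => i' ii.
  by rewrite mcoeffX -iE (inj_eq (@monom_inj n d)) eq_sym (negbTE ii) mul0r.
move=> <-; congr (_ + _).
  rewrite /restr La; apply: eq_bigr => s _; congr (_ * _).
  rewrite act_sum; apply: eq_bigr => t _; congr (_ * _).
  rewrite /act mulr_sumr; apply: eq_bigr => i _.
  by rewrite /shift addrAC mulrCA.
apply: eq_bigr => t _; rewrite /restr L_shift La /ldiff [c t * _]mulr_sumr; congr (_ * _).
by apply: eq_bigr => s _; rewrite mulrCA.
Qed.

Lemma cycle_ldiff p e f : is_cycle R' p e f -> restr L (ldiff f) = restr R (ldiff f).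
Proof.
move=> [_ _ f0]; rewrite [LHS](split_L (@supported_restr L (ldiff f))).
by rewrite restr_R'_L f0 addr0 restr_R_L.
Qed.

(** This is the connecting map: the differential of [f] on [L] lies in [R] because [f] is a cycle on
    [R']. *)
Lemma step_cycle p e f : is_cycle R' p.+1 (e - d%:Z) f -> is_cycle R p e (restr R (ldiff f)).
Proof.
move=> fc; have [fh fR' f0] := fc; split; last first.
- by rewrite -restr_R_L -(cycle_ldiff fc) ldiff_LK ?raddf0 //; apply: supported_R'_L.
- exact: supported_restr.
- by apply/homogeneous_restr/homogeneous_ldiff.
Qed.

Lemma boundaryN Q p e f : is_boundary Q p e f -> is_boundary Q p e (- f).
Proof.
move=> [g [gh gR ->]]; exists (- g); split.
- by rewrite -[- g]add0r; apply: homogeneousB.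
- by rewrite -[- g]add0r; apply: supportedB.
- by rewrite !raddfN.
Qed.

(** If the image of [f] is the differential of [g] on [R], then [f - g] is a cycle on [L], hence the
    differential of [h (f - g)], whose [R'] part bounds [f]. Conversely, the connecting map respects
    boundaries. *)
Lemma step_boundary p e f : is_cycle R' p.+1 (e - d%:Z) f ->
  (is_boundary R p e (restr R (ldiff f)) <-> is_boundary R' p.+1 (e - d%:Z) f).
Proof.
move=> fc; have [fh fR' f0] := fc; have [h [h0 hP]] := homotopy.
split=> [[g [gh gR gE]]|[g [gh gR' gE]]].
  have fgL : supported L (f - g).
    by apply: supportedB; [apply: supported_R'_L|apply: supported_R_L].
  have [hL hh hE] := hP _ fgL.
  have fg0 : restr L (ldiff (f - g)) = 0.
    by rewrite raddfB raddfB /= (cycle_ldiff fc) gE ldiff_R // subrr.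
  exists (restr R' (h (f - g))); split.
  - by apply: homogeneous_restr; apply: hh; apply: homogeneousB.
  - exact: supported_restr.
  - rewrite -ldiff_R' // -restr_R'_L; rewrite fg0 h0 addr0 in hE.
    by rewrite hE raddfB /= restr_id // -(restr_id gR) restr_R'_R subr0.
have gL := supported_R'_L gR'; pose dg := restr R (ldiff g).
have dgR : supported R dg by apply: supported_restr.
have LgE : restr L (ldiff g) = dg + f.
  rewrite gE [LHS](split_L (@supported_restr L (ldiff g))).
  by rewrite restr_R_L restr_R'_L.
have : restr L (ldiff (dg + f)) = 0 by rewrite -LgE ldiff_LK.
rewrite !raddfD /= ldiff_R // (cycle_ldiff fc) addrC => /eqP.
rewrite addr_eq0 => /eqP->; apply: boundaryN; exists dg; split=> //.
by apply: homogeneous_restr; apply: homogeneous_ldiff.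
Qed.

(** On [L], the cycle [f] is the differential of [h f]: the [R'] part of [h f] is the preimage, its
    [R] part gives the boundary. *)
Lemma step_surj p e f : is_cycle R p e f -> exists f',
  is_cycle R' p.+1 (e - d%:Z) f' /\ is_boundary R p e (f - restr R (ldiff f')).
Proof.
move=> [fh fR f0]; have fL := supported_R_L fR; have [h [h0 hP]] := homotopy.
have [hL hh hE] := hP _ fL; rewrite (ldiff_R fR) f0 h0 addr0 in hE.
have fc : is_cycle R' p.+1 (e - d%:Z) (restr R' (h f)).
  split; [exact/homogeneous_restr/hh|exact: supported_restr|].
  by rewrite -ldiff_R' // -restr_R'_L hE -(restr_id fR) restr_R'_R.
exists (restr R' (h f)); split=> //; exists (restr R (h f)); split.
- exact/homogeneous_restr/hh.
- exact: supported_restr.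
have -> : restr R' (h f) = h f - restr R (h f) by rewrite {2}(split_L hL) addrAC subrr add0r.
rewrite -restr_R_L raddfB raddfB /= hE.
by rewrite raddfB /= restr_R_L restr_id // opprB addrC subrK.
Qed.

End Step.

Fixpoint connect_map j f : coeffs :=
  if j is j'.+1 then connect_map j' (restr (neg_region j') (ldiff f)) else f.

Fact connect_map_linear j : linear (connect_map j).
Proof. by elim: j => [|j IH] c f g //=; rewrite !linearP IH. Qed.

HB.instance Definition _ j :=
  GRing.isLinear.Build k coeffs coeffs _ (connect_map j) (connect_map_linear j).

Lemma cycleB Q p e f g : is_cycle Q p e f -> is_cycle Q p e g -> is_cycle Q p e (f - g).
Proof.
move=> [fh fQ f0] [gh gQ g0]; split; [exact: homogeneousB|exact: supportedB|].
by rewrite !raddfB /= f0 g0 subrr.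
Qed.

Lemma boundaryD Q p e f g : is_boundary Q p e f -> is_boundary Q p e g -> is_boundary Q p e (f + g).
Proof.
move=> fB /boundaryN [g' [gh gQ gE]]; case: fB => [f' [fh fQ fE]].
exists (f' - g'); split; [exact: homogeneousB|exact: supportedB|].
by rewrite !raddfB /= -fE -gE opprK.
Qed.

(** The three clauses together say, on representatives, that [connect_map j] induces an isomorphism
    on homology. *)
Lemma connect_iso j p e : (j <= n.+1)%N ->
  let e' := e - (j * d)%:Z in
  [/\ forall f, is_cycle (neg_region j) (p + j)%N e' f ->
        is_cycle (neg_region 0) p e (connect_map j f),
      forall f, is_cycle (neg_region j) (p + j)%N e' f ->
        (is_boundary (neg_region 0) p e (connect_map j f) <->
         is_boundary (neg_region j) (p + j)%N e' f)
    & forall f, is_cycle (neg_region 0) p e f -> exists f',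
        is_cycle (neg_region j) (p + j)%N e' f' /\
        is_boundary (neg_region 0) p e (f - connect_map j f')].
Proof.
elim: j => [|j IH] jn /=.
  rewrite addn0 mul0n subr0. split=> [f fc|f _|f fc]; [exact: fc|exact: iff_refl|].
  exists f; split=> //; rewrite subrr.
  by exists 0; split=> //; rewrite (raddf0 ldiff) raddf0.
have [IH1 IH2 IH3] := IH (ltnW jn).
have -> : e - (j.+1 * d)%:Z = e - (j * d)%:Z - d%:Z.
  by rewrite mulSn PoszD opprD addrA addrAC.
rewrite addnS; pose j' := Ordinal jn; split=> f fc.
- by apply: IH1; apply: (@step_cycle j').
- have h1 := IH2 _ (@step_cycle j' _ _ _ fc).
  exact: (iff_trans h1 (@step_boundary j' _ _ _ fc)).
have [f1 [f1c f1b]] := IH3 f fc; have [f2 [f2c f2b]] := @step_surj j' _ _ _ f1c.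
exists f2; split=> //.
have -> : f - connect_map j (restr (neg_region j) (ldiff f2)) =
    (f - connect_map j f1) + connect_map j (f1 - restr (neg_region j) (ldiff f2)).
  by rewrite raddfB /= addrA subrK.
apply: boundaryD => //; apply/IH2 => //.
by apply: cycleB => //; apply: (@step_cycle j').
Qed.

End Lattice.

(** * Linear algebra of quotients and annihilators *)

Lemma dimv_quotient (K : fieldType) (Y A : vectType K) (L : 'Hom(Y, A)) (Z B : {vspace A}) :
  (B <= Z)%VS -> (forall y, L y \in Z) ->
  (forall z, z \in Z -> exists y, z - L y \in B) ->
  (\dim Z - \dim B = \dim (fullv : {vspace Y}) - \dim (L @^-1: B))%N.
Proof.
move=> BZ LZ ZL; set W := (L @^-1: B)%VS.
have ZE : Z = (limg L + B)%VS.
  apply/eqP; rewrite eqEsubv; apply/andP; split.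
    apply/subvP => z /ZL[y yB]; apply/memv_addP; exists (L y); first exact: memv_img (memvf _).
    by exists (z - L y) => //; rewrite addrC subrK.
  by rewrite subv_add BZ andbT; apply/subvP => _ /memv_imgP[y _ ->].
have capE : (limg L :&: B)%VS = (L @: W)%VS.
  apply/vspaceP => v; apply/memv_capP/memv_imgP => [[/memv_imgP[y _ ->] yB]|[y yW ->]].
    by exists y => //; rewrite -memv_preim.
  by rewrite -memv_preim in yW; split=> //; apply: memv_img (memvf _).
have kerW : (W :&: lker L)%VS = lker L.
  apply/capv_idPr/subvP => y; rewrite memv_ker -memv_preim => /eqP->.
  exact: mem0v.
have := limg_ker_dim L W; rewrite kerW -capE => dW.
have := limg_ker_dim L fullv; rewrite capfv => dY.
have := dimv_add_leqif (limg L) B => _.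
have := dimv_sum_cap (limg L) B; rewrite -ZE => dZ.
have := dimvS (subvf W); lia.
Qed.

(** Let [C] be a complement of [Wp]. The pairing embeds [W] into the dual of [C] by nondegeneracy,
    and [C] into the dual of [W] because [C] meets [Wp] in zero. *)
Lemma perp_dim (K : fieldType) (Y : vectType K) (phi : Y -> Y -> K) (W Wp : {vspace Y}) :
  (forall c x y z, phi (c *: x + y) z = c * phi x z + phi y z) ->
  (forall c x y z, phi z (c *: x + y) = c * phi z x + phi z y) ->
  (forall y, (forall z, phi y z = 0) -> y = 0) ->
  (forall g, g \in Wp <-> forall y, y \in W -> phi y g = 0) ->
  (\dim (fullv : {vspace Y}) - \dim W = \dim Wp)%N.
Proof.
move=> phil phir nd WpP.
have phil0 z : phi 0 z = 0 by have := phil (-1) 0 0 z; rewrite scaler0 addr0 mulN1r addNr.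
have phir0 z : phi z 0 = 0 by have := phir (-1) 0 0 z; rewrite scaler0 addr0 mulN1r addNr.
have span_r (U : {vspace Y}) y : (forall i : 'I_(\dim U), phi y (vbasis U)`_i = 0) ->
    forall z, z \in U -> phi y z = 0.
  move=> y0 z /coord_vbasis->; elim/big_rec: _ => // i x _ x0.
  by rewrite phir y0 mulr0 add0r.
have span_l (U : {vspace Y}) y : (forall i : 'I_(\dim U), phi (vbasis U)`_i y = 0) ->
    forall z, z \in U -> phi z y = 0.
  move=> y0 z /coord_vbasis->; elim/big_rec: _ => // i x _ x0.
  by rewrite phil y0 mulr0 add0r.
pose C := (Wp^C)%VS.
have C_le : (\dim W <= \dim C)%N.
  pose F (y : Y) : 'rV[K]_(\dim C) := \row_i phi y (vbasis C)`_i.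
  have F_lin : linear F by move=> c x y; apply/rowP=> i; rewrite !mxE phil.
  pose FL : {linear Y -> 'rV[K]_(\dim C)} := HB.pack F (GRing.isLinear.Build K _ _ _ F F_lin).
  rewrite -[leqRHS](@dim_rV K); apply: (dim_inj (f := linfun FL)) => y yW.
  rewrite lfunE => /rowP y0; apply: nd => z.
  have : z \in (Wp + C)%VS by rewrite addv_complf memvf.
  case/memv_addP => u uWp [v vC ->].
  rewrite -[u]scale1r phir (proj1 (WpP u) uWp) // mulr0 add0r.
  by apply: (span_r C) => // i; have := y0 i; rewrite !mxE.
have C_ge : (\dim C <= \dim W)%N.
  pose F (g : Y) : 'rV[K]_(\dim W) := \row_i phi (vbasis W)`_i g.
  have F_lin : linear F by move=> c x y; apply/rowP=> i; rewrite !mxE phir.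
  pose FL : {linear Y -> 'rV[K]_(\dim W)} := HB.pack F (GRing.isLinear.Build K _ _ _ F F_lin).
  rewrite -[leqRHS](@dim_rV K); apply: (dim_inj (f := linfun FL)) => g gC.
  rewrite lfunE => /rowP g0; apply/eqP; rewrite -memv0 -(capv_compl Wp) memv_cap gC andbT.
  apply/WpP; apply: span_l => i; by have := g0 i; rewrite !mxE.
have /eqP dC : \dim W == \dim C by rewrite eqn_leq C_le C_ge.
rewrite dC dimv_compl; have := dimvS (subvf Wp); lia.
Qed.

(** * Duality for the Veronese module *)

Section Embedding.
Variables (k : fieldType) (n : nat) (d : nat) (N : nat).

Local Notation lattice := {ffun 'I_n.+1 -> int}.
Local Notation coeffs := ({set 'I_N} -> lattice -> k^o).

Definition natm (a : lattice) : 'X_{1..n.+1} := [multinom `|a i|%N | i < n.+1].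

Lemma natm_lat m : natm (lat m) = m.
Proof. by apply/mnmP => i; rewrite mnmE ffunE. Qed.

Lemma lat_natm (a : lattice) : neg_region 0 a -> lat (natm a) = a.
Proof. by move=> /forallP a0; apply/ffunP => i; rewrite ffunE mnmE gez0_abs //; apply: a0. Qed.

Lemma ldeg_natm (a : lattice) : neg_region 0 a -> ldeg a = (mdeg (natm a))%:Z.
Proof. by move=> a0; rewrite -ldeg_lat lat_natm. Qed.

Lemma lat_region0 m : neg_region 0 (lat m : lattice).
Proof. by apply/forallP => i; rewrite ffunE. Qed.

Lemma region0B (a : lattice) m : neg_region 0 a ->
  neg_region 0 (a - lat m) = (m <= natm a)%MM.
Proof.
move=> /forallP a0; apply/forallP/mnm_lepP => [h i|h i]; have := h i; have := a0 i;
  by rewrite !ffunE mnmE /=; lia.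
Qed.

Lemma natmB (a : lattice) m : neg_region 0 a -> (m <= natm a)%MM ->
  natm (a - lat m) = (natm a - m)%MM.
Proof.
move=> /forallP a0 /mnm_lepP ma; apply/mnmP => i; have := ma i; have := a0 i.
by rewrite mnmBE !mnmE !ffunE /=; lia.
Qed.

Lemma mcoeff_homogM (p w : {mpoly k[n.+1]}) m : p \is d.-homog ->
  (p * w)@_m = \sum_(i < 'C(d + n, d)) p@_(monom i) *
    (if (monom i <= m)%MM then w@_(m - monom i) else 0).
Proof.
move=> pd; rewrite {1}(homog_sum_monom pd) mulr_suml raddf_sum; apply: eq_bigr => i _ /=.
rewrite -scalerAl mcoeffZ; congr (_ * _); rewrite mulrC; case: ifPn => le.
  by rewrite -{1}(submK le) addmC mcoeffMX.
apply/memN_msupp_eq0; apply: contra le => /msuppM_le/allpairsP[[m1 m2] /= [_ m2X ->]].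
by move: m2X; rewrite msuppX inE => /eqP->; apply: lem_addl.
Qed.

Definition emb (e : int) (f : {ffun {set 'I_N} -> H0 k n e}) : coeffs :=
  fun S a => if neg_region 0 a then (H0_val (f S))@_(natm a) else 0.

(** For negative [e] the projection is zero, whatever the absolute value of [e] contributes. *)
Definition unemb (e : int) (g : coeffs) : {ffun {set 'I_N} -> H0 k n e} :=
  [ffun S => H0_proj e (\sum_(i < 'C(`|e|%N + n, `|e|%N)) g S (lat (monom i)) *: 'X_[monom i])].

Lemma H0_val_coef e (u : H0 k n e) m : (mdeg m)%:Z != e -> (H0_val u)@_m = 0.
Proof.
case: e u => e u /=; last by rewrite mcoeff0.
by move=> me; apply: (@dhomog_nemf_coeff _ _ mdeg e) => //; apply: dhomog_is_dhomog.
Qed.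

Lemma emb_supported e f : supported (neg_region 0) (@emb e f).
Proof. by move=> S a; rewrite /emb => /negbTE->. Qed.

Lemma emb_inj e (f f' : {ffun {set 'I_N} -> H0 k n e}) : emb f = emb f' -> f = f'.
Proof.
move=> ff; apply/ffunP=> S; apply: H0_val_inj; apply/mpolyP => m.
have := congr1 (fun g : coeffs => g S (lat m)) ff.
by rewrite /emb lat_region0 natm_lat.
Qed.

Lemma emb_homogeneous e p (f : {ffun {set 'I_N} -> H0 k n e}) :
  (forall S : {set 'I_N}, #|S| != p -> f S = 0) <-> homogeneous p e (emb f).
Proof.
split=> [f0 S a|fh S Sp].
  rewrite /emb; case: ifP => // a0 /orP[/f0->|]; first by rewrite raddf0 mcoeff0.
  by rewrite ldeg_natm // => /H0_val_coef.
apply: H0_val_inj; apply/mpolyP => m; rewrite raddf0 mcoeff0.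
have := fh S (lat m); rewrite Sp /= /emb lat_region0 natm_lat; exact.
Qed.

Fact unemb_linear e : linear (@unemb e).
Proof.
move=> c f g; apply/ffunP=> S; rewrite !ffunE -H0_proj_linear scaler_sumr -big_split.
congr (H0_proj _ _); apply: eq_bigr => i _ /=.
by rewrite scalerA -scalerDl.
Qed.

HB.instance Definition _ e := GRing.isLinear.Build k coeffs
  {ffun {set 'I_N} -> H0 k n e} _ (@unemb e) (@unemb_linear e).

Fact emb_linear e : linear (@emb e).
Proof.
move=> c f g; apply/funext=> S; apply/funext=> a.
rewrite -[RHS]/(c *: emb f S a + emb g S a) /emb; case: ifP => _.
  by rewrite !ffunE linearP mcoeffD mcoeffZ.
by rewrite scaler0 addr0.
Qed.

HB.instance Definition _ e := GRing.isLinear.Build k {ffun {set 'I_N} -> H0 k n e} coeffs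
  _ (@emb e) (@emb_linear e).

Lemma unembK e p (g : coeffs) : homogeneous p e g -> supported (neg_region 0) g ->
  emb (unemb e g) = g.
Proof.
move=> gh gs; apply/funext=> S; apply/funext=> a; rewrite /emb.
case: ifPn => [a0|/gs->//]; rewrite ffunE.
have [/eqP ae|ae] := boolP (ldeg a == e); last first.
  by rewrite gh ?ae ?orbT // H0_val_coef // -ldeg_natm.
case: e gh ae => e gh ae; last by move: ae; rewrite ldeg_natm.
rewrite /= pihomog_dE; last exact: sum_monom_homog.
have [|i iE] := @monom_onto n e (natm a).
  by move: ae; rewrite ldeg_natm // => -[].
by rewrite -iE mcoeff_sum_monom iE lat_natm.
Qed.

End Embedding.

Lemma H0_valZ (k : fieldType) n m (c : k) (u : H0 k n m) : H0_val (c *: u) = c *: H0_val u.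
Proof. by rewrite -[c *: u]addr0 H0_val_linear raddf0 addr0. Qed.

Section Veronese.
Variables (k : fieldType) (n : nat) (b : int) (d : nat).

Local Notation V := (Vero k n d%:Z).
Local Notation N := (\dim (fullv : {vspace V})).
Local Notation lattice := {ffun 'I_n.+1 -> int}.
Local Notation coeffs := ({set 'I_N} -> lattice -> k^o).

Lemma dim_Vero : N = 'C(d + n, d).
Proof. by rewrite dimvf. Qed.

Definition vero_form (s : 'I_N) : {mpoly k[n.+1]} := H0_val (vbasis (fullv : {vspace V}))`_s.

Lemma vero_homog s : vero_form s \is d.-homog.
Proof. exact: dhomog_is_dhomog. Qed.

Lemma vero_free (x : 'I_N -> k) : \sum_s x s *: vero_form s = 0 -> forall s, x s = 0.
Proof.
move=> x0; apply/freeP; first exact: (basis_free (vbasisP fullv)).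
apply: (@H0_val_inj k n d%:Z); rewrite raddf0 -x0 raddf_sum.
by apply: eq_bigr => s _; exact: H0_valZ.
Qed.

Lemma vero_span (p : {mpoly k[n.+1]}) : p \is d.-homog ->
  exists x : 'I_N -> k, p = \sum_s x s *: vero_form s.
Proof.
move=> pd; pose u : V := DHomog pd.
exists (fun s => coord (vbasis fullv) s u).
rewrite -[LHS]/(@H0_val k n d%:Z u) {1}(coord_vbasis (memvf u)) raddf_sum.
by apply: eq_bigr => s _; exact: H0_valZ.
Qed.

(** The minus sign appears because [koszul_fun] counts positions from 1 and [ldiff] from 0. *)
Lemma emb_koszul i (f : extmod V (VeroMod k n b d i)) :
  emb (VeroKoszul k n b d i f) = - restr (neg_region 0) (ldiff d vero_form (emb f)).
Proof.
apply/funext=> T; apply/funext=> a.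
rewrite -[RHS]/(- restr (neg_region 0) (ldiff d vero_form (emb f)) T a) /restr /emb.
case: ifPn => [a0|_]; last by rewrite oppr0.
rewrite lfunE ffunE raddf_sum raddf_sum -sumrN; apply: eq_bigr => s sT.
etransitivity; first exact: (congr1 (mcoeff (natm a)) (H0_valZ _ _)).
have degE : b + i.+1%:Z * d%:Z = d%:Z + (b + i%:Z * d%:Z) by rewrite intS mulrDl mul1r addrCA.
rewrite mcoeffZ; etransitivity.
  exact: (congr1 (fun p => _ * mcoeff (natm a) p) (H0_val_mul _ _ degE)).
have -> : #|[set t in s |: T | (t <= s)%N]| = (pos T s).+1.
  rewrite (cardsD1 s) !inE eqxx leqnn add1n; congr _.+1; apply: eq_card => t.
  by rewrite !inE; case: (eqVneq t s) => [->|ts]; rewrite ?ltnn ?andbF //= ltn_neqAle ts.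
rewrite exprS mulN1r mulNr (mcoeff_homogM _ _ (vero_homog s)); congr (- (_ * _)).
apply: eq_bigr => j _; rewrite (region0B _ a0); congr (_ * _).
case: (boolP (monom j <= natm a)%MM) => [le|_]; last reflexivity.
rewrite (natmB a0 le); reflexivity.
Qed.

Lemma cyclesP p q (f : extmod V (VeroMod k n b d q)) :
  f \in koszul_cycles k n b d p q <->
  is_cycle d vero_form (neg_region 0) p (b + q%:Z * d%:Z) (emb f).
Proof.
rewrite memv_cap [X in _ && X]memv_ker; split.
  move=> /andP[/extpowP/emb_homogeneous fh /eqP f0]; split=> //; first exact: emb_supported.
  by rewrite -[LHS]opprK -emb_koszul f0 (raddf0 (@emb k n N _)) oppr0.
move=> [/emb_homogeneous fh _ f0]; apply/andP; split; first exact/extpowP.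
apply/eqP/(@emb_inj k n N); rewrite emb_koszul f0.
by rewrite oppr0 (raddf0 (@emb k n N _)).
Qed.

Lemma boundariesP p q (f : extmod V (VeroMod k n b d q)) : (0 < q)%N ->
  f \in koszul_boundaries k n b d p q <->
  is_boundary d vero_form (neg_region 0) p (b + q%:Z * d%:Z) (emb f).
Proof.
case: q f => // q f _.
have degE : b + q.+1%:Z * d%:Z - d%:Z = b + q%:Z * d%:Z.
  by rewrite intS mulrDl mul1r addrCA [_ - _]addrAC subrr add0r.
split=> [/memv_imgP[g /extpowP/emb_homogeneous gh ->]|[g [gh gs fE]]].
  exists (- emb g); split.
  - by rewrite degE => T a Ta; rewrite -[LHS]/(- (emb g T a)) gh ?oppr0.
  - by move=> T a Ta; rewrite -[LHS]/(- (emb g T a)) emb_supported ?oppr0.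
  by rewrite emb_koszul (raddfN (ldiff d vero_form)) (raddfN (restr _)).
rewrite degE in gh.
have gK := unembK gh gs.
apply/memv_imgP; exists (- unemb _ g).
  rewrite memvN; apply/extpowP/emb_homogeneous.
  by rewrite gK.
by apply: (@emb_inj k n N); rewrite raddfN /= raddfN /= emb_koszul gK opprK.
Qed.

End Veronese.

(** * The negative region and its dual *)

Section NegativeRegion.
Variables (k : fieldType) (n N c p : nat).

Local Notation lattice := {ffun 'I_n.+1 -> int}.
Local Notation coeffs := ({set 'I_N} -> lattice -> k^o).
Local Notation ext := {ffun {set 'I_N} -> 'rV[k]_('C(c + n, c))}.

(* The Laurent monomials with all exponents negative are [1 / (x_0 ... x_n m)]. *)
Definition neg_lat (m : 'X_{1..n.+1}) : lattice := [ffun i => - (m i)%:Z - 1].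
Definition neg_natm (a : lattice) : 'X_{1..n.+1} := [multinom (`|a i|%N).-1 | i < n.+1].

Lemma neg_lat_region m : neg_region n.+1 (neg_lat m).
Proof. by apply/forallP => i; rewrite ltn_ord ffunE; lia. Qed.

Lemma neg_latK m : neg_natm (neg_lat m) = m.
Proof. by apply/mnmP => i; rewrite mnmE ffunE; lia. Qed.

Lemma neg_natmK a : neg_region n.+1 a -> neg_lat (neg_natm a) = a.
Proof.
move=> /forallP a0; apply/ffunP => i; have := a0 i.
by rewrite ltn_ord /= ffunE mnmE; lia.
Qed.

Lemma neg_latB m m' : neg_lat m - lat m' = neg_lat (m + m')%MM.
Proof. by apply/ffunP => i; rewrite !ffunE mnmDE; lia. Qed.

Lemma ldeg_neg_lat m : ldeg (neg_lat m) = - (mdeg m + n.+1)%N%:Z.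
Proof.
rewrite /ldeg mdegE (eq_bigr (fun i => - (m i)%:Z - 1)); last by move=> i _; rewrite ffunE.
rewrite big_split /= !sumrN PoszD opprD (big_morph Posz PoszD erefl).
by rewrite sumr_const card_ord natz.
Qed.

Definition neg_fun (y : ext) : coeffs := fun T a =>
  if neg_region n.+1 a && (#|T| == p) then \sum_j y T 0 j *+ (neg_natm a == monom j) else 0.

Fact neg_fun_linear : linear neg_fun.
Proof.
move=> x f g; apply/funext=> T; apply/funext=> a.
rewrite -[RHS]/(x *: neg_fun f T a + neg_fun g T a) /neg_fun; case: ifP => _.
  by rewrite scaler_sumr -big_split; apply: eq_bigr => j _; rewrite !ffunE !mxE mulrnDl -mulrnAr.
by rewrite scaler0 addr0.
Qed.

HB.instance Definition _ := GRing.isLinear.Build k ext coeffs _ neg_fun neg_fun_linear.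

Lemma neg_fun_neg_lat y (T : {set 'I_N}) m :
  neg_fun y T (neg_lat m) = if #|T| == p then \sum_j y T 0 j *+ (m == monom j) else 0.
Proof. by rewrite /neg_fun neg_lat_region neg_latK. Qed.

Lemma neg_fun_monom y (T : {set 'I_N}) j : #|T| = p -> neg_fun y T (neg_lat (monom j)) = y T 0 j.
Proof.
move=> Tp; rewrite neg_fun_neg_lat Tp eqxx (bigD1 j) //= eqxx mulr1n big1 ?addr0 // => i ij.
by rewrite (inj_eq (@monom_inj n c)) eq_sym (negbTE ij).
Qed.

Lemma neg_fun_supported y : supported (neg_region n.+1) (neg_fun y).
Proof. by move=> T a /negbTE a0; rewrite /neg_fun a0. Qed.

Lemma neg_fun_homogeneous y : homogeneous p (- (c + n.+1)%N%:Z) (neg_fun y).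
Proof.
move=> T a Ta; rewrite /neg_fun; case: ifP => // /andP[a0 Tp].
move: Ta; rewrite Tp /= => Ta; apply: big1 => j _; case: eqP => // aj.
by move: Ta; rewrite -(neg_natmK a0) aj ldeg_neg_lat mdeg_monom eqxx.
Qed.

Lemma eq_neg_homogeneous (f g : coeffs) :
  homogeneous p (- (c + n.+1)%N%:Z) f -> supported (neg_region n.+1) f ->
  homogeneous p (- (c + n.+1)%N%:Z) g -> supported (neg_region n.+1) g ->
  (forall (T : {set 'I_N}) j, #|T| = p ->
    f T (neg_lat (monom (d := c) j)) = g T (neg_lat (monom j))) -> f = g.
Proof.
move=> fh fs gh gs fg; apply/funext=> T; apply/funext=> a.
have [a0|a0] := boolP (neg_region n.+1 a); last by rewrite fs // gs.
have [|/norP[/negPn/eqP Tp /negPn/eqP ac]] := boolP ((#|T| != p) || (ldeg a != - (c + n.+1)%N%:Z)).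
  by move=> Ta; rewrite fh // gh.
have [|j jE] := @monom_onto n c (neg_natm a).
  by move: ac; rewrite -{1}(neg_natmK a0) ldeg_neg_lat; lia.
by rewrite -(neg_natmK a0) -jE fg.
Qed.

Lemma neg_fun_onto f : homogeneous p (- (c + n.+1)%N%:Z) f -> supported (neg_region n.+1) f ->
  exists y, f = neg_fun y.
Proof.
move=> fh fs; exists [ffun T => \row_j f T (neg_lat (monom j))].
apply: eq_neg_homogeneous fh fs _ _ _ => [||T j Tp].
- exact: neg_fun_homogeneous.
- exact: neg_fun_supported.
by rewrite neg_fun_monom // ffunE mxE.
Qed.

End NegativeRegion.

Section Duality.
Variables (k : fieldType) (n N c d : nat) (E : 'I_N -> {mpoly k[n.+1]}).
Hypothesis E_homog : forall s, E s \is d.-homog.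

Local Notation m := 'C(c + n, c).
Local Notation w := (fun j : 'I_m => 'X_[monom j] : {mpoly k[n.+1]}).
Local Notation ext := {ffun {set 'I_N} -> 'rV[k]_m}.
Local Notation ext' := {ffun {set 'I_N} -> 'rV[k]_('C(c + d + n, c + d))}.
Local Notation R := (@neg_region n n.+1).

(** The differential lands in degree [d - c - n - 1], above [-n - 1], the largest degree of a
    monomial with all exponents negative. *)
Lemma neg_fun_cycle p (y : ext) : (c < d)%N ->
  is_cycle d E R p.+1 (- (c + n.+1)%N%:Z) (neg_fun p.+1 y).
Proof.
move=> c_lt_d; split; [exact: neg_fun_homogeneous|exact: neg_fun_supported|].
have dh : homogeneous p (- (c + n.+1)%N%:Z + d%:Z) (ldiff d E (neg_fun p.+1 y)).
  by apply: homogeneous_ldiff; rewrite addrK; apply: neg_fun_homogeneous.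
apply/funext=> T; apply/funext=> a; rewrite /restr; case: ifP => // a0.
by rewrite dh // -(neg_natmK a0) ldeg_neg_lat; apply/orP; right; apply/eqP; lia.
Qed.

(* In the monomial bases, the Koszul differential into the negative region is the
   transpose of [create E], see [transpose_create]. *)
Definition transpose (G : ext') (T : {set 'I_N}) (j : 'I_m) : k :=
  \sum_(s | s \notin T) (-1) ^+ pos T s *
    \sum_l G (s |: T) 0 l * (E s * 'X_[monom j])@_(monom l).

Lemma ldiff_neg_fun p (G : ext') (T : {set 'I_N}) j : #|T| = p ->
  ldiff d E (neg_fun p.+1 G) T (neg_lat (monom j)) = transpose G T j.
Proof.
move=> Tp; apply: eq_bigr => s sT; congr (_ * _).
have FE l : (E s * 'X_[monom j])@_(monom l) =
    \sum_i (E s)@_(monom i) *+ ((monom j + monom (d := d) i)%MM == monom (d := c + d) l).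
  rewrite {1}(homog_sum_monom (E_homog s)) mulr_suml raddf_sum; apply: eq_bigr => i _ /=.
  by rewrite -scalerAl mcoeffZ -mpolyXD mcoeffX addmC mulr_natr.
under [RHS]eq_bigr do rewrite FE mulr_sumr.
rewrite exchange_big; apply: eq_bigr => i _ /=.
rewrite neg_latB neg_fun_neg_lat cardsU1 sT Tp eqxx mulr_sumr; apply: eq_bigr => l _.
by rewrite !mulrnAr mulrC.
Qed.

Lemma neg_fun_boundary p (y : ext) :
  is_boundary d E R p (- (c + n.+1)%N%:Z) (neg_fun p y) <->
  exists G : ext', forall (T : {set 'I_N}) j, #|T| = p -> y T 0 j = transpose G T j.
Proof.
have degE : - (c + n.+1)%N%:Z - d%:Z = - (c + d + n.+1)%N%:Z by lia.
split=> [[g [gh gs gE]]|[G GE]].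
  rewrite degE in gh; have [G GE] := neg_fun_onto gh gs.
  exists G => T j Tp; rewrite -(ldiff_neg_fun _ _ Tp) -GE -(neg_fun_monom _ _ Tp) gE.
  by rewrite /restr neg_lat_region.
exists (neg_fun p.+1 G); split.
- by rewrite degE; apply: neg_fun_homogeneous.
- exact: neg_fun_supported.
apply: eq_neg_homogeneous => [||||T j Tp].
- exact: neg_fun_homogeneous.
- exact: neg_fun_supported.
- by apply/homogeneous_restr/homogeneous_ldiff; rewrite degE; apply: neg_fun_homogeneous.
- exact: supported_restr.
by rewrite neg_fun_monom // /restr neg_lat_region ldiff_neg_fun // GE.
Qed.

(** Both sides sum over pairs of [T] and [s] outside [T], matched by [S = s |: T]. *)
Lemma transpose_create (G : ext') (g : ext) :
  \sum_T \sum_j transpose G T j * g T 0 j =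
  \sum_S \sum_l G S 0 l * (create E (lin_form w g) S)@_(monom l).
Proof.
pose F (s : 'I_N) (S T : {set 'I_N}) : k :=
  (-1) ^+ pos T s * \sum_j (\sum_l G S 0 l * (E s * 'X_[monom j])@_(monom l)) * g T 0 j.
transitivity (\sum_(T : {set 'I_N}) \sum_(s | s \notin T) F s (s |: T) T).
  apply: eq_bigr => T _; rewrite /transpose; under eq_bigr do rewrite mulr_suml.
  rewrite exchange_big; apply: eq_bigr => s _; rewrite /F mulr_sumr.
  by apply: eq_bigr => j _; rewrite mulrA.
transitivity (\sum_(S : {set 'I_N}) \sum_(s in S) F s S (S :\ s)); last first.
  apply: eq_bigr => S _; under [RHS]eq_bigr do rewrite raddf_sum mulr_sumr.
  rewrite exchange_big; apply: eq_bigr => s sS; rewrite /F mulr_sumr.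
  rewrite (pos_setD1 s sS) ltnn add0n.
  transitivity (\sum_j \sum_l (-1) ^+ pos (S :\ s) s *
      (G S 0 l * (E s * 'X_[monom j])@_(monom l) * g (S :\ s) 0 j)).
    by apply: eq_bigr => j _; rewrite mulr_suml mulr_sumr.
  rewrite exchange_big; apply: eq_bigr => l _ /=.
  rewrite /lin_form mulr_sumr mulr_sumr raddf_sum mulr_sumr; apply: eq_bigr => j _ /=.
  by rewrite raddfMsign /= -scalerAr mcoeffZ; ring.
rewrite (exchange_big_dep predT) //= [RHS](exchange_big_dep predT) //=.
apply: eq_bigr => s _; rewrite (reindex_onto (fun S : {set 'I_N} => S :\ s) (fun T => s |: T)) /=.
  apply: eq_big => [S|S]; last by move=> /andP[_ /eqP->].
  by rewrite !inE eqxx /=; apply/eqP/idP => [<-|sS]; rewrite ?setU11 ?setD1K.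
by move=> T sT; rewrite setU1K.
Qed.

End Duality.

Lemma pos_setC N (T : {set 'I_N}) s : (pos T s + pos (~: T) s)%N = s.
Proof.
have -> : (pos T s + pos (~: T) s)%N = \sum_(t < N | (t < s)%N) 1.
  rewrite (bigID (fun t => t \in T)) /= !sum1_card.
  by congr (_ + _)%N; apply: eq_card => t; rewrite !inE andbC.
by rewrite (big_ord_narrow (ltnW (ltn_ord s))) sum1_card card_ord.
Qed.

Section Star.
Variables (k : fieldType) (n N m : nat) (E : 'I_N -> {mpoly k[n.+1]}) (w : 'I_m -> {mpoly k[n.+1]}).
Local Notation ext := {ffun {set 'I_N} -> 'rV[k]_m}.

(* The sign turning [pos T s] into [pos (~: T) s], by [pos_setC]. *)
Definition eps (T : {set 'I_N}) : k := \prod_(t in T) (-1) ^+ t.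

Lemma eps_setU1 s (T : {set 'I_N}) : s \notin T -> eps (s |: T) = (-1) ^+ s * eps T.
Proof. by move=> sT; rewrite /eps big_setU1. Qed.

Lemma eps_neq0 T : eps T != 0.
Proof. by apply/prodf_neq0 => t _; rewrite signr_eq0. Qed.

(** The Hodge star of the chosen basis, up to a sign depending only on the exterior degree. *)
Definition star (f : ext) : ext := [ffun T => eps (~: T) *: f (~: T)].

Lemma create_star f T :
  create E (lin_form w (star f)) (~: T) = eps T *: contract E (lin_form w f) T.
Proof.
rewrite scaler_sumr; apply: eq_big => [s|s]; rewrite inE // => sT.
have -> : lin_form w (star f) (~: T :\ s) = eps (s |: T) *: lin_form w f (s |: T).
  rewrite scaler_sumr; apply: eq_bigr => j _; rewrite scalerA ffunE mxE.
  suff -> : ~: (~: T :\ s) = s |: T by [].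
  by apply/setP=> t; rewrite !inE; case: (t == s); case: (t \in T).
have signZ q (p : {mpoly k[n.+1]}) : (-1) ^+ q *: p = (-1) ^+ q * p.
  by rewrite -[in LHS]signr_odd -[in RHS]signr_odd scaler_sign mulr_sign.
rewrite eps_setU1 // -!scalerAr [_ * eps T]mulrC -scalerA signZ; congr (_ *: _).
rewrite mulrA -exprD -{1}(pos_setC T s) -addnA exprD addnn -mul2n exprM.
by rewrite sqrrN !expr1n mulr1.
Qed.

Lemma starP p (f : ext) : (p <= N)%N -> koszul_kernel E w (N - p)%N f <->
  (forall T : {set 'I_N}, #|T| != p -> star f T = 0) /\
  (forall S, create E (lin_form w (star f)) S = 0).
Proof.
move=> pN; split=> [[fp fk]|[fp fk]]; split=> T.
- move=> Tp; rewrite ffunE fp ?scaler0 //; apply: contra Tp.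
  by move=> /eqP; have := cardsC T; rewrite card_ord; lia.
- by rewrite -[T]setCK create_star fk scaler0.
- move=> Tp; have := fp (~: T); rewrite ffunE setCK => f0.
  have /eqP : eps T *: f T = 0.
    by apply: f0; apply: contra Tp => /eqP Tp; have := cardsC T; rewrite card_ord; lia.
  by rewrite scaler_eq0 (negbTE (eps_neq0 T)) => /eqP.
have /eqP := create_star f T; rewrite fk eq_sym scaler_eq0 (negbTE (eps_neq0 T)).
by move=> /eqP.
Qed.

End Star.

Section Pairing.
Variables (k : fieldType) (n N c d : nat) (E : 'I_N -> {mpoly k[n.+1]}).
Hypothesis E_homog : forall s, E s \is d.-homog.

Local Notation m := 'C(c + n, c).
Local Notation w := (fun j : 'I_m => 'X_[monom j] : {mpoly k[n.+1]}).
Local Notation ext := {ffun {set 'I_N} -> 'rV[k]_m}.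
Local Notation ext' := {ffun {set 'I_N} -> 'rV[k]_('C(c + d + n, c + d))}.

Definition star_pairing (y f : ext) : k := \sum_T \sum_j y T 0 j * star f T 0 j.

Lemma star_pairing_nondeg y : (forall f, star_pairing y f = 0) -> y = 0.
Proof.
move=> y0; apply/ffunP=> T; apply/rowP=> j; rewrite ffunE mxE.
have := y0 [ffun S => if S == ~: T then delta_mx 0 j else 0].
rewrite /star_pairing (bigD1 T) //= (bigD1 j) //= big1 => [|i ij]; last first.
  by rewrite !ffunE eqxx !mxE (negbTE ij) andbF !mulr0.
rewrite big1 => [|S ST]; last first.
  apply: big1 => i _; rewrite !ffunE (inj_eq (@setC_inj _)) (negbTE ST).
  by rewrite !mxE !mulr0.
rewrite !addr0 !ffunE eqxx !mxE !eqxx mulr1 => /eqP.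
by rewrite mulf_eq0 (negbTE (eps_neq0 _ _)) orbF => /eqP.
Qed.

Lemma create_homog (g : ext) S : create E (lin_form w g) S \is (c + d).-homog.
Proof.
apply: rpred_sum => s _; rewrite -signr_odd mulr_sign.
have sg : E s * lin_form w g (S :\ s) \is (c + d).-homog.
  by rewrite [(c + d)%N]addnC; apply: dhomogM => //; apply: sum_monom_homog.
by case: odd; rewrite ?rpredN.
Qed.

(** Since [y] is constrained in exterior degree [p] only, testing on the other degrees forces
    [star f] into degree [p]. Testing on the transpose of a unit vector gives one coefficient of
    [create E], by [transpose_create]. *)
Lemma koszul_kernel_pairing p f : (p <= N)%N ->
  koszul_kernel E w (N - p)%N f <->
  forall y : ext,
    (exists G : ext', forall (T : {set 'I_N}) j, #|T| = p -> y T 0 j = transpose E G T j) ->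
    star_pairing y f = 0.
Proof.
move=> pN; split=> [/(starP _ _ _ pN)[fp fk] y [G yG]|f0].
  transitivity (\sum_T \sum_j transpose E G T j * star f T 0 j).
    apply: eq_bigr => T _; apply: eq_bigr => j _.
    by have [/yG->//|/fp->] := eqVneq #|T| p; rewrite !mxE !mulr0.
  rewrite transpose_create big1 // => S _; apply: big1 => l _.
  by rewrite fk mcoeff0 mulr0.
have fp (T : {set 'I_N}) : #|T| != p -> star f T = 0.
  move=> Tp; apply/rowP=> j; rewrite mxE.
  have := f0 [ffun S => if S == T then delta_mx 0 j else 0].
  rewrite /star_pairing (bigD1 T) //= (bigD1 j) //= big1 => [|i ij]; last first.
    by rewrite ffunE eqxx !mxE (negbTE ij) andbF mul0r.
  rewrite big1 => [|S ST]; last first.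
    by apply: big1 => i _; rewrite ffunE (negbTE ST) mxE mul0r.
  rewrite !addr0 ffunE eqxx !mxE !eqxx mul1r; apply.
  exists 0 => S i Sp; rewrite ffunE; case: eqP => [ST|_]; first by rewrite -ST Sp eqxx in Tp.
  rewrite mxE /transpose big1 // => s _; rewrite big1 ?mulr0 // => l _.
  by rewrite ffunE mxE mul0r.
apply/starP => //; split=> // S; apply/mpolyP => mon; rewrite mcoeff0.
have [/monom_onto[l <-]|ne] := eqVneq (mdeg mon) (c + d)%N; last first.
  by apply: (dhomog_nemf_coeff (create_homog _ _)).
pose G : ext' := [ffun S' => if S' == S then delta_mx 0 l else 0].
have := f0 [ffun T => \row_j transpose E G T j].
rewrite /star_pairing; under eq_bigr do under eq_bigr do rewrite ffunE mxE.
rewrite transpose_create (bigD1 S) //= (bigD1 l) //= big1 => [|i il]; last first.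
  by rewrite ffunE eqxx !mxE (negbTE il) andbF mul0r.
rewrite big1 => [|S' ST]; last first.
  by apply: big1 => i _; rewrite ffunE (negbTE ST) mxE mul0r.
rewrite !addr0 ffunE eqxx !mxE !eqxx mul1r; apply.
by exists G => T j _; rewrite ffunE mxE.
Qed.

End Pairing.

Section KoszulDuality.
Variables (k : fieldType) (n : nat) (b : int) (d c p : nat).

Local Notation V := (Vero k n d%:Z).
Local Notation N := (\dim (fullv : {vspace V})).
Local Notation m := 'C(c + n, c).
Local Notation w := (fun j : 'I_m => 'X_[monom j] : {mpoly k[n.+1]}).
Local Notation ext := {ffun {set 'I_N} -> 'rV[k]_m}.
Local Notation vero_form := (@vero_form k n d).

Hypothesis n_gt0 : (0 < n)%N.
Hypothesis c_lt_d : (c < d)%N.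
Hypothesis bE : b = d%:Z - (c + n.+1)%N%:Z.
Hypothesis p_le : (p + n.+1 <= N)%N.

Local Notation degree := (b + n%:Z * d%:Z).

Definition dual_map (y : ext) : extmod V (VeroMod k n b d n) :=
  unemb degree (connect_map d vero_form n.+1 (neg_fun (p + n.+1)%N y)).

Fact dual_map_linear : linear dual_map.
Proof. by move=> x y z; rewrite /dual_map neg_fun_linear connect_map_linear unemb_linear. Qed.

HB.instance Definition _ := GRing.isLinear.Build k ext (extmod V (VeroMod k n b d n)) _
  dual_map dual_map_linear.

Lemma degree_shift : degree - (n.+1 * d)%N%:Z = - (c + n.+1)%N%:Z.
Proof. by rewrite bE; lia. Qed.

(** [dual_map] is onto modulo boundaries, so the homology is [ext] modulo the preimage of the
    boundaries, of the same dimension as the annihilator of that preimage. The exterior degrees of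
    [ext] other than [p + n + 1] lie in the preimage and do not count. *)
Lemma kappa_koszul_kernel (U : {vspace ext}) :
  (forall f, f \in U <-> koszul_kernel vero_form w (N - (p + n.+1))%N f) ->
  kappa k n b d p n = \dim U.
Proof.
move=> UP.
have [+ + +] := connect_iso (@vero_span k n d) p degree (leqnn n.+1).
rewrite degree_shift => iso1 iso2 iso3.
have ncycle (y : ext) :
    is_cycle d vero_form (neg_region n.+1) (p + n.+1)%N (- (c + n.+1)%N%:Z) (neg_fun (p + n.+1)%N y).
  by rewrite [(p + n.+1)%N]addnS; apply: neg_fun_cycle.
pose L := linfun dual_map.
have embL y : emb (L y) = connect_map d vero_form n.+1 (neg_fun (p + n.+1)%N y).
  by rewrite lfunE /=; have [h s _] := iso1 _ (ncycle y); apply: unembK h s.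
have WP y : y \in (L @^-1: koszul_boundaries k n b d p n)%VS <->
    exists G : {ffun {set 'I_N} -> 'rV[k]_('C(c + d + n, c + d))},
      forall (T : {set 'I_N}) j, #|T| = (p + n.+1)%N -> y T 0 j = transpose vero_form G T j.
  rewrite -memv_preim; apply: iff_trans (boundariesP _ _ n_gt0) _; rewrite embL.
  apply: iff_trans (iso2 _ (ncycle y)) _.
  exact: neg_fun_boundary (@vero_homog k n d) _ _.
rewrite /kappa (dimv_quotient (L := L)).
- apply: (perp_dim (phi := @star_pairing k n N c)).
  - move=> x y z t; rewrite /star_pairing mulr_sumr -big_split; apply: eq_bigr => T _.
    rewrite mulr_sumr -big_split; apply: eq_bigr => j _ /=.
    by rewrite !ffunE !mxE; ring.
  - move=> x y z t; rewrite /star_pairing mulr_sumr -big_split; apply: eq_bigr => T _.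
    rewrite mulr_sumr -big_split; apply: eq_bigr => j _ /=.
    by rewrite !ffunE !mxE; ring.
  - exact: star_pairing_nondeg.
  move=> g; apply: iff_trans (UP g) _.
  apply: iff_trans (koszul_kernel_pairing (@vero_homog k n d) _ p_le) _.
  by split=> h y /WP; apply: h.
- exact: koszul_boundaries_sub.
- by move=> y; apply/cyclesP; rewrite embL; apply: iso1.
move=> z /cyclesP/iso3[f' [[f'h f's f'c] f'b]].
have [y f'E] := neg_fun_onto f'h f's; exists y.
by apply/(boundariesP _ _ n_gt0); rewrite raddfB /= embL -f'E.
Qed.

End KoszulDuality.

(** * The first nonzero entry of the row *)

Lemma bin_dim_gap n c d : (0 < n)%N -> (c < d)%N -> ('C(c + n, c) + n <= 'C(d + n, d))%N.
Proof.
case: n => // n _; case: d => // d; rewrite ltnS => cd.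
have h : ('C(c + n.+1, c) <= 'C(d + n.+1, d))%N.
  rewrite -[in leqLHS](bin_sub (leq_addr n.+1 c)) addKn -(bin_sub (leq_addr n.+1 d)) addKn.
  by apply: leq_bin2l; rewrite leq_add2r.
have -> : 'C(d.+1 + n.+1, d.+1) = ('C(d + n.+1, d) + 'C(d.+1 + n, d.+1))%N.
  by rewrite addSn binS addnC addSnnS.
apply: leq_add => //; rewrite -(bin_sub (leq_addr n d.+1)) addKn.
apply: leq_trans (_ : 'C(n.+1, n) <= _)%N; first by rewrite binSn.
by apply: leq_bin2l; lia.
Qed.

Lemma koszul_kernel_space (K : fieldType) n N m (e : 'I_N -> {mpoly K[n]})
    (w : 'I_m -> {mpoly K[n]}) p :
  exists U : {vspace {ffun {set 'I_N} -> 'rV[K]_m}},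
    forall f, f \in U <-> koszul_kernel e w p f.
Proof.
have [k0 kD] := koszul_kernel_lin e w p.
exact: (subspace_exists k0 kD).
Qed.

Theorem theorem4 (k : fieldType) (n : nat) (b d : int)
    (hn : (1 <= n)%N) (hb : - n%:Z <= b) (hd : b + n%:Z + 1 <= d) :
  exists p : nat,
    [/\ p%:Z = 'C(`|d|%N + n, `|d|%N)%:Z - 'C(`|(d - b - 1)%R|%N, n)%:Z - n%:Z,
        forall p' : nat, (p' < p)%N -> kappa k n b d p' n = 0%N,
        kappa k n b d p n <> 0%N
      & kappa k n b d p n =
          'C('C(`|(b + 2 * n%:Z + 1)%R|%N, n) + 'C(`|(d - b - 1)%R|%N, n) - 2,
             'C(`|(d - b - 1)%R|%N, n) - 1)].
Proof.
have [d' dE] : exists d', d = Posz d' by exists `|d|%N; lia.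
subst d; have [c cE] : exists c, d'%:Z - b - n%:Z - 1 = Posz c by exists `|(d'%:Z - b - n%:Z - 1)%R|%N; lia.
have bE : b = d'%:Z - (c + n.+1)%N%:Z by lia.
have cd : (c < d')%N by lia.
pose N := \dim (fullv : {vspace Vero k n d'%:Z}).
have NE : N = 'C(d' + n, d') := dim_Vero k n d'.
have -> : `|(d'%:Z - b - 1)%R|%N = (c + n)%N by lia.
have -> : `|(b + 2 * n%:Z + 1)%R|%N = (d' - c + n)%N by lia.
have binE x : 'C(x + n, n) = 'C(x + n, x) by rewrite -(bin_sub (leq_addr n x)) addKn.
rewrite !binE /=; set m := 'C(c + n, c); set s0 := 'C(d' - c + n, d' - c).
have m_gt0 : (0 < m)%N by rewrite bin_gt0 leq_addr.
have s0_gt0 : (0 < s0)%N by rewrite bin_gt0 leq_addr.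
(* This makes [N - m - n] a true difference, as the integer formula for [p] requires. *)
have gap : (m + n <= N)%N by rewrite NE; apply: bin_dim_gap.
have kE p : (p + n.+1 <= N)%N -> exists U : {vspace {ffun {set 'I_N} -> 'rV[k]_m}},
    (forall f, f \in U <-> koszul_kernel (@vero_form k n d')
       (fun j : 'I_m => 'X_[monom j]) (N - (p + n.+1))%N f) /\ kappa k n b d' p n = \dim U.
  move=> pN; have [U UP] := koszul_kernel_space (@vero_form k n d')
    (fun j : 'I_m => 'X_[monom j]) (N - (p + n.+1))%N.
  exists U; split=> //; apply: (kappa_koszul_kernel hn cd bE pN UP).
have e_homog := @vero_homog k n d'; have e_free := @vero_free k n d'.
(* The complementary exterior degree [N - (p + n + 1)] is at least [m] here, and equals [m - 1] at
   [p = N - m - n]. *)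
have vanish p : (p < N - m - n)%N -> kappa k n b d' p n = 0%N.
  move=> pN; have [|U [UP ->]] := kE p; first by lia.
  apply/eqP; rewrite dimv_eq0; apply/eqP/vspaceP => f; rewrite memv0.
  apply/idP/eqP => [/UP fk|->]; last exact: mem0v.
  by apply: koszul_kernel_eq0 fk => //; lia.
have kp : kappa k n b d' (N - m - n) n = 'C(s0 + m - 2, m - 1).
  have [|U [UP ->]] := kE (N - m - n)%N; first by lia.
  have pE : (N - (N - m - n + n.+1) = m.-1)%N by lia.
  rewrite pE in UP.
  have -> : (s0 + m - 2 = s0 + m.-1 - 1)%N by lia.
  rewrite [(m - 1)%N]subn1; apply/eqP; rewrite eqn_leq; apply/andP; split.
    by apply: koszul_kernel_dim => // f /UP.
  have [U' [U'k dU']] := koszul_kernel_dim_ge (ltnW cd) (@vero_span k n d').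
  apply: (@leq_trans (\dim U')); first by rewrite dU'.
  by apply/dimvS/subvP => f /U'k/UP.
exists (N - m - n)%N; split=> //; first by lia.
by rewrite kp; apply/eqP; rewrite -lt0n bin_gt0; lia.
Qed.
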